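(* Let $V\models\mathsf{ZFC}$, let $G_0\subseteq\mathbb P=\mathrm{Add}(\omega,\omega_1)$ be $V$-generic, let $\mathcal N=\mathrm{HS}^{G_0}$ be the symmetric extension of $V$ determined by $\mathbb P$, the group $\mathcal G=\mathrm{Sym}(\omega_1)$ and the countable-support filter $\mathcal F$, and let $A=\{c_\alpha:\alpha<\omega_1\}$ be the set of Cohen reals added by $G_0$. Then in $\mathcal N$ the set $A$ is not well-orderable. In particular, $\mathcal N$ satisfies the negation of the well-ordering principle (every set is well-orderable), and hence $\mathcal N\models\neg\mathsf{AC}$.
   Context: $\mathbb P=\mathrm{Add}(\omega,\omega_1)=\mathrm{Fn}(\omega_1\times\omega,2,{<}\omega)$ is the set of finite partial functions from $\omega_1\times\omega$ to $2$, ordered by reverse inclusion, as defined in $V$. $\mathcal G=\mathrm{Sym}(\omega_1)$ is the group of all permutations of $\omega_1$; $\pi\in\mathcal G$ acts on $\mathbb P$ by $\mathrm{dom}(\pi p)=\{(\pi(\alpha),n):(\alpha,n)\in\mathrm{dom}(p)\}$, $(\pi p)(\pi(\alpha),n)=p(\alpha,n)$, and on $\mathbb P$-names by $\pi\dot x=\{\langle\pi\dot y,\pi p\rangle:\langle\dot y,p\rangle\in\dot x\}$. For $E\subseteq\omega_1$, $\mathrm{Fix}(E)=\{\pi\in\mathcal G:\pi\restriction E=\mathrm{id}_E\}$. $\mathcal F$ is the normal filter of subgroups of $\mathcal G$ (closed upward, under finite intersections, and under conjugation) generated by $\{\mathrm{Fix}(E):E\in[\omega_1]^{\le\omega}\}$,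 where countability is computed in $V$. A name $\dot x$ is symmetric if $\mathrm{Stab}(\dot x)=\{\pi\in\mathcal G:\pi\dot x=\dot x\}\in\mathcal F$; $\dot x\in\mathrm{HS}$ if $\dot x$ is symmetric and every name appearing in $\dot x$ is in $\mathrm{HS}$. $\mathrm{HS}^{G_0}=\{\dot x^{G_0}:\dot x\in\mathrm{HS}\}$. For $\alpha<\omega_1$, $\dot c_\alpha=\{\langle\check n,p\rangle:p\in\mathbb P,\ (\alpha,n)\in\mathrm{dom}(p),\ p(\alpha,n)=1\}$ and $c_\alpha=\dot c_\alpha^{G_0}$ (a subset of $\omega$, identified with an element of $2^\omega$); $\dot A=\{\langle\dot c_\alpha,\mathbf 1_{\mathbb P}\rangle:\alpha<\omega_1\}$ and $A=\dot A^{G_0}$, which belongs to $\mathcal N$. *)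

(* Defs.v *)
From Stdlib Require Import Setoid Morphisms.

Set Implicit Arguments.
Unset Strict Implicit.
Unset Printing Implicit Defensive.

(* The ambient universe: well-founded trees, read as sets up to extensional
   equality.  A ground model is a transitive class of this universe, and its
   extensions are classes of the same universe. *)

Inductive ens : Type := sup (I : Type) (f : I -> ens).

Definition idx (x : ens) : Type := let (I, _) := x in I.
Definition elt (x : ens) : idx x -> ens :=
  match x with sup f => f end.

Fixpoint eqs (x y : ens) : Prop :=
  match x, y with
  | sup f, sup g =>
      (forall i, exists j, eqs (f i) (g j)) /\
      (forall j, exists i, eqs (f i) (g j))
  end.

Definition mem (x y : ens) : Prop := exists i : idx y, eqs x (elt i).
Definition sub (x y : ens) : Prop := forall z, mem z x -> mem z y.

Declare Scope ens_scope.
Delimit Scope ens_scope with ens.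
Notation "x ≡ y" := (eqs x y) (at level 70, no associativity) : ens_scope.
Notation "x ∈ y" := (mem x y) (at level 70, no associativity) : ens_scope.
Notation "x ⊆ y" := (sub x y) (at level 70, no associativity) : ens_scope.
Open Scope ens_scope.

Lemma eqs_refl x : x ≡ x.
Proof.
induction x as [I f IH]; simpl; split; intros i; exists i; apply IH.
Qed.

Lemma eqs_sym x y : x ≡ y -> y ≡ x.
Proof.
revert y; induction x as [I f IH]; intros [J g]; simpl; intros [H1 H2].
split; [intros j; destruct (H2 j) as [i Hi] | intros i; destruct (H1 i) as [j Hi]];
  eauto.
Qed.

Lemma eqs_trans x y z : x ≡ y -> y ≡ z -> x ≡ z.
Proof.
revert y z; induction x as [I f IH]; intros [J g] [K h]; simpl.
intros [H1 H2] [H3 H4]; split.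
- intros i; destruct (H1 i) as [j Hj]; destruct (H3 j) as [k Hk]; eauto.
- intros k; destruct (H4 k) as [j Hj]; destruct (H2 j) as [i Hi]; eauto.
Qed.

#[global] Instance eqs_equiv : Equivalence eqs.
Proof. split; [exact eqs_refl | exact eqs_sym | exact eqs_trans]. Qed.

Lemma elt_mem (x : ens) (i : idx x) : elt i ∈ x.
Proof. exists i; apply eqs_refl. Qed.

Lemma eqs_ext x y : (forall z, z ∈ x <-> z ∈ y) -> x ≡ y.
Proof.
destruct x as [I f], y as [J g]; intros H; simpl; split.
- intros i; exact (proj1 (H (f i)) (elt_mem (x := sup f) i)).
- intros j; destruct (proj2 (H (g j)) (elt_mem (x := sup g) j)) as [i Hi].
  exists i; symmetry; exact Hi.
Qed.

#[global] Instance mem_proper : Proper (eqs ==> eqs ==> iff) mem.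
Proof.
assert (H : forall x x' y y', x ≡ x' -> y ≡ y' -> x ∈ y -> x' ∈ y').
{ intros x x' [I f] [J g] Hx [H1 _] [i Hi]; destruct (H1 i) as [j Hj].
  exists j; simpl in *; rewrite <- Hx, Hi; exact Hj. }
intros x x' Hx y y' Hy; split; apply H; trivial; symmetry; trivial.
Qed.

Definition empty : ens := sup (fun i : False => match i with end).
Definition upair (x y : ens) : ens := sup (fun b : bool => if b then x else y).
Definition opair (x y : ens) : ens := upair (upair x x) (upair x y).
Definition bigU (x : ens) : ens :=
  sup (fun t : {i : idx x & idx (elt i)} => elt (projT2 t)).
Definition sep (x : ens) (Q : ens -> Prop) : ens :=
  sup (fun t : {i : idx x | Q (elt i)} => elt (proj1_sig t)).
Definition cap (x y : ens) : ens := sep x (fun z => z ∈ y).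
Definition pow (x : ens) : ens :=
  sup (fun S : idx x -> Prop =>
         sup (fun t : {i : idx x | S i} => elt (proj1_sig t))).
Definition cprod (x y : ens) : ens :=
  sup (fun t : idx x * idx y => opair (elt (fst t)) (elt (snd t))).
Definition succ (x : ens) : ens := bigU (upair x (upair x x)).

Fixpoint vnat (n : nat) : ens :=
  match n with O => empty | S m => succ (vnat m) end.
Definition omega : ens := sup vnat.
Definition one : ens := vnat 1.
Definition two : ens := vnat 2.

Lemma upairE x y z : z ∈ upair x y <-> z ≡ x \/ z ≡ y.
Proof.
split.
- intros [[|] H]; auto.
- intros [H|H]; [exists true | exists false]; exact H.
Qed.

Lemma bigUE x z : z ∈ bigU x <-> exists y, y ∈ x /\ z ∈ y.
Proof.
split.
- intros [[i j] H]; exists (elt i); split; [apply elt_mem | exists j; exact H].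
- intros [y [[i Hi] Hz]]; rewrite Hi in Hz; destruct Hz as [j Hj].
  exists (existT (fun i => idx (elt i)) i j); exact Hj.
Qed.

#[global] Instance upair_proper : Proper (eqs ==> eqs ==> eqs) upair.
Proof.
intros x x' Hx y y' Hy; apply eqs_ext; intros z; rewrite !upairE, Hx, Hy; tauto.
Qed.

#[global] Instance opair_proper : Proper (eqs ==> eqs ==> eqs) opair.
Proof. intros x x' Hx y y' Hy; unfold opair; rewrite Hx, Hy; reflexivity. Qed.

(* [name_rec S F x] is {F (name_rec S F y) p : <y,p> in x, p in S}, see
   [name_recE].  With <y,p> = {{y},{y,p}}, the name y is found as an element
   of an element of an element of x, which makes the recursion structural. *)
Fixpoint name_rec (S : ens) (F : ens -> ens -> ens) (x : ens) : ens :=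
  match x with sup f =>
    bigU (sup (fun a => match f a with sup g =>
      bigU (sup (fun b => match g b with sup h =>
        sup (fun t : {cp : _ * idx S | opair (h (fst cp)) (elt (snd cp)) ≡ f a}
             => F (name_rec S F (h (fst (proj1_sig t))))
                  (elt (snd (proj1_sig t))))
      end))
    end))
  end.

Lemma name_rec_raw S F x z :
  z ∈ name_rec S F x <->
  exists a : idx x, exists b : idx (elt a), exists c : idx (elt b),
    exists s : idx S, opair (elt c) (elt s) ≡ elt a /\
                      z ≡ F (name_rec S F (elt c)) (elt s).
Proof.
destruct x as [A f]; cbn [name_rec idx elt]; rewrite bigUE; split.
- intros [y [[a Ha] Hz]]; exists a; cbn [idx elt] in *; rewrite Ha in Hz.
  destruct (f a) as [B g]; cbn [idx elt] in *; rewrite bigUE in Hz.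
  destruct Hz as [w [[b Hb] Hz]]; exists b; cbn [idx elt] in *; rewrite Hb in Hz.
  destruct (g b) as [C h]; destruct Hz as [[[c s] Hcs] Hz].
  exists c, s; split; [exact Hcs | exact Hz].
- intros [a [b [c [s [Hcs Hz]]]]].
  eexists; split; [exists a; apply eqs_refl|]; cbn [idx elt] in *.
  destruct (f a) as [B g]; cbn [idx elt] in *; rewrite bigUE.
  eexists; split; [exists b; apply eqs_refl|]; cbn [idx elt] in *.
  destruct (g b) as [C h]; exists (exist _ (c, s) Hcs); exact Hz.
Qed.

Lemma opair_dig x y p : opair y p ∈ x ->
  exists a : idx x, exists b : idx (elt a), exists c : idx (elt b),
    opair y p ≡ elt a /\ y ≡ elt c.
Proof.
intros [a Ha]; exists a.
assert (Hb : upair y y ∈ elt a)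
  by (rewrite <- Ha; unfold opair; rewrite upairE; left; reflexivity).
destruct Hb as [b Hb]; exists b.
assert (Hc : y ∈ elt b) by (rewrite <- Hb, upairE; left; reflexivity).
destruct Hc as [c Hc]; exists c; split; assumption.
Qed.

Lemma name_rec_ext S F (HF : Proper (eqs ==> eqs ==> eqs) F) x y :
  x ≡ y -> name_rec S F x ≡ name_rec S F y.
Proof.
assert (Hdeep : forall Q : ens -> Prop,
  (forall x, (forall (a : idx x) (b : idx (elt a)) (c : idx (elt b)),
                 Q (elt c)) -> Q x) -> forall x, Q x).
{ intros Q HQ.
  assert (H : forall x, Q x /\ (forall i : idx x, Q (elt i)) /\
                        (forall (i : idx x) (j : idx (elt i)), Q (elt j))).
  { intros z; induction z as [I f IH]; split; [|split].
    - apply HQ; intros a b c; exact (proj2 (proj2 (IH a)) b c).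
    - intros i; exact (proj1 (IH i)).
    - intros i j; exact (proj1 (proj2 (IH i)) j). }
  intros z; exact (proj1 (H z)). }
revert y; pattern x; apply Hdeep; clear x; intros x IH y Hxy.
apply eqs_ext; intros z; rewrite !name_rec_raw; split.
- intros [a [b [c [s [Hp Hz]]]]].
  assert (Hy : opair (elt c) (elt s) ∈ y)
    by (rewrite <- Hxy, Hp; apply elt_mem).
  destruct (opair_dig Hy) as [a' [b' [c' [Ha' Hc']]]].
  exists a', b', c', s; split; [rewrite <- Hc'; exact Ha'|].
  rewrite Hz; apply HF; [exact (IH a b c _ Hc') | reflexivity].
- intros [a [b [c [s [Hp Hz]]]]].
  assert (Hx : opair (elt c) (elt s) ∈ x)
    by (rewrite Hxy, Hp; apply elt_mem).
  destruct (opair_dig Hx) as [a' [b' [c' [Ha' Hc']]]].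
  exists a', b', c', s; split; [rewrite <- Hc'; exact Ha'|].
  rewrite Hz; apply HF; [|reflexivity].
  symmetry; apply (IH a' b' c'); symmetry; exact Hc'.
Qed.

Lemma name_recE S F (HF : Proper (eqs ==> eqs ==> eqs) F) x z :
  z ∈ name_rec S F x <->
  exists y p, p ∈ S /\ opair y p ∈ x /\ z ≡ F (name_rec S F y) p.
Proof.
rewrite name_rec_raw; split.
- intros [a [b [c [s [Hp Hz]]]]]; exists (elt c), (elt s).
  split; [apply elt_mem|split]; [rewrite Hp; apply elt_mem | exact Hz].
- intros [y [p [[s Hs] [Hyp Hz]]]].
  destruct (opair_dig Hyp) as [a [b [c [Ha Hc]]]].
  exists a, b, c, s; split; [rewrite <- Hc, <- Hs; exact Ha|].
  rewrite Hz; apply HF; [apply name_rec_ext; assumption | exact Hs].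
Qed.

(* Truth in the structure (D, ∈) for a class D: every quantifier ranges
   over D. *)

Definition transitive_class (D : ens -> Prop) : Prop :=
  forall x y, D x -> y ∈ x -> D y.

Inductive fm : Type :=
| Fmem (i j : nat)
| Feq (i j : nat)
| Fbot
| Fimp (a b : fm)
| Fall (a : fm).

Definition scons (x : ens) (e : nat -> ens) (n : nat) : ens :=
  match n with O => x | S m => e m end.

(* Variables are de Bruijn indices. *)
Fixpoint sat (D : ens -> Prop) (e : nat -> ens) (a : fm) : Prop :=
  match a with
  | Fmem i j => e i ∈ e j
  | Feq i j => e i ≡ e j
  | Fbot => False
  | Fimp b c => sat D e b -> sat D e c
  | Fall b => forall x, D x -> sat D (scons x e) b
  end.

Definition upair_in (D : ens -> Prop) (z x y : ens) : Prop :=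
  forall w, D w -> (w ∈ z <-> w ≡ x \/ w ≡ y).

Definition opair_in (D : ens -> Prop) (z x y : ens) : Prop :=
  exists a b, D a /\ D b /\
    upair_in D a x x /\ upair_in D b x y /\ upair_in D z a b.

Definition rel_in (D : ens -> Prop) (R x y : ens) : Prop :=
  exists z, D z /\ z ∈ R /\ opair_in D z x y.

Definition extensionality_in (D : ens -> Prop) : Prop :=
  forall x y, D x -> D y -> (forall z, D z -> (z ∈ x <-> z ∈ y)) -> x ≡ y.

Definition foundation_in (D : ens -> Prop) : Prop :=
  forall x, D x -> (exists y, D y /\ y ∈ x) ->
  exists y, D y /\ y ∈ x /\ forall z, D z -> z ∈ x -> ~ z ∈ y.

Definition pairing_in (D : ens -> Prop) : Prop :=
  forall x y, D x -> D y -> exists z, D z /\ upair_in D z x y.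

Definition union_in (D : ens -> Prop) : Prop :=
  forall x, D x -> exists u, D u /\
  forall z, D z -> (z ∈ u <-> exists y, D y /\ y ∈ x /\ z ∈ y).

Definition powerset_in (D : ens -> Prop) : Prop :=
  forall x, D x -> exists u, D u /\
  forall z, D z -> (z ∈ u <-> forall w, D w -> w ∈ z -> w ∈ x).

Definition infinity_in (D : ens -> Prop) : Prop :=
  exists u, D u /\
  (exists o, D o /\ o ∈ u /\ forall w, D w -> ~ w ∈ o) /\
  (forall x, D x -> x ∈ u ->
     exists s, D s /\ s ∈ u /\ forall w, D w -> (w ∈ s <-> w ∈ x \/ w ≡ x)).

Definition separation_in (D : ens -> Prop) : Prop :=
  forall (a : fm) (e : nat -> ens), (forall n, D (e n)) ->
  forall x, D x -> exists u, D u /\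
  forall z, D z -> (z ∈ u <-> z ∈ x /\ sat D (scons z e) a).

Definition replacement_in (D : ens -> Prop) : Prop :=
  forall (a : fm) (e : nat -> ens), (forall n, D (e n)) ->
  forall x, D x ->
  (forall y, D y -> y ∈ x ->
     exists z, D z /\ sat D (scons z (scons y e)) a /\
     forall z', D z' -> sat D (scons z' (scons y e)) a -> z' ≡ z) ->
  exists u, D u /\
  forall z, D z ->
    (z ∈ u <-> exists y, D y /\ y ∈ x /\ sat D (scons z (scons y e)) a).

Definition choice_function_in (D : ens -> Prop) (f x : ens) : Prop :=
  (forall t, D t -> t ∈ f ->
     exists y z, D y /\ D z /\ y ∈ x /\ opair_in D t y z) /\
  (forall y z z', D y -> D z -> D z' ->
     rel_in D f y z -> rel_in D f y z' -> z ≡ z') /\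
  (forall y, D y -> y ∈ x -> exists z, D z /\ z ∈ y /\ rel_in D f y z).

Definition AC_in (D : ens -> Prop) : Prop :=
  forall x, D x -> (forall y, D y -> y ∈ x -> exists z, D z /\ z ∈ y) ->
  exists f, D f /\ choice_function_in D f x.

Definition ZFC_in (D : ens -> Prop) : Prop :=
  extensionality_in D /\ foundation_in D /\ pairing_in D /\ union_in D /\
  powerset_in D /\ infinity_in D /\ separation_in D /\ replacement_in D /\
  AC_in D.

Definition wellorders_in (D : ens -> Prop) (R x : ens) : Prop :=
  (forall t, D t -> t ∈ R ->
     exists y z, D y /\ D z /\ y ∈ x /\ z ∈ x /\ opair_in D t y z) /\
  (forall y, D y -> y ∈ x -> ~ rel_in D R y y) /\
  (forall y z w, D y -> D z -> D w -> y ∈ x -> z ∈ x -> w ∈ x ->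
     rel_in D R y z -> rel_in D R z w -> rel_in D R y w) /\
  (forall y z, D y -> D z -> y ∈ x -> z ∈ x ->
     rel_in D R y z \/ y ≡ z \/ rel_in D R z y) /\
  (forall s, D s -> (forall y, D y -> y ∈ s -> y ∈ x) ->
     (exists y, D y /\ y ∈ s) ->
     exists m, D m /\ m ∈ s /\
     forall y, D y -> y ∈ s -> m ≡ y \/ rel_in D R m y).

Definition wellorderable_in (D : ens -> Prop) (x : ens) : Prop :=
  exists R, D R /\ wellorders_in D R x.

Definition WO_in (D : ens -> Prop) : Prop :=
  forall x, D x -> wellorderable_in D x.

(* The objects below are computed in the transitive class V.  Bounded notions
   (ordered pair, bijection, omega, and so on) are absolute for V and are
   written in the ambient universe; the witnesses of unbounded quantifiers
   are required to lie in V. *)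

Definition function (f x y : ens) : Prop :=
  f ⊆ cprod x y /\
  (forall a, a ∈ x -> exists b, opair a b ∈ f) /\
  (forall a b b', opair a b ∈ f -> opair a b' ∈ f -> b ≡ b').

Definition injection (f x y : ens) : Prop :=
  function f x y /\
  forall a a' b, opair a b ∈ f -> opair a' b ∈ f -> a ≡ a'.

Definition bijection (f x y : ens) : Prop :=
  injection f x y /\ forall b, b ∈ y -> exists a, opair a b ∈ f.

Definition finite_in (V : ens -> Prop) (x : ens) : Prop :=
  exists n f, n ∈ omega /\ V f /\ bijection f x n.

Definition countable_in (V : ens -> Prop) (x : ens) : Prop :=
  exists f, V f /\ injection f x omega.

Definition ordinal (x : ens) : Prop :=
  (forall y, y ∈ x -> y ⊆ x) /\
  (forall y z, y ∈ x -> z ∈ y -> z ⊆ y).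

Definition is_omega1 (V : ens -> Prop) (w1 : ens) : Prop :=
  V w1 /\ ordinal w1 /\ ~ countable_in V w1 /\
  forall a, a ∈ w1 -> countable_in V a.

(* Fn(w1 x omega, 2, <omega); q is stronger than p iff p ⊆ q, and the
   weakest condition is [empty]. *)
Definition cond_box (w1 : ens) : ens := cprod (cprod w1 omega) two.

Definition Add (V : ens -> Prop) (w1 : ens) : ens :=
  sep (pow (cond_box w1)) (fun p =>
    V p /\ finite_in V p /\
    forall a i j, opair a i ∈ p -> opair a j ∈ p -> i ≡ j).

Definition generic (V : ens -> Prop) (w1 G : ens) : Prop :=
  G ⊆ Add V w1 /\
  empty ∈ G /\
  (forall p q, p ∈ G -> q ∈ Add V w1 -> q ⊆ p -> q ∈ G) /\
  (forall p q, p ∈ G -> q ∈ G -> exists r, r ∈ G /\ p ⊆ r /\ q ⊆ r) /\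
  (forall D, V D -> D ⊆ Add V w1 ->
     (forall p, p ∈ Add V w1 -> exists q, q ∈ D /\ p ⊆ q) ->
     exists p, p ∈ D /\ p ∈ G).

Definition Sym (V : ens -> Prop) (w1 : ens) : ens :=
  sep (pow (cprod w1 w1)) (fun s => V s /\ bijection s w1 w1).

Definition perm_id (w1 : ens) : ens :=
  sep (cprod w1 w1) (fun t => exists a, t ≡ opair a a).

Definition perm_comp (w1 s r : ens) : ens :=
  sep (cprod w1 w1) (fun t =>
    exists a b c, t ≡ opair a c /\ opair a b ∈ r /\ opair b c ∈ s).

Definition perm_inv (w1 s : ens) : ens :=
  sep (cprod w1 w1) (fun t => exists a b, t ≡ opair b a /\ opair a b ∈ s).

Definition subgroup (V : ens -> Prop) (w1 H : ens) : Prop :=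
  V H /\ H ⊆ Sym V w1 /\ perm_id w1 ∈ H /\
  (forall s r, s ∈ H -> r ∈ H -> perm_comp w1 s r ∈ H) /\
  (forall s, s ∈ H -> perm_inv w1 s ∈ H).

Definition conj_subgroup (w1 s H : ens) : ens :=
  sup (fun i : idx H =>
         perm_comp w1 s (perm_comp w1 (elt i) (perm_inv w1 s))).

Definition Fix_ (V : ens -> Prop) (w1 E : ens) : ens :=
  sep (Sym V w1) (fun s => forall a, a ∈ E -> opair a a ∈ s).

Inductive symfilter (V : ens -> Prop) (w1 : ens) : ens -> Prop :=
| symfilter_Fix E :
    V E -> E ⊆ w1 -> countable_in V E -> symfilter V w1 (Fix_ V w1 E)
| symfilter_up H K :
    symfilter V w1 H -> subgroup V w1 K -> H ⊆ K -> symfilter V w1 K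
| symfilter_cap H K :
    symfilter V w1 H -> symfilter V w1 K -> symfilter V w1 (cap H K)
| symfilter_conj s H :
    s ∈ Sym V w1 -> symfilter V w1 H -> symfilter V w1 (conj_subgroup w1 s H).

Definition act_cond (w1 s p : ens) : ens :=
  sep (cond_box w1) (fun t =>
    exists a b n i, t ≡ opair (opair b n) i /\
      opair a b ∈ s /\ opair (opair a n) i ∈ p).

Definition act_name (V : ens -> Prop) (w1 s x : ens) : ens :=
  name_rec (Add V w1) (fun y p => opair y (act_cond w1 s p)) x.

Definition val (G x : ens) : ens := name_rec G (fun v _ => v) x.

Definition Stab (V : ens -> Prop) (w1 x : ens) : ens :=
  sep (Sym V w1) (fun s => act_name V w1 s x ≡ x).

Inductive HS (V : ens -> Prop) (w1 : ens) (x : ens) : Prop :=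
| HS_intro :
    V x ->
    (forall z, z ∈ x ->
       exists y p, z ≡ opair y p /\ p ∈ Add V w1 /\ HS V w1 y) ->
    symfilter V w1 (Stab V w1 x) ->
    HS V w1 x.

Definition sym_ext (V : ens -> Prop) (w1 G : ens) (v : ens) : Prop :=
  exists x, HS V w1 x /\ v ≡ val G x.

Fixpoint check (x : ens) : ens :=
  match x with sup f => sup (fun i => opair (check (f i)) empty) end.

Definition c_name (V : ens -> Prop) (w1 a : ens) : ens :=
  sup (fun t : {np : idx omega * idx (Add V w1) |
                 opair (opair a (elt (fst np))) one ∈ elt (snd np)} =>
         opair (check (elt (fst (proj1_sig t)))) (elt (snd (proj1_sig t)))).

Definition A_name (V : ens -> Prop) (w1 : ens) : ens :=
  sup (fun i : idx w1 => opair (c_name V w1 (elt i)) empty).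

#[global] Instance act_cond_proper w1 s : Proper (eqs ==> eqs) (act_cond w1 s).
Proof.
assert (H : forall p q, p ≡ q -> act_cond w1 s p ⊆ act_cond w1 s q).
{ intros p q Hpq z [[i Hi] Hz]; cbn in Hz.
  assert (Hi' : exists a b n j, elt i ≡ opair (opair b n) j /\
      opair a b ∈ s /\ opair (opair a n) j ∈ q).
  { destruct Hi as [a [b [n [j Hj]]]]; exists a, b, n, j.
    rewrite <- Hpq; exact Hj. }
  exists (exist _ i Hi'); exact Hz. }
intros p q Hpq; apply eqs_ext; intros z.
split; apply H; [exact Hpq | symmetry; exact Hpq].
Qed.

Lemma valE G x z :
  z ∈ val G x <-> exists y p, p ∈ G /\ opair y p ∈ x /\ z ≡ val G y.
Proof. apply name_recE; intros v v' Hv p p' _; exact Hv. Qed.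

Lemma act_nameE V w1 s x z :
  z ∈ act_name V w1 s x <->
  exists y p, p ∈ Add V w1 /\ opair y p ∈ x /\
              z ≡ opair (act_name V w1 s y) (act_cond w1 s p).
Proof.
apply name_recE; intros v v' Hv p p' Hp; rewrite Hv, Hp; reflexivity.
Qed.

(* Main.v *)
From Stdlib Require Import Setoid Morphisms Classical List PeanoNat Lia.
Require Import Defs.

(* With countable supports, a name in HS is fixed by every permutation of w1
   that fixes some countable E pointwise.  Given a condition p in the generic
   filter G and an index a outside E, density yields b outside E such that p also
   lies in the filter G' = (a b)G.  Names supported by E have the same value in G
   and G', while the Cohen reals c_a and c_b are exchanged; hence whatever p forces
   about c_a and such names also holds of c_b.

   - If R well-orders A in N and has support E, let c_a be the R-least element of
     {c_b : b not in E}.  Some p in G forces that (c_a, c_b) is in R for all the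
     other b, and the exchange puts (c_b, c_a) in R.
   - If f in N, with support E, is a choice function for the family of the sets
     {c_b : b not in e}, e countable, then its value c_a at e = E is also c_b.  This
     refutes AC directly, so Zermelo's theorem is not needed inside N.

   Forcing is only needed for equality and membership of names. *)

Set Implicit Arguments.
Unset Strict Implicit.
Unset Printing Implicit Defensive.

(** * Sets of the ambient universe *)

(** The obstacle is that [generic] and the axioms of [V] speak only of elements of [V], while all
    constructions are carried out on ambient trees. Each set of conditions or names must therefore
    be shown to lie in [V], which by separation and replacement comes down to first-order
    definability over [V]. The predicates [dfn] and [dft] make this compositional: definability is
    proved connective by connective, and formulas of [fm] appear only in the basic closure lemmas.
    Recursion is what this calculus cannot treat directly. It is replaced by the existence of a
    witnessing set (recursion on [omega], forced equality) or bypassed by an explicit description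
    (stabilizers). The second choice is that soundness of forcing is proved for every generic
    filter: it is applied in G', which is again generic over [V], and the outcome is then read back
    as a statement about values in G. *)

Lemma sub_refl x : x ⊆ x.
Proof. intros z Hz; exact Hz. Qed.

Lemma sub_trans x y z : x ⊆ y -> y ⊆ z -> x ⊆ z.
Proof. intros H H' w Hw; apply H', H, Hw. Qed.

#[global] Instance sub_proper : Proper (eqs ==> eqs ==> iff) sub.
Proof.
intros x x' Hx y y' Hy; unfold sub; split; intros H z.
- rewrite <- Hx, <- Hy; auto.
- rewrite Hx, Hy; auto.
Qed.

Lemma sub_antisym x y : x ⊆ y -> y ⊆ x -> x ≡ y.
Proof. intros H H'; apply eqs_ext; split; auto. Qed.

(** Structural induction on [ens] reaches only the chosen elements [f i]. Quantifying over all
    [x' ≡ x] extends it to every [y ∈ x] without assuming that [Q] respects [≡]. *)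
Lemma mem_ind (Q : ens -> Prop) :
  (forall x, (forall y, y ∈ x -> Q y) -> Q x) -> forall x, Q x.
Proof.
intros HQ x; enough (H : forall x', x' ≡ x -> Q x') by (apply H; reflexivity).
induction x as [I f IH]; intros x' Hx'; apply HQ; intros y Hy.
rewrite Hx' in Hy; destruct Hy as [i Hi]; exact (IH i y Hi).
Qed.

Lemma not_mem_empty z : ~ z ∈ empty.
Proof. intros [[] _]. Qed.

(** [sep] filters indices, so [Q] is tested only at the representatives [elt i]; the hypothesis
    carries it over to equal sets. *)
Lemma sepE x (Q : ens -> Prop) z :
  (forall y y', y ≡ y' -> y ∈ x -> Q y -> Q y') ->
  (z ∈ sep x Q <-> z ∈ x /\ Q z).
Proof.
intros HQ; split.
- intros [[i Hi] Hz]; simpl in Hz; split; [exists i; exact Hz|].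
  apply (HQ (elt i) z); [symmetry; exact Hz | apply elt_mem | exact Hi].
- intros [Hx Hz]; destruct Hx as [i Hi].
  assert (Hi' : Q (elt i)) by (apply (HQ z); [exact Hi | exists i; exact Hi | exact Hz]).
  exists (exist _ i Hi'); exact Hi.
Qed.

Lemma powE x z : z ∈ pow x <-> z ⊆ x.
Proof.
split.
- intros [S HS] w; rewrite HS; intros [[i Hi] Hw]; exists i; exact Hw.
- intros H; exists (fun i => elt i ∈ z); apply eqs_ext; intros w; split.
  + intros Hw; destruct (H w Hw) as [i Hi]; rewrite Hi in Hw.
    exists (exist _ i Hw); exact Hi.
  + intros [[i Hi] Hw]; simpl in Hw; rewrite Hw; exact Hi.
Qed.

Lemma upair_inj x y x' y' : upair x y ≡ upair x' y' ->
  (x ≡ x' /\ y ≡ y') \/ (x ≡ y' /\ y ≡ x').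
Proof.
intros H.
assert (Hz : forall z, (z ≡ x \/ z ≡ y) <-> (z ≡ x' \/ z ≡ y'))
  by (intros z; rewrite <- !upairE, H; reflexivity).
destruct (proj1 (Hz x) (or_introl (eqs_refl x))) as [H1|H1];
destruct (proj1 (Hz y) (or_intror (eqs_refl y))) as [H2|H2]; auto.
- destruct (proj2 (Hz y') (or_intror (eqs_refl y'))) as [H3|H3].
  + left; split; auto; rewrite H2, <- H1, H3; reflexivity.
  + left; split; auto; rewrite H3; reflexivity.
- destruct (proj2 (Hz x') (or_introl (eqs_refl x'))) as [H3|H3].
  + left; split; auto; rewrite H3; reflexivity.
  + right; split; auto; rewrite H3; reflexivity.
Qed.

Lemma opair_inj x y x' y' : opair x y ≡ opair x' y' -> x ≡ x' /\ y ≡ y'.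
Proof.
intros H; apply upair_inj in H as [[H1 H2]|[H1 H2]];
  apply upair_inj in H1 as [[H1 H3]|[H1 H3]]; apply upair_inj in H2 as [[H2 H4]|[H2 H4]];
  split; auto; eauto using eqs_trans, eqs_sym.
Qed.

Lemma cprodE x y z :
  z ∈ cprod x y <-> exists a b, a ∈ x /\ b ∈ y /\ z ≡ opair a b.
Proof.
split.
- intros [[i j] H]; exists (elt i), (elt j); split; [|split]; try apply elt_mem; exact H.
- intros [a [b [[i Hi] [[j Hj] H]]]]; exists (i, j); simpl; rewrite H, Hi, Hj; reflexivity.
Qed.

Lemma opair_cprod x y a b : opair a b ∈ cprod x y <-> a ∈ x /\ b ∈ y.
Proof.
rewrite cprodE; split.
- intros [c [d [Hc [Hd H]]]]; apply opair_inj in H as [H1 H2]; rewrite H1, H2; auto.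
- intros [Ha Hb]; exists a, b; split; [|split]; auto; reflexivity.
Qed.

#[global] Instance bigU_proper : Proper (eqs ==> eqs) bigU.
Proof.
intros x x' Hx; apply eqs_ext; intros z; rewrite !bigUE; setoid_rewrite Hx; reflexivity.
Qed.

#[global] Instance cprod_proper : Proper (eqs ==> eqs ==> eqs) cprod.
Proof.
intros x x' Hx y y' Hy; apply eqs_ext; intros z; rewrite !cprodE.
setoid_rewrite Hx; setoid_rewrite Hy; reflexivity.
Qed.

Definition cup (x y : ens) : ens := bigU (upair x y).

Lemma cupE x y z : z ∈ cup x y <-> z ∈ x \/ z ∈ y.
Proof.
unfold cup; rewrite bigUE; split.
- intros [w [Hw Hz]]; rewrite upairE in Hw; destruct Hw as [Hw|Hw]; rewrite Hw in Hz; auto.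
- intros [H|H]; [exists x | exists y]; rewrite upairE; split; auto; [left|right]; reflexivity.
Qed.

#[global] Instance cup_proper : Proper (eqs ==> eqs ==> eqs) cup.
Proof. intros x x' Hx y y' Hy; unfold cup; rewrite Hx, Hy; reflexivity. Qed.

Lemma succE x z : z ∈ succ x <-> z ∈ x \/ z ≡ x.
Proof. change (succ x) with (cup x (upair x x)); rewrite cupE, upairE; tauto. Qed.

#[global] Instance succ_proper : Proper (eqs ==> eqs) succ.
Proof. intros x x' Hx; unfold succ; rewrite Hx; reflexivity. Qed.

Lemma capE x y z : z ∈ cap x y <-> z ∈ x /\ z ∈ y.
Proof.
unfold cap; rewrite sepE; [reflexivity|].
intros a b H _; rewrite H; auto.
Qed.

Lemma succ_inj x y : succ x ≡ succ y -> x ≡ y.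
Proof.
intros H.
assert (H1 : x ∈ succ y) by (rewrite <- H, succE; right; reflexivity).
assert (H2 : y ∈ succ x) by (rewrite H, succE; right; reflexivity).
rewrite succE in H1, H2; destruct H1 as [H1|H1]; [|exact H1].
destruct H2 as [H2|H2]; [|symmetry; exact H2].
(* What remains is the cycle x ∈ y ∈ x. The induction hypothesis at [y], applied to the reversed
   cycle y ∈ x ∈ y, excludes it. *)
exfalso; revert y H H1 H2; induction x as [x IH] using mem_ind; intros y H Hxy Hyx.
apply (IH y Hyx x); auto; symmetry; exact H.
Qed.

Lemma succ_not_empty x : ~ succ x ≡ empty.
Proof.
intros H; apply (not_mem_empty (z := x)); rewrite <- H, succE; right; reflexivity.
Qed.

Lemma vnat_inj n m : vnat n ≡ vnat m -> n = m.
Proof.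
revert m; induction n as [|n IH]; intros [|m]; cbn [vnat]; intros H; auto.
- symmetry in H; destruct (succ_not_empty H).
- destruct (succ_not_empty H).
- f_equal; apply IH, succ_inj, H.
Qed.

Lemma vnat_omega n : vnat n ∈ omega.
Proof. exists n; reflexivity. Qed.

Lemma memvnat n z : z ∈ vnat n <-> exists m, m < n /\ z ≡ vnat m.
Proof.
induction n as [|n IH]; cbn [vnat].
- split; [intros H; destruct (not_mem_empty H) | intros [m [H _]]; lia].
- rewrite succE, IH; split.
  + intros [[m [Hm H]]|H]; [exists m | exists n]; split; auto; lia.
  + intros [m [Hm H]]; destruct (Nat.eq_dec m n) as [->|]; [right; exact H|].
    left; exists m; split; auto; lia.
Qed.

Definition rep (x : ens) (F : ens -> ens) : ens := sup (fun i : idx x => F (elt i)).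

Lemma repE x F z :
  (forall y y', y ≡ y' -> y ∈ x -> F y ≡ F y') ->
  (z ∈ rep x F <-> exists y, y ∈ x /\ z ≡ F y).
Proof.
intros HF; split.
- intros [i Hi]; exists (elt (x := x) i); split; [apply elt_mem | exact Hi].
- intros [y [Hy Hz]]; destruct Hy as [i Hi]; exists i; simpl.
  rewrite Hz; apply HF; [exact Hi | exists i; exact Hi].
Qed.

Definition fset (l : list ens) : ens := fold_right (fun x s => cup (upair x x) s) empty l.

Lemma fsetE l z : z ∈ fset l <-> Exists (fun y => z ≡ y) l.
Proof.
induction l as [|x l IH]; simpl.
- rewrite Exists_nil; split; [apply not_mem_empty | tauto].
- rewrite Exists_cons, cupE, upairE, IH; tauto.
Qed.

(** * Definability over a transitive model *)

Class model (V : ens -> Prop) : Prop :=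
  { model_trans : transitive_class V; model_ZFC : ZFC_in V }.

(* [mix e c] interleaves the variables [e] with the parameters [c], so that one
   environment carries both. *)
Fixpoint mix (T : Type) (e c : nat -> T) (n : nat) : T :=
  match n with O => e O | S m => mix c (fun k => e (S k)) m end.

Lemma mix_even T (e c : nat -> T) n : mix e c (n + n) = e n.
Proof.
revert e c; induction n as [|n IH]; intros e c; simpl; auto.
rewrite Nat.add_succ_r; simpl; apply IH.
Qed.

Lemma mix_odd T (e c : nat -> T) n : mix e c (S (n + n)) = c n.
Proof. simpl; apply mix_even. Qed.

Lemma mix_map T U (R : T -> U -> Prop) (e c : nat -> T) (e' c' : nat -> U) :
  (forall n, R (e n) (e' n)) -> (forall n, R (c n) (c' n)) ->
  forall n, R (mix e c n) (mix e' c' n).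
Proof.
intros H H' n; revert e c e' c' H H'.
induction n as [|n IH]; intros e c e' c' H H'; simpl; auto.
Qed.

Lemma mix_ren T (R : T -> T -> Prop) (e c g : nat -> T) (r s : nat -> nat) :
  (forall n, R (e n) (g (r n))) -> (forall n, R (c n) (g (s n))) ->
  forall n, R (mix e c n) (g (mix r s n)).
Proof. intros H H'; exact (mix_map (R := fun x k => R x (g k)) H H'). Qed.

Lemma mix_all T (Q : T -> Prop) (e c : nat -> T) :
  (forall n, Q (e n)) -> (forall n, Q (c n)) -> forall n, Q (mix e c n).
Proof.
intros H H'; exact (mix_map (R := fun x (_ : T) => Q x) (e' := e) (c' := c) H H').
Qed.

Definition up (r : nat -> nat) (n : nat) : nat :=
  match n with O => O | S m => S (r m) end.

Fixpoint ren (r : nat -> nat) (a : fm) : fm :=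
  match a with
  | Fmem i j => Fmem (r i) (r j)
  | Feq i j => Feq (r i) (r j)
  | Fbot => Fbot
  | Fimp a b => Fimp (ren r a) (ren r b)
  | Fall a => Fall (ren (up r) a)
  end.

(** Allowing [≡] between the environments has a second use: with [r] the identity, truth depends on
    the values of the variables only up to [≡]. *)
Lemma sat_ren D a e e' r :
  (forall n, e' n ≡ e (r n)) -> (sat D e' a <-> sat D e (ren r a)).
Proof.
revert e e' r; induction a as [i j|i j| |a IHa b IHb|a IHa]; intros e e' r H; simpl.
- rewrite !H; reflexivity.
- rewrite !H; reflexivity.
- reflexivity.
- rewrite (IHa _ _ _ H), (IHb _ _ _ H); reflexivity.
- apply Morphisms_Prop.all_iff_morphism; intros x.
  rewrite (IHa (scons x e) (scons x e') (up r)); [reflexivity|].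
  intros [|n]; simpl; [reflexivity | apply H].
Qed.

Section Definability.
Context {V : ens -> Prop} {M : model V}.

Notation env := (nat -> ens).
Notation tl e := (fun n => e (S n)).

Lemma V_mem x y : V x -> y ∈ x -> V y.
Proof. apply (model_trans (V := V)). Qed.

(** Invariance under [≡] is not part of the hypotheses on [V]. Pairing puts [x], hence also [y],
    into a set of [V], and transitivity does the rest. *)
Lemma V_eqs x y : x ≡ y -> V x -> V y.
Proof.
intros H Hx; destruct (model_ZFC (V := V)) as [_ [_ [HP _]]].
destruct (HP x x Hx Hx) as [z [Hz Hu]].
assert (Hxz : x ∈ z) by (apply Hu; auto; left; reflexivity).
rewrite H in Hxz; exact (V_mem Hz Hxz).
Qed.

#[global] Instance V_proper : Proper (eqs ==> iff) V.
Proof. intros x y H; split; apply V_eqs; auto with relations. Qed.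

Definition Venv (e : env) : Prop := forall n, V (e n).

Lemma Venv_scons x e : V x -> Venv e -> Venv (scons x e).
Proof. intros Hx He [|n]; simpl; auto. Qed.

Lemma Venv_tl e : Venv e -> Venv (tl e).
Proof. intros H n; apply H. Qed.

(** First-order definability over [V] with parameters. The formula reads variables at even positions
    and parameters at odd ones, so neither supply has to be counted or bounded. *)
Definition dfn (P : env -> Prop) : Prop :=
  exists a c, Venv c /\ forall e, Venv e -> (P e <-> sat V (mix e c) a).

(** As [fm] has no function symbols, a class function is given by its graph: position 0 holds the
    value, the later positions the arguments. *)
Definition dft (t : env -> ens) : Prop :=
  (forall e, Venv e -> V (t e)) /\ dfn (fun e => e 0 ≡ t (tl e)).

Lemma dfn_ext (P Q : env -> Prop) :
  (forall e, Venv e -> (P e <-> Q e)) -> dfn Q -> dfn P.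
Proof.
intros H [a [c [Hc Ha]]]; exists a, c; split; auto.
intros e He; rewrite (H e He); auto.
Qed.

Lemma dfn_proper (P : env -> Prop) e e' :
  dfn P -> Venv e -> (forall n, e n ≡ e' n) -> (P e <-> P e').
Proof.
intros [a [c [Hc Ha]]] He H.
assert (He' : Venv e') by (intros n; rewrite <- H; apply He).
rewrite (Ha e He), (Ha e' He').
rewrite (@sat_ren V a (mix e' c) (mix e c) (fun n => n)).
- symmetry; apply sat_ren; intros n; reflexivity.
- intros n; apply (mix_map (R := eqs)); [exact H | reflexivity].
Qed.

Lemma dfn_ren (P : env -> Prop) (r : nat -> nat) :
  dfn P -> dfn (fun e => P (fun n => e (r n))).
Proof.
intros [a [c [Hc Ha]]].
exists (ren (mix (fun n => r n + r n) (fun n => S (n + n))) a), c; split; auto.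
intros e He; rewrite Ha by (intros n; apply He).
apply sat_ren, (mix_ren (R := eqs)); intros n;
  rewrite ?mix_even, ?mix_odd; reflexivity.
Qed.

Lemma V_inhabited : exists x, V x.
Proof.
destruct (model_ZFC (V := V)) as [_ [_ [_ [_ [_ [[u [Hu _]] _]]]]]]; exists u; exact Hu.
Qed.

Lemma dfn_bot : dfn (fun _ => False).
Proof.
destruct V_inhabited as [u Hu].
exists Fbot, (fun _ => u); split; [intros n; exact Hu | simpl; tauto].
Qed.

Lemma dfn_mem_var i j : dfn (fun e => e i ∈ e j).
Proof.
destruct V_inhabited as [u Hu].
exists (Fmem (i + i) (j + j)), (fun _ => u); split; [intros n; exact Hu|].
intros e He; simpl; rewrite !mix_even; reflexivity.
Qed.

Lemma dfn_eq_var i j : dfn (fun e => e i ≡ e j).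
Proof.
destruct V_inhabited as [u Hu].
exists (Feq (i + i) (j + j)), (fun _ => u); split; [intros n; exact Hu|].
intros e He; simpl; rewrite !mix_even; reflexivity.
Qed.

Lemma dfn_imp P Q : dfn P -> dfn Q -> dfn (fun e => P e -> Q e).
Proof.
intros [a [c [Hc Ha]]] [b [d [Hd Hb]]].
(* The two parameter lists are interleaved once more: in [mix e (mix c d)], entry n of [c] stands at
   2(2n)+1 and entry n of [d] at 2(2n+1)+1. *)
exists (Fimp (ren (mix (fun n => n + n) (fun n => S ((n + n) + (n + n)))) a)
             (ren (mix (fun n => n + n) (fun n => S (S (n + n) + S (n + n)))) b)), (mix c d).
split; [exact (mix_all (Q := V) Hc Hd)|].
intros e He; rewrite Ha, Hb by exact He; cbn [sat].
rewrite (@sat_ren V a (mix e (mix c d)) (mix e c) (mix (fun n => n + n) (fun n => S ((n + n) + (n + n))))),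
  (@sat_ren V b (mix e (mix c d)) (mix e d) (mix (fun n => n + n) (fun n => S (S (n + n) + S (n + n)))));
  [reflexivity| |]; apply (mix_ren (R := eqs)); intros n;
  repeat (rewrite mix_even || rewrite mix_odd); reflexivity.
Qed.

(** [Fall] pushes its variable in front of the whole interleaving, whereas [dfn] expects it among
    the variables; this renaming mediates. The term [S (n + n) - 1] equals [n + n]. *)
Lemma scons_mix x e c n :
  mix (scons x e) c n ≡
  scons x (mix e c) (mix (up (fun n => S (n + n) - 1)) (fun n => S (S (n + n))) n).
Proof.
apply (mix_ren (R := eqs)); clear n; intros [|n]; cbn [scons up];
  rewrite ?mix_odd; try reflexivity.
replace (S (n + n) - 1) with (n + n) by lia; rewrite mix_even; reflexivity.
Qed.

Lemma dfn_all (P : ens -> env -> Prop) :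
  dfn (fun e => P (e 0) (tl e)) -> dfn (fun e => forall x, V x -> P x e).
Proof.
intros [a [c [Hc Ha]]].
exists (Fall (ren (mix (up (fun n => S (n + n) - 1)) (fun n => S (S (n + n)))) a)), c.
split; auto; intros e He; cbn [sat].
enough (H : forall x, V x -> (P x e <-> sat V (scons x (mix e c))
  (ren (mix (up (fun n => S (n + n) - 1)) (fun n => S (S (n + n)))) a))) by firstorder.
intros x Hx; rewrite (Ha (scons x e) (Venv_scons Hx He)).
apply sat_ren; intros n; apply scons_mix.
Qed.

Lemma dfn_not P : dfn P -> dfn (fun e => ~ P e).
Proof. intros H; exact (dfn_imp H dfn_bot). Qed.

Lemma dfn_and P Q : dfn P -> dfn Q -> dfn (fun e => P e /\ Q e).
Proof.
intros HP HQ; apply (dfn_ext (Q := fun e => ~ (P e -> ~ Q e))).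
- intros e He; split; [tauto | intros H].
  destruct (classic (P e)), (classic (Q e)); tauto.
- apply dfn_not, dfn_imp; auto; apply dfn_not; auto.
Qed.

Lemma dfn_or P Q : dfn P -> dfn Q -> dfn (fun e => P e \/ Q e).
Proof.
intros HP HQ; apply (dfn_ext (Q := fun e => ~ P e -> Q e)).
- intros e He; destruct (classic (P e)); tauto.
- apply dfn_imp; auto; apply dfn_not; auto.
Qed.

Lemma dfn_iff P Q : dfn P -> dfn Q -> dfn (fun e => P e <-> Q e).
Proof. intros HP HQ; apply dfn_and; apply dfn_imp; auto. Qed.

Lemma dfn_ex (P : ens -> env -> Prop) :
  dfn (fun e => P (e 0) (tl e)) -> dfn (fun e => exists x, V x /\ P x e).
Proof.
intros HP; apply (dfn_ext (Q := fun e => ~ forall x, V x -> ~ P x e)).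
- intros e He; split; [firstorder | intros H].
  apply not_all_ex_not in H as [x Hx]; exists x; split.
  + apply NNPP; tauto.
  + apply NNPP; tauto.
- apply dfn_not, (dfn_all (P := fun x e => ~ P x e)), dfn_not, HP.
Qed.

Lemma dft_V t e : dft t -> Venv e -> V (t e).
Proof. intros [H _]; apply H. Qed.

Lemma dft_proper t e e' :
  dft t -> Venv e -> (forall n, e n ≡ e' n) -> t e ≡ t e'.
Proof.
intros [Ht Hd] He H.
assert (Hs : Venv (scons (t e) e)) by (apply Venv_scons; auto).
apply (@dfn_proper _ (scons (t e) e) (scons (t e) e') Hd Hs).
- intros [|n]; simpl; [reflexivity | apply H].
- reflexivity.
Qed.

(** Substitution without substituting in formulas: [P (t e)] is read as the existence of some [x] in
    [V] with [x ≡ t e] and [P x e]. *)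
Lemma dfn_at (P : ens -> env -> Prop) t :
  dfn (fun e => P (e 0) (tl e)) -> dft t -> dfn (fun e => P (t e) e).
Proof.
intros HP Ht; apply (dfn_ext (Q := fun e => exists x, V x /\ (x ≡ t e /\ P x e))).
- intros e He; split.
  + intros H; exists (t e); repeat split; auto; [apply dft_V; auto | reflexivity].
  + intros [x [Hx [Hxt H]]]; revert H.
    assert (Hs : Venv (scons x e)) by (apply Venv_scons; auto).
    apply (@dfn_proper _ (scons x e) (scons (t e) e) HP Hs).
    intros [|n]; simpl; [exact Hxt | reflexivity].
- apply (dfn_ex (P := fun x e => x ≡ t e /\ P x e)), dfn_and; [apply Ht | exact HP].
Qed.

Lemma dft_ren t (r : nat -> nat) : dft t -> dft (fun e => t (fun n => e (r n))).
Proof.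
intros [Ht Hd]; split; [intros e He; apply Ht; intros n; apply He|].
exact (dfn_ren (up r) Hd).
Qed.

Lemma dft_var n : dft (fun e => e n).
Proof. split; [intros e He; apply He | apply (dfn_eq_var 0 (S n))]. Qed.

Lemma dft_cst c : V c -> dft (fun _ => c).
Proof.
intros Hc; split; [auto|].
exists (Feq 0 1), (fun _ => c); split; [intros n; exact Hc|].
intros e He; reflexivity.
Qed.

Lemma dfn_mem s t : dft s -> dft t -> dfn (fun e => s e ∈ t e).
Proof.
intros Hs Ht; apply (dfn_at (P := fun x e => s e ∈ x)); [|exact Ht].
apply (dfn_at (P := fun x e => x ∈ e 0)); [apply (dfn_mem_var 0 1)|].
apply (dft_ren S Hs).
Qed.

Lemma dfn_eq s t : dft s -> dft t -> dfn (fun e => s e ≡ t e).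
Proof.
intros Hs Ht; apply (dfn_at (P := fun x e => s e ≡ x)); [|exact Ht].
apply (dfn_at (P := fun x e => x ≡ e 0)); [apply (dfn_eq_var 0 1)|].
apply (dft_ren S Hs).
Qed.

Lemma dfn_ball (P : ens -> env -> Prop) t :
  dft t -> dfn (fun e => P (e 0) (tl e)) -> dfn (fun e => forall x, x ∈ t e -> P x e).
Proof.
intros Ht HP; apply (dfn_ext (Q := fun e => forall x, V x -> x ∈ t e -> P x e)).
- intros e He; split; auto; intros H x Hx; apply H; auto.
  apply (V_mem (dft_V Ht He) Hx).
- apply (dfn_all (P := fun x e => x ∈ t e -> P x e)), dfn_imp; auto.
  apply dfn_mem; [apply dft_var | apply (dft_ren S Ht)].
Qed.

Lemma dfn_bex (P : ens -> env -> Prop) t :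
  dft t -> dfn (fun e => P (e 0) (tl e)) -> dfn (fun e => exists x, x ∈ t e /\ P x e).
Proof.
intros Ht HP; apply (dfn_ext (Q := fun e => exists x, V x /\ (x ∈ t e /\ P x e))).
- intros e He; split; [|firstorder]; intros [x [Hx H]]; exists x; split; auto.
  apply (V_mem (dft_V Ht He) Hx).
- apply (dfn_ex (P := fun x e => x ∈ t e /\ P x e)), dfn_and; auto.
  apply dfn_mem; [apply dft_var | apply (dft_ren S Ht)].
Qed.

Lemma dfn_sub s t : dft s -> dft t -> dfn (fun e => s e ⊆ t e).
Proof.
intros Hs Ht; apply (dfn_ball (P := fun x e => x ∈ t e)); auto.
apply dfn_mem; [apply dft_var | apply (dft_ren S Ht)].
Qed.

Lemma dfn_V t : dft t -> dfn (fun e => V (t e)).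
Proof.
intros Ht; apply (dfn_ext (Q := fun e => False -> False)).
- intros e He; split; auto; intros _; apply dft_V; auto.
- apply dfn_imp; apply dfn_bot.
Qed.

(** By extensionality, the graph of [t] is definable as soon as membership in its values is.
    Transitivity of [V] allows testing only members from [V]. *)
Lemma dft_char t (Q : ens -> env -> Prop) :
  (forall e, Venv e -> V (t e)) ->
  (forall e z, Venv e -> V z -> (z ∈ t e <-> Q z e)) ->
  dfn (fun e => Q (e 0) (tl e)) -> dft t.
Proof.
intros Ht Hz HQ; split; auto.
apply (dfn_ext (Q := fun e => forall z, V z -> (z ∈ e 0 <-> Q z (tl e)))).
- intros e He; split.
  + intros H z HV; rewrite H; apply Hz; auto; apply Venv_tl; auto.
  + intros H; apply eqs_ext; intros z; split; intros Hm.
    * assert (HV := V_mem (He 0) Hm).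
      apply Hz; auto; [apply Venv_tl; auto | apply H; auto].
    * assert (HV := V_mem (Ht _ (Venv_tl He)) Hm).
      apply H; auto; apply Hz; auto; apply Venv_tl; auto.
- apply (dfn_all (P := fun z e => z ∈ e 0 <-> Q z (tl e))), dfn_iff.
  + apply (dfn_mem_var 0 1).
  + exact (dfn_ren (fun n => match n with O => O | S m => S (S m) end) HQ).
Qed.

(** The pattern of the closure lemmas: the set granted by the axiom inside [V] has the same elements
    as the ambient one because [V] is transitive, and [V_eqs] transfers membership in [V]. *)
Lemma V_upair x y : V x -> V y -> V (upair x y).
Proof.
intros Hx Hy; destruct (model_ZFC (V := V)) as [_ [_ [HP _]]].
destruct (HP x y Hx Hy) as [z [Hz Hu]].
refine (V_eqs _ Hz); apply eqs_ext; intros w; rewrite upairE; split.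
- intros Hw; apply Hu; auto; apply (V_mem Hz Hw).
- intros Hw; apply Hu; auto; destruct Hw as [Hw|Hw]; rewrite Hw; auto.
Qed.

Lemma V_opair x y : V x -> V y -> V (opair x y).
Proof. intros; unfold opair; auto using V_upair. Qed.

Lemma V_bigU x : V x -> V (bigU x).
Proof.
intros Hx; destruct (model_ZFC (V := V)) as [_ [_ [_ [HU _]]]].
destruct (HU x Hx) as [u [Hu H]].
refine (V_eqs _ Hu); apply eqs_ext; intros w; rewrite bigUE; split.
- intros Hw; destruct (proj1 (H w (V_mem Hu Hw)) Hw) as [y Hy]; exists y; tauto.
- intros [y [Hy Hw]]; assert (HVy := V_mem Hx Hy).
  apply H; [apply (V_mem HVy Hw) | exists y; auto].
Qed.

Lemma V_cup x y : V x -> V y -> V (cup x y).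
Proof. intros; apply V_bigU, V_upair; auto. Qed.

Lemma V_succ x : V x -> V (succ x).
Proof. intros; apply V_bigU, V_upair, V_upair; auto. Qed.

Lemma V_opl x y : V (opair x y) -> V x.
Proof.
intros H; apply (V_mem (x := upair x x)); [|rewrite upairE; left; reflexivity].
apply (V_mem H); unfold opair; rewrite upairE; left; reflexivity.
Qed.

Lemma V_opr x y : V (opair x y) -> V y.
Proof.
intros H; apply (V_mem (x := upair x y)); [|rewrite upairE; right; reflexivity].
apply (V_mem H); unfold opair; rewrite upairE; right; reflexivity.
Qed.

Lemma dft_upair s t : dft s -> dft t -> dft (fun e => upair (s e) (t e)).
Proof.
intros Hs Ht; apply (dft_char (Q := fun z e => z ≡ s e \/ z ≡ t e)).
- intros e He; apply V_upair; apply dft_V; auto.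
- intros e z He Hz; apply upairE.
- apply dfn_or; apply dfn_eq; try apply dft_var; [apply (dft_ren S Hs) | apply (dft_ren S Ht)].
Qed.

Lemma dft_opair s t : dft s -> dft t -> dft (fun e => opair (s e) (t e)).
Proof. intros Hs Ht; apply dft_upair; apply dft_upair; auto. Qed.

Lemma dft_bigU t : dft t -> dft (fun e => bigU (t e)).
Proof.
intros Ht; apply (dft_char (Q := fun z e => exists y, y ∈ t e /\ z ∈ y)).
- intros e He; apply V_bigU, dft_V; auto.
- intros e z He Hz; apply bigUE.
- apply (dfn_bex (P := fun y e => e 0 ∈ y)); [apply (dft_ren S Ht)|].
  apply (dfn_mem_var 1 0).
Qed.

Lemma dft_cup s t : dft s -> dft t -> dft (fun e => cup (s e) (t e)).
Proof. intros; apply dft_bigU, dft_upair; auto. Qed.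

Lemma dft_succ t : dft t -> dft (fun e => succ (t e)).
Proof. intros; apply dft_bigU, dft_upair; auto; apply dft_upair; auto. Qed.

Lemma sepE_dfn (Q : ens -> env -> Prop) x e z :
  dfn (fun e => Q (e 0) (tl e)) -> V x -> Venv e ->
  (z ∈ sep x (fun z => Q z e) <-> z ∈ x /\ Q z e).
Proof.
intros HQ Hx He; apply sepE; intros y y' Hy Hm.
apply (@dfn_proper _ (scons y e) (scons y' e) HQ).
- apply Venv_scons; auto; apply (V_mem Hx Hm).
- intros [|n]; simpl; [exact Hy | reflexivity].
Qed.

Lemma V_sep_env (Q : ens -> env -> Prop) x e :
  dfn (fun e => Q (e 0) (tl e)) -> V x -> Venv e -> V (sep x (fun z => Q z e)).
Proof.
intros HQ Hx He; pose proof HQ as [a [c [Hc Ha]]].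
destruct (model_ZFC (V := V)) as [_ [_ [_ [_ [_ [_ [HS _]]]]]]].
destruct (HS (ren (mix (up (fun n => S (n + n) - 1)) (fun n => S (S (n + n)))) a)
             (mix e c) (mix_all (Q := V) He Hc) x Hx) as [u [Hu H]].
refine (V_eqs _ Hu); apply eqs_ext; intros z; rewrite sepE_dfn by auto.
assert (Hz : V z -> (Q z e <-> sat V (scons z (mix e c))
  (ren (mix (up (fun n => S (n + n) - 1)) (fun n => S (S (n + n)))) a))).
{ intros Hz; rewrite (Ha (scons z e) (Venv_scons Hz He)).
  apply sat_ren; intros n; apply scons_mix. }
split.
- intros Hm; assert (HV := V_mem Hu Hm); apply H in Hm; auto; rewrite Hz; auto.
- intros [Hm HQz]; assert (HV := V_mem Hx Hm); apply H; auto; rewrite <- Hz; auto.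
Qed.

Lemma dft_sep (Q : ens -> env -> Prop) t :
  dft t -> dfn (fun e => Q (e 0) (tl e)) -> dft (fun e => sep (t e) (fun z => Q z e)).
Proof.
intros Ht HQ; apply (dft_char (Q := fun z e => z ∈ t e /\ Q z e)).
- intros e He; apply V_sep_env; auto; apply dft_V; auto.
- intros e z He Hz; apply sepE_dfn; auto; apply dft_V; auto.
- apply dfn_and; auto; apply dfn_mem; [apply dft_var | apply (dft_ren S Ht)].
Qed.

Lemma V_repl_env (Q : ens -> ens -> env -> Prop) x e :
  dfn (fun e => Q (e 0) (e 1) (fun n => e (S (S n)))) -> V x -> Venv e ->
  (forall y, y ∈ x -> exists z, V z /\ Q z y e /\ forall z', V z' -> Q z' y e -> z' ≡ z) ->
  exists u, V u /\ forall z, V z -> (z ∈ u <-> exists y, y ∈ x /\ Q z y e).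
Proof.
intros HQ Hx He Hf; pose proof HQ as [a [c [Hc Ha]]].
destruct (model_ZFC (V := V)) as [_ [_ [_ [_ [_ [_ [_ [HR _]]]]]]]].
(* Positions 0 and 1 are taken by [z] and [y]; the interleaving of the other variables with the
   parameters is shifted by two. *)
set (r := mix (up (up (fun n => n + n))) (fun n => S (S (S (n + n))))).
assert (HE : forall z y, V z -> V y ->
               (Q z y e <-> sat V (scons z (scons y (mix e c))) (ren r a))).
{ intros z y Hz Hy; rewrite (Ha (scons z (scons y e))) by (do 2 (apply Venv_scons; auto)).
  apply sat_ren, (mix_ren (R := eqs)); [intros [|[|n]] | intros n]; cbn [scons up];
    rewrite ?mix_even, ?mix_odd; reflexivity. }
destruct (HR (ren r a) (mix e c) (mix_all (Q := V) He Hc) x Hx) as [u [Hu H]].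
- intros y Hy Hyx; destruct (Hf y Hyx) as [z [Hz [HQz Hun]]]; exists z; split; auto.
  split; [apply HE; auto|]; intros z' Hz' Hs; apply Hun; auto; apply HE; auto.
- exists u; split; auto; intros z Hz; rewrite (H z Hz); split.
  + intros [y [Hy [Hyx Hs]]]; exists y; split; auto; apply HE; auto.
  + intros [y [Hyx Hs]]; assert (Hy := V_mem Hx Hyx); exists y; repeat split; auto.
    apply HE; auto.
Qed.

Lemma repE_dft (F : ens -> env -> ens) x e z :
  dft (fun e => F (e 0) (tl e)) -> V x -> Venv e ->
  (z ∈ rep x (fun y => F y e) <-> exists y, y ∈ x /\ z ≡ F y e).
Proof.
intros HF Hx He; apply repE; intros y y' Hy Hm.
apply (@dft_proper _ (scons y e) (scons y' e) HF).
- apply Venv_scons; auto; apply (V_mem Hx Hm).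
- intros [|n]; simpl; [exact Hy | reflexivity].
Qed.

Lemma V_rep_env (F : ens -> env -> ens) x e :
  dft (fun e => F (e 0) (tl e)) -> V x -> Venv e -> V (rep x (fun y => F y e)).
Proof.
intros HF Hx He.
destruct (@V_repl_env (fun z y e => z ≡ F y e) x e) as [u [Hu H]]; auto.
- apply HF.
- intros y Hy; exists (F y e); split; [|split; [reflexivity | auto]].
  apply (dft_V (t := fun e => F (e 0) (tl e)) (e := scons y e)); auto.
  apply Venv_scons; auto; apply (V_mem Hx Hy).
- refine (V_eqs _ Hu); apply eqs_ext; intros z; rewrite repE_dft by auto; split.
  + intros Hz; apply H; auto; apply (V_mem Hu Hz).
  + intros [y [Hy Hz]]; apply H; [|eauto].
    rewrite Hz; apply (dft_V (t := fun e => F (e 0) (tl e)) (e := scons y e)); auto.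
    apply Venv_scons; auto; apply (V_mem Hx Hy).
Qed.

Lemma dft_rep (F : ens -> env -> ens) t :
  dft t -> dft (fun e => F (e 0) (tl e)) -> dft (fun e => rep (t e) (fun y => F y e)).
Proof.
intros Ht HF; apply (dft_char (Q := fun z e => exists y, y ∈ t e /\ z ≡ F y e)).
- intros e He; apply V_rep_env; auto; apply dft_V; auto.
- intros e z He Hz; apply repE_dft; auto; apply dft_V; auto.
- apply (dfn_bex (P := fun y e => e 0 ≡ F y (tl e))); [apply (dft_ren S Ht)|].
  apply dfn_eq; [apply dft_var|].
  exact (dft_ren (fun n => match n with O => O | S m => S (S m) end) HF).
Qed.

End Definability.

(** * Automation of closure and definability *)

Ltac vhook := fail.

Ltac vstep :=
  match goal with
  | H : ?P |- ?P => exact H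
  | |- _ (upair _ _) => apply V_upair
  | |- _ (opair _ _) => apply V_opair
  | |- _ (bigU _) => apply V_bigU
  | |- _ (cup _ _) => apply V_cup
  | |- _ (succ _) => apply V_succ
  | |- _ => vhook
  end.

Ltac vtac := solve [repeat vstep].

(** The placeholders [vhook] and [dhook] are overwritten as new closure lemmas become available. The
    clauses of [dstep] treat one guarded quantifier at a time, which is why later predicates bound
    each quantifier separately, by [V] or by a set. *)
Ltac dhook := fail.

Ltac dstep :=
  match goal with
  | |- dft (fun e => e ?n) => apply dft_var
  | |- dft (fun _ => ?c) => apply dft_cst; vtac
  | H : dft ?t |- dft ?t => exact H
  | H : dft ?t |- dft (fun e => ?t e) => exact H
  | H : dft ?t |- dft (fun e => ?t (fun n => e (@?r n))) => exact (dft_ren r H)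
  | H : dfn ?t |- dfn ?t => exact H
  | H : dfn ?t |- dfn (fun e => ?t e) => exact H
  | H : dfn ?t |- dfn (fun e => ?t (fun n => e (@?r n))) => exact (dfn_ren r H)
  | |- dft (fun e => opair (@?s e) (@?t e)) => apply (dft_opair (s := s) (t := t))
  | |- dft (fun e => upair (@?s e) (@?t e)) => apply (dft_upair (s := s) (t := t))
  | |- dft (fun e => cup (@?s e) (@?t e)) => apply (dft_cup (s := s) (t := t))
  | |- dft (fun e => bigU (@?t e)) => apply (dft_bigU (t := t))
  | |- dft (fun e => succ (@?t e)) => apply (dft_succ (t := t))
  | |- dft (fun e => sep (@?t e) (fun z => @?Q e z)) =>
      apply (dft_sep (Q := fun z e => Q e z) (t := t)); cbv beta
  | |- dft (fun e => rep (@?t e) (fun z => @?Q e z)) =>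
      apply (dft_rep (F := fun z e => Q e z) (t := t)); cbv beta
  | |- dfn (fun _ => False) => apply dfn_bot
  | |- dfn (fun e => ~ @?P e) => apply (dfn_not (P := P))
  | |- dfn (fun e => @?P e /\ @?Q e) => apply (dfn_and (P := P) (Q := Q))
  | |- dfn (fun e => @?P e \/ @?Q e) => apply (dfn_or (P := P) (Q := Q))
  | |- dfn (fun e => @?P e <-> @?Q e) => apply (dfn_iff (P := P) (Q := Q))
  | |- dfn (fun e => @?P e -> @?Q e) => apply (dfn_imp (P := P) (Q := Q))
  | |- dfn (fun e => @?s e ∈ @?t e) => apply (dfn_mem (s := s) (t := t))
  | |- dfn (fun e => @?s e ≡ @?t e) => apply (dfn_eq (s := s) (t := t))
  | |- dfn (fun e => @?s e ⊆ @?t e) => apply (dfn_sub (s := s) (t := t))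
  | |- dfn (fun e => forall x : ens, x ∈ @?t e -> @?P e x) =>
      apply (dfn_ball (P := fun x e => P e x) (t := t)); cbv beta
  | |- dfn (fun e => exists x : ens, x ∈ @?t e /\ @?P e x) =>
      apply (dfn_bex (P := fun x e => P e x) (t := t)); cbv beta
  | |- dfn (fun e => forall x : ens, _ x -> @?P e x) =>
      apply (dfn_all (P := fun x e => P e x)); cbv beta
  | |- dfn (fun e => exists x : ens, _ x /\ @?P e x) =>
      apply (dfn_ex (P := fun x e => P e x)); cbv beta
  | |- dfn (fun e => ?V (@?t e)) => apply (dfn_V (t := t))
  | _ => dhook
  end.

Ltac dauto := repeat dstep.

(** * Power sets, natural numbers and products in the model *)

Section Basics.
Context {V : ens -> Prop} {M : model V}.

Lemma sepE_V (Q : ens -> Prop) x z :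
  dfn (V := V) (fun e => Q (e 0)) -> V x -> (z ∈ sep x Q <-> z ∈ x /\ Q z).
Proof.
intros HQ Hx; exact (@sepE_dfn V M (fun z _ => Q z) x (fun _ => x) z HQ Hx (fun _ => Hx)).
Qed.

Lemma V_sep (Q : ens -> Prop) x :
  dfn (V := V) (fun e => Q (e 0)) -> V x -> V (sep x Q).
Proof.
intros HQ Hx; exact (@V_sep_env V M (fun z _ => Q z) x (fun _ => x) HQ Hx (fun _ => Hx)).
Qed.

Lemma repE_V (F : ens -> ens) x z :
  dft (V := V) (fun e => F (e 0)) -> V x ->
  (z ∈ rep x F <-> exists y, y ∈ x /\ z ≡ F y).
Proof.
intros HF Hx; exact (@repE_dft V M (fun z _ => F z) x (fun _ => x) z HF Hx (fun _ => Hx)).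
Qed.

Lemma V_rep (F : ens -> ens) x :
  dft (V := V) (fun e => F (e 0)) -> V x -> V (rep x F).
Proof.
intros HF Hx; exact (@V_rep_env V M (fun z _ => F z) x (fun _ => x) HF Hx (fun _ => Hx)).
Qed.

Lemma V_repl (Q : ens -> ens -> Prop) x :
  dfn (V := V) (fun e => Q (e 0) (e 1)) -> V x ->
  (forall y, y ∈ x -> exists z, V z /\ Q z y /\ forall z', V z' -> Q z' y -> z' ≡ z) ->
  exists u, V u /\ forall z, V z -> (z ∈ u <-> exists y, y ∈ x /\ Q z y).
Proof.
intros HQ Hx; exact (@V_repl_env V M (fun z y _ => Q z y) x (fun _ => x) HQ Hx (fun _ => Hx)).
Qed.

(** The ambient [pow x] may have elements outside [V], so what [V] provides is the set of those
    subsets that it contains. *)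
Lemma V_pow x : V x -> exists u, V u /\ forall z, z ∈ u <-> V z /\ z ⊆ x.
Proof.
intros Hx; destruct (model_ZFC (V := V)) as [_ [_ [_ [_ [HP _]]]]].
destruct (HP x Hx) as [u [Hu H]]; exists u; split; auto.
assert (H' : forall z, V z -> (z ∈ u <-> z ⊆ x)).
{ intros z Hz; rewrite (H z Hz); split; intros Hs w; auto.
  intros Hw; apply Hs; auto; apply (V_mem Hz Hw). }
intros z; split.
- intros Hz; assert (HV := V_mem Hu Hz); split; auto; apply H'; auto.
- intros [Hz Hs]; apply H'; auto.
Qed.

Lemma V_empty : V empty.
Proof.
destruct (model_ZFC (V := V)) as [_ [_ [_ [_ [_ [[u [_ [[o [Ho [_ H]]] _]]] _]]]]]].
refine (V_eqs _ Ho); apply eqs_ext; intros z; split; intros Hz.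
- destruct (H z (V_mem Ho Hz) Hz).
- destruct (not_mem_empty Hz).
Qed.

Lemma V_vnat n : V (vnat n).
Proof. induction n; cbn [vnat]; [apply V_empty | apply V_succ; assumption]. Qed.

Ltac vhook ::= match goal with |- _ empty => apply V_empty end.

(** A bounded description of the natural numbers, by well-foundedness of membership. It is used to
    separate [omega] from the inductive set that infinity supplies in [V]. *)
Lemma isnat_omega x :
  (forall m, m ∈ succ x -> m ≡ empty \/ exists k, k ∈ succ x /\ m ≡ succ k) -> x ∈ omega.
Proof.
intros H.
assert (Hm : forall m, m ∈ succ x -> m ∈ omega).
{ intros m; induction m as [m IH] using mem_ind; intros Hm.
  destruct (H m Hm) as [H0|[k [Hk HS]]].
  - exists 0; exact H0.
  - destruct (IH k) as [n Hn]; auto; [rewrite HS, succE; right; reflexivity|].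
    exists (S n); rewrite HS, Hn; reflexivity. }
apply Hm; rewrite succE; right; reflexivity.
Qed.

Lemma vnat_isnat n m :
  m ∈ succ (vnat n) -> m ≡ empty \/ exists k, k ∈ succ (vnat n) /\ m ≡ succ k.
Proof.
intros Hm; apply (memvnat (S n)) in Hm as [[|k] [Hk Hm]]; auto.
right; exists (vnat k); split; auto; apply (memvnat (S n)); exists k; split; [lia|reflexivity].
Qed.

Lemma V_omega : V omega.
Proof.
destruct (model_ZFC (V := V)) as [_ [_ [_ [_ [_ [[u [Hu [[o [Ho [Hou H0]]] HS]]] _]]]]]].
set (w := sep u (fun x => forall m, m ∈ succ x -> m ≡ empty \/ exists k, k ∈ succ x /\ m ≡ succ k)).
assert (Hd : dfn (V := V) (fun e => forall m, m ∈ succ (e 0) -> m ≡ empty \/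
               exists k, k ∈ succ (e 0) /\ m ≡ succ k)) by dauto.
assert (Hw : V w) by (apply V_sep; auto).
refine (V_eqs _ Hw); apply eqs_ext; intros z; unfold w; rewrite sepE_V by auto; split.
- intros [_ Hz]; apply isnat_omega, Hz.
- intros [n Hn]; simpl in Hn; split.
  + rewrite Hn; clear z Hn; induction n as [|n IH]; cbn [vnat].
    * assert (He : empty ≡ o).
      { apply eqs_ext; intros y; split; intros Hy; [destruct (not_mem_empty Hy)|].
        destruct (H0 y (V_mem Ho Hy) Hy). }
      rewrite He; exact Hou.
    * destruct (HS _ (V_mem Hu IH) IH) as [s [Hs [Hsu Hx]]].
      assert (He : succ (vnat n) ≡ s).
      { apply eqs_ext; intros y; rewrite succE; split.
        - intros Hy; apply Hx; auto; destruct Hy as [Hy|Hy]; [|rewrite Hy; apply V_vnat].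
          apply (V_mem (V_vnat n) Hy).
        - intros Hy; apply Hx; auto; apply (V_mem Hs Hy). }
      rewrite He; exact Hsu.
  + intros m; setoid_rewrite Hn; apply vnat_isnat.
Qed.

Lemma V_one : V one.
Proof. apply (V_vnat 1). Qed.

Lemma V_two : V two.
Proof. apply (V_vnat 2). Qed.

Lemma V_cprod x y : V x -> V y -> V (cprod x y).
Proof.
intros Hx Hy.
assert (Hd : dft (V := V) (fun e => rep y (fun b => opair (e 0) b))) by dauto.
apply (V_eqs (x := bigU (rep x (fun a => rep y (fun b => opair a b)))));
  [|apply V_bigU, V_rep; auto].
apply eqs_ext; intros z; rewrite cprodE, bigUE; split.
- intros [w [Hw Hz]]; rewrite repE_V in Hw by auto; destruct Hw as [a [Ha Hw]].
  assert (HVa := V_mem Hx Ha).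
  rewrite Hw, repE_V in Hz by (auto; dauto); destruct Hz as [b Hb]; exists a, b; tauto.
- intros [a [b [Ha [Hb Hz]]]]; assert (HVa := V_mem Hx Ha).
  exists (rep y (fun b => opair a b)); rewrite !repE_V by (auto; dauto).
  split; [exists a; split; auto; reflexivity | exists b; auto].
Qed.

Lemma dft_cprod s t : dft (V := V) s -> dft (V := V) t -> dft (V := V) (fun e => cprod (s e) (t e)).
Proof.
intros Hs Ht.
apply (dft_char (Q := fun z e => exists a, a ∈ s e /\ exists b, b ∈ t e /\ z ≡ opair a b)).
- intros e He; apply V_cprod; apply dft_V; auto.
- intros e z He Hz; rewrite cprodE; firstorder.
- dauto.
Qed.

End Basics.

Ltac vhook ::=
  match goal with
  | |- _ empty => apply V_empty
  | |- _ omega => apply V_omega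
  | |- _ (vnat _) => apply V_vnat
  | |- _ one => apply V_one
  | |- _ two => apply V_two
  | |- _ (cprod _ _) => apply V_cprod
  end.

Ltac dhook ::=
  match goal with
  | |- dft (fun e => cprod (@?s e) (@?t e)) => apply (dft_cprod (s := s) (t := t))
  end.

(** * Functions, recursion and transitive closures in the model *)

Section Functions.
Context {V : ens -> Prop} {M : model V}.
Notation dfn := (dfn (V := V)).
Notation dft := (dft (V := V)).

#[global] Instance function_proper : Proper (eqs ==> eqs ==> eqs ==> iff) function.
Proof.
intros f f' Hf x x' Hx y y' Hy; unfold function.
setoid_rewrite Hf; setoid_rewrite Hx; setoid_rewrite Hy; reflexivity.
Qed.

#[global] Instance injection_proper : Proper (eqs ==> eqs ==> eqs ==> iff) injection.
Proof.
intros f f' Hf x x' Hx y y' Hy; unfold injection.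
rewrite Hf at 1; rewrite Hx, Hy; setoid_rewrite Hf; reflexivity.
Qed.

#[global] Instance bijection_proper : Proper (eqs ==> eqs ==> eqs ==> iff) bijection.
Proof.
intros f f' Hf x x' Hx y y' Hy; unfold bijection.
rewrite Hf at 1; rewrite Hx, Hy at 1; setoid_rewrite Hf; setoid_rewrite Hy; reflexivity.
Qed.

Lemma function_dom f x y a b : function f x y -> opair a b ∈ f -> a ∈ x /\ b ∈ y.
Proof. intros [H _] Hf; apply opair_cprod, H, Hf. Qed.

(** The quantifiers of [function] run over the whole universe; since f ⊆ x × y they may be bounded
    by [x] and [y], after which the formula is absolute. *)
Lemma dfn_function f x y :
  dft f -> dft x -> dft y -> dfn (fun e => function (f e) (x e) (y e)).
Proof.
intros Hf Hx Hy; apply (dfn_ext (Q := fun e => f e ⊆ cprod (x e) (y e) /\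
  (forall a, a ∈ x e -> exists b, b ∈ y e /\ opair a b ∈ f e) /\
  (forall a, a ∈ x e -> forall b, b ∈ y e -> forall b', b' ∈ y e ->
     opair a b ∈ f e -> opair a b' ∈ f e -> b ≡ b'))).
- intros e He; unfold function; split; intros [H1 [H2 H3]]; split; auto; split.
  + intros a Ha; destruct (H2 a Ha) as [b Hb]; exists b; split; auto.
    apply (opair_cprod (x e) (y e) a b), H1, Hb.
  + intros; eapply H3; eauto.
  + intros a Ha; destruct (H2 a Ha) as [b Hb]; exists b; tauto.
  + intros a b b' Hb Hb'.
    pose proof (proj1 (opair_cprod _ _ _ _) (H1 _ Hb)).
    pose proof (proj1 (opair_cprod _ _ _ _) (H1 _ Hb')).
    apply (H3 a); tauto.
- dauto.
Qed.

Lemma dfn_injection f x y :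
  dft f -> dft x -> dft y -> dfn (fun e => injection (f e) (x e) (y e)).
Proof.
intros Hf Hx Hy; apply (dfn_ext (Q := fun e => function (f e) (x e) (y e) /\
  (forall a, a ∈ x e -> forall a', a' ∈ x e -> forall b, b ∈ y e ->
     opair a b ∈ f e -> opair a' b ∈ f e -> a ≡ a'))).
- intros e He; unfold injection; split; intros [H1 H2]; split; auto.
  + intros; eapply H2; eauto.
  + intros a a' b Hb Hb'.
    pose proof (function_dom H1 Hb); pose proof (function_dom H1 Hb').
    apply (H2 a) with (b := b); tauto.
- apply dfn_and; [apply dfn_function; auto | dauto].
Qed.

Lemma dfn_bijection f x y :
  dft f -> dft x -> dft y -> dfn (fun e => bijection (f e) (x e) (y e)).
Proof.
intros Hf Hx Hy; apply (dfn_ext (Q := fun e => injection (f e) (x e) (y e) /\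
  (forall b, b ∈ y e -> exists a, a ∈ x e /\ opair a b ∈ f e))).
- intros e He; unfold bijection; split; intros [H1 H2]; split; auto; intros b Hb;
    destruct (H2 b Hb) as [a Ha]; exists a; [|tauto].
  pose proof (function_dom (proj1 H1) Ha); tauto.
- apply dfn_and; [apply dfn_injection; auto | dauto].
Qed.

Lemma dfn_finite t : dft t -> dfn (fun e => finite_in V (t e)).
Proof.
intros Ht; apply (dfn_ext (Q := fun e => exists n, n ∈ omega /\
  exists f, V f /\ bijection f (t e) n)).
- intros e He; firstorder.
- dauto; apply dfn_bijection; dauto.
Qed.

Lemma dfn_countable t : dft t -> dfn (fun e => countable_in V (t e)).
Proof.
intros Ht; unfold countable_in; dauto; apply dfn_injection; dauto.
Qed.

#[global] Instance finite_proper : Proper (eqs ==> iff) (finite_in V).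
Proof. intros x x' Hx; unfold finite_in; setoid_rewrite Hx; reflexivity. Qed.

#[global] Instance countable_proper : Proper (eqs ==> iff) (countable_in V).
Proof. intros x x' Hx; unfold countable_in; setoid_rewrite Hx; reflexivity. Qed.

(** Recursion on [omega] inside [V]. An approximation is a set of pairs in which every pair is
    either the start or the successor of another pair of the set. It need not be assumed to be a
    function: induction shows that it gives no wrong value at a natural number. Replacement then
    collects the correct pairs. *)
Lemma V_nat_rec (F : ens -> ens) a :
  dft (fun e => F (e 0)) -> V a -> V (sup (fun n => opair (vnat n) (Nat.iter n F a))).
Proof.
intros HF Ha.
assert (HFV : forall x, V x -> V (F x)).
{ intros x Hx; apply (dft_V (t := fun e => F (e 0)) (e := fun _ => x)); auto; intros n; auto. }
assert (HFp : forall x y, V x -> x ≡ y -> F x ≡ F y).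
{ intros x y Hx H; apply (dft_proper (t := fun e => F (e 0)) (e := fun _ => x) (e' := fun _ => y));
    auto; intros n; auto. }
set (u := fun n => Nat.iter n F a).
assert (Hu : forall n, V (u n)) by (induction n; cbn; auto).
set (apx := fun f => forall t, t ∈ f -> t ≡ opair empty a \/
  exists k, V k /\ exists x, V x /\ opair k x ∈ f /\ t ≡ opair (succ k) (F x)).
assert (Hsound : forall f n y, apx f -> opair (vnat n) y ∈ f -> y ≡ u n).
{ intros f n; induction n as [|n IH]; intros y Hf Hy;
    destruct (Hf _ Hy) as [H|[k [Hk [x [Hx [Hkx H]]]]]]; apply opair_inj in H as [H1 H2].
  - exact H2.
  - symmetry in H1; destruct (succ_not_empty H1).
  - destruct (succ_not_empty H1).
  - apply succ_inj in H1; rewrite <- H1 in Hkx; rewrite H2; cbn.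
    apply HFp; auto; apply IH; auto. }
assert (Hex : forall n, exists f, V f /\ apx f /\ opair (vnat n) (u n) ∈ f).
{ induction n as [|n [f [Hf [Haf Hn]]]].
  - exists (upair (opair empty a) (opair empty a)); split; [vtac|split].
    + intros t Ht; rewrite upairE in Ht; tauto.
    + rewrite upairE; left; reflexivity.
  - exists (cup f (upair (opair (vnat (S n)) (u (S n))) (opair (vnat (S n)) (u (S n))))).
    split; [apply V_cup; auto; apply V_upair; apply V_opair; first [apply Hu | apply V_vnat]|split].
    + intros t Ht; rewrite cupE, upairE in Ht.
      assert (Ht' : t ∈ f \/ t ≡ opair (vnat (S n)) (u (S n))) by tauto; clear Ht.
      destruct Ht' as [Ht|Ht].
      * destruct (Haf t Ht) as [H|[k [Hk [x [Hx [Hkx H]]]]]]; auto.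
        right; exists k; split; auto; exists x; split; auto; split; auto.
        rewrite cupE; auto.
      * right; exists (vnat n); split; [vtac|]; exists (u n); split; auto.
        split; [rewrite cupE; auto | exact Ht].
    + rewrite cupE, upairE; right; left; reflexivity. }
destruct (@V_repl V M (fun z y => exists x, V x /\ z ≡ opair y x /\
            exists f, V f /\ apx f /\ opair y x ∈ f) omega) as [w [Hw H]].
- unfold apx.
  assert (HF' := fun r => dft_ren r HF); cbv beta in HF'.
  dauto; apply (HF' (fun _ => 0)).
- vtac.
- intros y [n Hn]; simpl in Hn; exists (opair y (u n)).
  assert (Hy : V y) by (rewrite Hn; vtac).
  split; [apply V_opair; auto|split].
  + exists (u n); split; auto; split; [reflexivity|]; destruct (Hex n) as [f Hf].
    exists f; rewrite Hn; exact Hf.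
  + intros z' Hz' [x [Hx [Hz [f [Hf [Haf Hm]]]]]].
    rewrite Hn in Hm; rewrite Hz, (Hsound f n x Haf Hm); reflexivity.
- refine (V_eqs _ Hw); apply eqs_ext; intros z; split.
  + intros Hz; apply H in Hz; [|apply (V_mem Hw Hz)].
    destruct Hz as [y [[n Hn] [x [Hx [Hz [f [Hf [Haf Hm]]]]]]]]; simpl in Hn.
    exists n; cbn [elt]; rewrite Hn in Hm; rewrite Hz, Hn, (Hsound f n x Haf Hm); reflexivity.
  + intros [n Hn]; cbn [elt] in Hn.
    apply H; [rewrite Hn; apply V_opair; [apply V_vnat | apply Hu]|].
    exists (vnat n); split; [apply vnat_omega|]; exists (u n); split; auto.
Qed.

(** By induction, the closure of [x] is [x] together with the closures of its elements. Leastness is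
    carried along because replacement needs the closure of each element to be unique. *)
Lemma V_tc x : V x ->
  exists t, V t /\ x ⊆ t /\ (forall y, y ∈ t -> y ⊆ t) /\
    forall t', V t' -> x ⊆ t' -> (forall y, y ∈ t' -> y ⊆ t') -> t ⊆ t'.
Proof.
induction x as [x IH] using mem_ind; intros Hx.
set (Q := fun t y => y ⊆ t /\ (forall z, z ∈ t -> z ⊆ t) /\
    forall t', V t' -> y ⊆ t' -> (forall z, z ∈ t' -> z ⊆ t') -> t ⊆ t').
assert (HQ : dfn (fun e => Q (e 0) (e 1))) by (unfold Q; dauto).
destruct (@V_repl V M Q x HQ Hx) as [u [Hu H]].
{ intros y Hy; destruct (IH y Hy (V_mem Hx Hy)) as [t [Ht Hq]]; exists t; split; auto.
  split; auto; intros t' Ht' [H1 [H2 H3]]; destruct Hq as [H4 [H5 H6]].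
  apply sub_antisym; auto. }
exists (cup x (bigU u)); split; [vtac|]; split; [|split].
- intros z Hz; rewrite cupE; auto.
- intros y Hy z Hz; rewrite cupE, bigUE in *; right.
  destruct Hy as [Hy|[t [Ht Hy]]].
  + destruct (IH y Hy (V_mem Hx Hy)) as [t [Ht Hq]]; exists t; split.
    * apply H; auto; exists y; auto.
    * apply (proj1 Hq), Hz.
  + exists t; split; auto; apply H in Ht as [y' [Hy' [_ [Hq _]]]]; [|apply (V_mem Hu Ht)].
    apply (Hq y Hy z Hz).
- intros t' Ht' Hxt Htr z Hz; rewrite cupE, bigUE in Hz; destruct Hz as [Hz|[t [Ht Hz]]].
  + apply Hxt, Hz.
  + assert (HVt := V_mem Hu Ht); apply H in Ht as [y' [Hy' [_ [_ Hq]]]]; auto.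
    apply (Hq t'); auto.
Qed.

Lemma V_transitive_superset x : V x -> exists t, V t /\ x ∈ t /\ forall y, y ∈ t -> y ⊆ t.
Proof.
intros Hx; destruct (@V_tc (upair x x)) as [t [Ht [Hs [Htr _]]]]; [vtac|].
exists t; split; auto; split; auto; apply Hs; rewrite upairE; left; reflexivity.
Qed.

End Functions.

Ltac dhook ::=
  match goal with
  | |- dft (fun e => cprod (@?s e) (@?t e)) => apply (dft_cprod (s := s) (t := t))
  | |- dfn (fun e => function (@?f e) (@?s e) (@?t e)) => apply (dfn_function (f := f) (x := s) (y := t))
  | |- dfn (fun e => injection (@?f e) (@?s e) (@?t e)) => apply (dfn_injection (f := f) (x := s) (y := t))
  | |- dfn (fun e => bijection (@?f e) (@?s e) (@?t e)) => apply (dfn_bijection (f := f) (x := s) (y := t))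
  | |- dfn (fun e => finite_in _ (@?t e)) => apply (dfn_finite (t := t))
  | |- dfn (fun e => countable_in _ (@?t e)) => apply (dfn_countable (t := t))
  end.

(** * Finite and countable sets of the model *)

Section Cardinality.
Context {V : ens -> Prop} {M : model V}.
Notation dfn := (dfn (V := V)).
Notation dft := (dft (V := V)).

Lemma V_fset l : Forall V l -> V (fset l).
Proof.
induction 1 as [|x l Hx Hl IH]; simpl; vtac.
Qed.

Lemma rel_ext x y f g :
  f ⊆ cprod x y -> g ⊆ cprod x y ->
  (forall a b, a ∈ x -> b ∈ y -> (opair a b ∈ f <-> opair a b ∈ g)) -> f ≡ g.
Proof.
intros Hf Hg H; apply eqs_ext; intros z; split; intros Hz.
- pose proof (Hf _ Hz) as Hz'; rewrite cprodE in Hz'; destruct Hz' as [a [b [Ha [Hb Hz']]]].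
  rewrite Hz' in *; apply H; auto.
- pose proof (Hg _ Hz) as Hz'; rewrite cprodE in Hz'; destruct Hz' as [a [b [Ha [Hb Hz']]]].
  rewrite Hz' in *; apply H; auto.
Qed.

Lemma finite_fset l : Forall V l -> finite_in V (fset l).
Proof.
induction 1 as [|x l Hx Hl IH]; cbn [fset fold_right].
- exists empty, empty; split; [exact (vnat_omega 0)|]; split; [vtac|].
  assert (He : forall z, ~ z ∈ empty) by exact not_mem_empty.
  split; [split; [split; [|split]|]|].
  + intros z Hz; destruct (He z Hz).
  + intros a Ha; destruct (He a Ha).
  + intros a b b' H; destruct (He _ H).
  + intros a a' b H; destruct (He _ H).
  + intros b Hb; destruct (He b Hb).
- change (fold_right (fun y s => cup (upair y y) s) empty l) with (fset l).
  destruct (classic (x ∈ fset l)) as [Hm|Hm].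
  + enough (Hc : cup (upair x x) (fset l) ≡ fset l) by (rewrite Hc; exact IH).
    apply eqs_ext; intros z; rewrite cupE, upairE; split; auto.
    intros [[H|H]|H]; auto; rewrite H; auto.
  + destruct IH as [n [f [[k Hk] [Hf [[[Hs [Ht Hfun]] Hinj] Hsurj]]]]].
    cbn [elt omega] in Hk.
    assert (Hlt : forall a b, opair a b ∈ f -> a ∈ fset l /\ exists m, m < k /\ b ≡ vnat m).
    { intros a b Hab; apply Hs, opair_cprod in Hab as [Ha Hb]; split; auto.
      rewrite Hk in Hb; apply memvnat in Hb; exact Hb. }
    set (t := opair x (vnat k)).
    assert (Hg : forall a b, opair a b ∈ cup f (upair t t) <->
                   opair a b ∈ f \/ (a ≡ x /\ b ≡ vnat k)).
    { intros a b; rewrite cupE, upairE; unfold t; split.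
      - intros [H|[H|H]]; auto; apply opair_inj in H; auto.
      - intros [H|[H1 H2]]; auto; right; left; rewrite H1, H2; reflexivity. }
    exists (vnat (S k)), (cup f (upair t t)); split; [apply vnat_omega|].
    split; [unfold t; vtac|split; [split; [split; [|split]|]|]].
    * intros z Hz; rewrite cupE, upairE in Hz; destruct Hz as [Hz|Hz].
      -- pose proof (Hs _ Hz) as Hz'; rewrite cprodE in Hz'.
         destruct Hz' as [a [b [Ha [Hb Hz']]]]; rewrite Hz', opair_cprod, cupE.
         split; auto; cbn [vnat]; rewrite succE, <- Hk; auto.
      -- assert (Hzt : z ≡ t) by tauto; rewrite Hzt; unfold t; rewrite opair_cprod, cupE, upairE.
         split; [left; left; reflexivity | apply succE; right; reflexivity].
    * intros a Ha; rewrite cupE, upairE in Ha; destruct Ha as [Ha|Ha].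
      -- exists (vnat k); apply Hg; right; split; [tauto | reflexivity].
      -- destruct (Ht a Ha) as [b Hb]; exists b; apply Hg; auto.
    * intros a b b' H1 H2; apply Hg in H1, H2.
      destruct H1 as [H1|[H1 H1']], H2 as [H2|[H2 H2']].
      -- apply (Hfun a); auto.
      -- apply Hlt in H1; rewrite H2 in H1; tauto.
      -- apply Hlt in H2; rewrite H1 in H2; tauto.
      -- rewrite H1', H2'; reflexivity.
    * intros a a' b H1 H2; apply Hg in H1, H2.
      destruct H1 as [H1|[H1 H1']], H2 as [H2|[H2 H2']].
      -- apply (Hinj a a' b); auto.
      -- apply Hlt in H1 as [_ [m [Hm' Hb]]]; rewrite H2' in Hb; apply vnat_inj in Hb; lia.
      -- apply Hlt in H2 as [_ [m [Hm' Hb]]]; rewrite H1' in Hb; apply vnat_inj in Hb; lia.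
      -- rewrite H1, H2; reflexivity.
    * intros b Hb; cbn [vnat] in Hb; rewrite succE, <- Hk in Hb; destruct Hb as [Hb|Hb].
      -- destruct (Hsurj b Hb) as [a Ha]; exists a; apply Hg; auto.
      -- exists x; apply Hg; right; split; [reflexivity | rewrite Hb, Hk; reflexivity].
Qed.

(** As [omega] consists of the standard numerals, an internal bijection can be read off as a Rocq
    list of preimages. Later finiteness arguments become inductions on lists. *)
Lemma finite_list x : finite_in V x -> exists l, Forall V l /\ x ≡ fset l.
Proof.
intros [n [f [[N HN] [Hf [[[Hs [Ht Hfun]] Hinj] Hsurj]]]]]; cbn [elt omega] in HN.
assert (H : forall k, k <= N -> exists l, Forall V l /\
          forall z, z ∈ fset l <-> exists m, m < k /\ opair z (vnat m) ∈ f).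
{ induction k as [|k IH]; intros Hk.
  - exists nil; split; [constructor|]; intros z; split; [intros H; destruct (not_mem_empty H)|].
    intros [m [H _]]; lia.
  - destruct IH as [l [Hl H]]; [lia|].
    destruct (Hsurj (vnat k)) as [a Ha]; [rewrite HN; apply memvnat; exists k; split; [lia|reflexivity]|].
    exists (a :: l); split; [constructor; auto; apply (V_opl (V_mem Hf Ha))|].
    intros z; rewrite fsetE, Exists_cons, <- fsetE, H; split.
    + intros [Hz|[m [Hm Hz]]]; [exists k; split; [lia|] | exists m; split; [lia | exact Hz]].
      rewrite Hz; exact Ha.
    + intros [m [Hm Hz]]; destruct (Nat.eq_dec m k) as [->|]; [left | right; exists m; split; auto; lia].
      apply (Hinj z a (vnat k)); auto. }
destruct (H N (le_n N)) as [l [Hl Hz]]; exists l; split; auto.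
apply eqs_ext; intros z; rewrite Hz; split.
- intros Hx; destruct (Ht z Hx) as [b Hb]; pose proof (Hs _ Hb) as Hb'.
  apply opair_cprod in Hb' as [_ Hb']; rewrite HN, memvnat in Hb'.
  destruct Hb' as [m [Hm Hbm]]; exists m; split; auto; rewrite <- Hbm; exact Hb.
- intros [m [Hm Hb]]; apply Hs, opair_cprod in Hb; tauto.
Qed.

Lemma fset_app l l' : fset (l ++ l') ≡ cup (fset l) (fset l').
Proof.
apply eqs_ext; intros z; rewrite cupE, !fsetE; apply Exists_app.
Qed.

Lemma finite_cup x y : finite_in V x -> finite_in V y -> finite_in V (cup x y).
Proof.
intros Hx Hy; apply finite_list in Hx as [l [Hl Hx]]; apply finite_list in Hy as [l' [Hl' Hy]].
rewrite Hx, Hy, <- fset_app; apply finite_fset, Forall_app; auto.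
Qed.

(** The map is given as a relation because permutations are sets of pairs and yield no Rocq function
    on [ens]. *)
Lemma list_image (R : ens -> ens -> Prop) l :
  (forall x x' z, x ≡ x' -> R x z -> R x' z) ->
  (forall x, x ∈ fset l -> exists y, V y /\ forall z, R x z <-> z ≡ y) ->
  exists l', Forall V l' /\ forall z, z ∈ fset l' <-> exists x, x ∈ fset l /\ R x z.
Proof.
intros HR; induction l as [|x l IH]; intros H.
- exists nil; split; [constructor|]; intros z; split; [intros Hz; destruct (not_mem_empty Hz)|].
  intros [x [Hx _]]; destruct (not_mem_empty Hx).
- destruct IH as [l' [Hl' Hz]]; [intros y Hy; apply H; cbn; rewrite cupE; auto|].
  destruct (H x) as [y [Hy Hxy]]; [cbn; rewrite cupE, upairE; left; left; reflexivity|].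
  exists (y :: l'); split; [constructor; auto|]; intros z.
  rewrite fsetE, Exists_cons, <- fsetE, Hz, <- Hxy.
  change (fset (x :: l)) with (cup (upair x x) (fset l)).
  setoid_rewrite cupE; setoid_rewrite upairE; split.
  + intros [Hx|[x' Hx']]; [exists x; split; auto; left; left; reflexivity | exists x'; tauto].
  + intros [x' [[Hx|Hx] Hx']]; [left; apply (HR x' x); tauto | right; exists x'; auto].
Qed.

Lemma countable_sub x y : V x -> x ⊆ y -> countable_in V y -> countable_in V x.
Proof.
intros Hx Hxy [f [Hf [[Hs [Ht Hfun]] Hinj]]].
exists (cap f (cprod x omega)); split; [|split; [split; [|split]|]].
- apply V_sep; [dauto | exact Hf].
- intros z; rewrite capE; tauto.
- intros a Ha; destruct (Ht a (Hxy a Ha)) as [b Hb]; exists b; rewrite capE; split; auto.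
  apply opair_cprod; split; auto; apply Hs, opair_cprod in Hb; tauto.
- intros a b b'; rewrite !capE; intros H H'; apply (Hfun a); tauto.
- intros a a' b; rewrite !capE; intros H H'; apply (Hinj a a' b); tauto.
Qed.

(** Doubling as a set of [V], iterating the double successor; it codes two countable sets by even
    and odd numbers. *)
Lemma double_graph :
  exists D, V D /\ forall x k, opair x k ∈ D <-> exists n, x ≡ vnat n /\ k ≡ vnat (n + n).
Proof.
exists (sup (fun n => opair (vnat n) (Nat.iter n (fun x => succ (succ x)) empty))).
split; [apply V_nat_rec; [dauto | vtac]|].
assert (H : forall n, Nat.iter n (fun x => succ (succ x)) empty ≡ vnat (n + n)).
{ induction n as [|n IH]; [reflexivity|].
  cbn [Nat.iter Nat.add]; rewrite Nat.add_succ_r; cbn [vnat].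
  apply succ_proper, succ_proper, IH. }
intros x k; split.
- intros [n Hn]; cbn [elt] in Hn; apply opair_inj in Hn; rewrite H in Hn; exists n; exact Hn.
- intros [n Hn]; exists n; cbn [elt]; rewrite H, (proj1 Hn), (proj2 Hn); reflexivity.
Qed.

(** Elements of [x] go to even numbers through [f], the remaining elements of [y] to odd numbers
    through [g]. *)
Lemma countable_cup x y :
  V x -> V y -> countable_in V x -> countable_in V y -> countable_in V (cup x y).
Proof.
intros Hx Hy [f [Hf [[Hs [Ht Hfun]] Hinj]]] [g [Hg [[Hs' [Ht' Hfun']] Hinj']]].
destruct double_graph as [D [HD HDE]].
set (Q := fun t => exists a, a ∈ cup x y /\ exists j, j ∈ omega /\ exists k, k ∈ omega /\
   opair j k ∈ D /\ ((opair a j ∈ f /\ t ≡ opair a k) \/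
                     (~ a ∈ x /\ opair a j ∈ g /\ t ≡ opair a (succ k)))).
assert (HQ : dfn (fun e => Q (e 0))) by (unfold Q; dauto).
set (h := sep (cprod (cup x y) omega) Q).
assert (Hh : forall a b, opair a b ∈ h <->
  (exists n, opair a (vnat n) ∈ f /\ b ≡ vnat (n + n)) \/
  (~ a ∈ x /\ exists n, opair a (vnat n) ∈ g /\ b ≡ vnat (S (n + n)))).
{ intros a b; unfold h; rewrite sepE_V by (auto; vtac); unfold Q; split.
  - intros [_ [a' [_ [j [_ [k [_ [Hjk H]]]]]]]]; apply HDE in Hjk as [n [Hj Hk]].
    destruct H as [[H1 H2]|[H1 [H2 H3]]]; [left|right].
    + apply opair_inj in H2 as [H2 H3]; exists n; rewrite H2, <- Hj, H3; auto.
    + apply opair_inj in H3 as [H3 H4]; split; [rewrite H3; auto|].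
      exists n; rewrite H3, <- Hj; split; auto; rewrite H4, Hk; reflexivity.
  - intros [[n [H1 H2]]|[H0 [n [H1 H2]]]].
    + assert (Ha : a ∈ cup x y) by (apply Hs, opair_cprod in H1; rewrite cupE; tauto).
      split; [apply opair_cprod; split; auto; exists (n + n); exact H2|].
      exists a; split; auto; exists (vnat n); split; [apply vnat_omega|].
      exists (vnat (n + n)); split; [apply vnat_omega|]; split; [apply HDE; exists n; split; reflexivity|].
      left; split; auto; rewrite H2; reflexivity.
    + assert (Ha : a ∈ cup x y) by (apply Hs', opair_cprod in H1; rewrite cupE; tauto).
      split; [apply opair_cprod; split; auto; exists (S (n + n)); exact H2|].
      exists a; split; auto; exists (vnat n); split; [apply vnat_omega|].
      exists (vnat (n + n)); split; [apply vnat_omega|]; split; [apply HDE; exists n; split; reflexivity|].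
      right; split; auto; split; auto; rewrite H2; reflexivity. }
exists h; split; [apply V_sep; auto; vtac|]; split; [split; [|split]|].
- intros z; unfold h; rewrite sepE_V by (auto; vtac); tauto.
- intros a Ha; rewrite cupE in Ha; destruct (classic (a ∈ x)) as [Hax|Hax].
  + destruct (Ht a Hax) as [b Hb]; pose proof (Hs _ Hb) as Hb'.
    apply opair_cprod in Hb' as [_ [n Hn]]; cbn in Hn.
    exists (vnat (n + n)); apply Hh; left; exists n; rewrite <- Hn; split; auto; reflexivity.
  + destruct (Ht' a) as [b Hb]; [tauto|]; pose proof (Hs' _ Hb) as Hb'.
    apply opair_cprod in Hb' as [_ [n Hn]]; cbn in Hn.
    exists (vnat (S (n + n))); apply Hh; right; split; auto; exists n; rewrite <- Hn; split; auto; reflexivity.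
- intros a b b' H H'; apply Hh in H, H'.
  destruct H as [[n [H1 H2]]|[H0 [n [H1 H2]]]], H' as [[n' [H1' H2']]|[H0' [n' [H1' H2']]]].
  + pose proof (Hfun _ _ _ H1 H1') as E; apply vnat_inj in E; subst n'; rewrite H2, H2'; reflexivity.
  + apply Hs, opair_cprod in H1; tauto.
  + apply Hs, opair_cprod in H1'; tauto.
  + pose proof (Hfun' _ _ _ H1 H1') as E; apply vnat_inj in E; subst n'; rewrite H2, H2'; reflexivity.
- intros a a' b H H'; apply Hh in H, H'.
  destruct H as [[n [H1 H2]]|[H0 [n [H1 H2]]]], H' as [[n' [H1' H2']]|[H0' [n' [H1' H2']]]];
    rewrite H2 in H2'; apply vnat_inj in H2'; try lia; assert (n' = n) by lia; subst n'.
  + apply (Hinj _ _ (vnat n)); auto.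
  + apply (Hinj' _ _ (vnat n)); auto.
Qed.

Lemma countable_singleton x : V x -> countable_in V (upair x x).
Proof.
intros Hx; exists (upair (opair x empty) (opair x empty)); split; [vtac|].
assert (H : forall a b, opair a b ∈ upair (opair x empty) (opair x empty) <-> a ≡ x /\ b ≡ empty).
{ intros a b; rewrite upairE; split.
  - intros [H|H]; apply opair_inj in H; auto.
  - intros [H1 H2]; left; rewrite H1, H2; reflexivity. }
split; [split; [|split]|].
- intros z Hz; rewrite upairE in Hz; assert (Hz' : z ≡ opair x empty) by tauto.
  rewrite Hz', opair_cprod, upairE; split; [left; reflexivity | exact (vnat_omega 0)].
- intros a Ha; exists empty; apply H; split; [|reflexivity]; rewrite upairE in Ha; tauto.
- intros a b b' H1 H2; apply H in H1, H2; rewrite (proj2 H1), (proj2 H2); reflexivity.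
- intros a a' b H1 H2; apply H in H1, H2; rewrite (proj1 H1), (proj1 H2); reflexivity.
Qed.

Lemma countable_empty : countable_in V empty.
Proof.
apply (countable_sub (y := upair empty empty)); [vtac| |apply countable_singleton; vtac].
intros z Hz; destruct (not_mem_empty Hz).
Qed.

Lemma countable_fset l : Forall V l -> countable_in V (fset l).
Proof.
induction 1 as [|x l Hx Hl IH]; [apply countable_empty|].
apply countable_cup; auto; [vtac | apply V_fset; auto | apply countable_singleton; auto].
Qed.

End Cardinality.

(** * Conditions and permutations *)

Class ground (V : ens -> Prop) (w1 : ens) : Prop :=
  { ground_model :: model V; ground_w1 : is_omega1 V w1 }.

Section Conditions.
Context {V : ens -> Prop} {w1 : ens} {M : ground V w1}.
Notation dfn := (dfn (V := V)).
Notation dft := (dft (V := V)).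
Notation P := (Add V w1).
Notation act := (act_cond w1).

Lemma V_w1 : V w1.
Proof. apply (ground_w1 (V := V)). Qed.

Lemma V_box : V (cond_box w1).
Proof. unfold cond_box; pose proof V_w1; vtac. Qed.

Lemma boxE t : t ∈ cond_box w1 <->
  exists a n i, a ∈ w1 /\ n ∈ omega /\ i ∈ two /\ t ≡ opair (opair a n) i.
Proof.
unfold cond_box; rewrite cprodE; setoid_rewrite cprodE; split.
- intros [b [i [[a [n [Ha [Hn Hb]]]] [Hi Ht]]]]; exists a, n, i.
  rewrite Hb in Ht; auto.
- intros [a [n [i [Ha [Hn [Hi Ht]]]]]]; exists (opair a n), i; split; auto.
  exists a, n; split; auto; split; auto; reflexivity.
Qed.

Lemma opair_box a n i : opair (opair a n) i ∈ cond_box w1 <-> a ∈ w1 /\ n ∈ omega /\ i ∈ two.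
Proof. unfold cond_box; rewrite !opair_cprod; tauto. Qed.

Lemma AddE p : p ∈ P <-> p ⊆ cond_box w1 /\ V p /\ finite_in V p /\
  forall a i j, opair a i ∈ p -> opair a j ∈ p -> i ≡ j.
Proof.
unfold Add; rewrite sepE, powE; [reflexivity|].
intros y y' Hy _ [H1 [H2 H3]]; rewrite <- Hy; split; auto; split; auto.
intros a i j; rewrite <- Hy; apply H3.
Qed.

Lemma V_Add : V P.
Proof.
destruct (V_pow V_box) as [u [Hu H]].
set (Q := fun p => p ⊆ cond_box w1 /\ finite_in V p /\
  forall a, V a -> forall i, V i -> forall j, V j -> opair a i ∈ p -> opair a j ∈ p -> i ≡ j).
pose proof V_box as HB.
assert (HQ : dfn (fun e => Q (e 0))) by (unfold Q; dauto).
refine (V_eqs _ (V_sep HQ Hu)); apply eqs_ext; intros p.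
rewrite sepE_V, H, AddE by auto; unfold Q; split.
- intros [[HV _] [H1 [H2 H3]]]; split; auto; split; auto; split; auto.
  intros a i j Hi Hj; assert (HVi := V_mem HV Hi); assert (HVj := V_mem HV Hj).
  apply (H3 a); auto; [apply (V_opl HVi) | apply (V_opr HVi) | apply (V_opr HVj)].
- intros [H1 [HV [H2 H3]]]; split; auto; split; auto; split; auto.
  intros a _ i _ j _; apply H3.
Qed.

Lemma P_V p : p ∈ P -> V p.
Proof. apply (V_mem V_Add). Qed.

Lemma P_box p : p ∈ P -> p ⊆ cond_box w1.
Proof. intros H; apply AddE in H; tauto. Qed.

Lemma cond_sub p q :
  p ⊆ cond_box w1 ->
  (forall a n i, a ∈ w1 -> opair (opair a n) i ∈ p -> opair (opair a n) i ∈ q) -> p ⊆ q.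
Proof.
intros Hp H z Hz; pose proof (Hp z Hz) as Hb; apply boxE in Hb as [a [n [i [Ha [_ [_ Hzt]]]]]].
rewrite Hzt in *; auto.
Qed.

Lemma P_empty : empty ∈ P.
Proof.
apply AddE; split; [intros z Hz; destruct (not_mem_empty Hz)|]; split; [vtac|split].
- apply (finite_fset (l := nil)); constructor.
- intros a i j Hi; destruct (not_mem_empty Hi).
Qed.

Lemma P_cup p q : p ∈ P -> q ∈ P ->
  (forall a n i j, opair (opair a n) i ∈ p -> opair (opair a n) j ∈ q -> i ≡ j) -> cup p q ∈ P.
Proof.
intros Hp Hq Hc; apply AddE in Hp as [H1 [H2 [H3 H4]]]; apply AddE in Hq as [H1' [H2' [H3' H4']]].
assert (Hc' : forall x i j, opair x i ∈ p -> opair x j ∈ q -> i ≡ j).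
{ intros x i j Hi Hj; pose proof (H1 _ Hi) as Hb; unfold cond_box in Hb.
  apply opair_cprod in Hb as [Hb _]; rewrite cprodE in Hb; destruct Hb as [a [n [_ [_ Hx]]]].
  rewrite Hx in Hi, Hj; apply (Hc a n); auto. }
apply AddE; split; [|split; [vtac|split; [apply finite_cup; auto|]]].
- intros z; rewrite cupE; intros [Hz|Hz]; auto.
- intros x i j; rewrite !cupE; intros [Hi|Hi] [Hj|Hj]; eauto.
  symmetry; eauto.
Qed.

Lemma P_single a n i : a ∈ w1 -> n ∈ omega -> i ∈ two ->
  upair (opair (opair a n) i) (opair (opair a n) i) ∈ P.
Proof.
intros Ha Hn Hi; set (t := opair (opair a n) i).
assert (Ht : V t).
{ unfold t; pose proof (V_mem V_w1 Ha); pose proof (V_mem V_omega Hn);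
    pose proof (V_mem V_two Hi); vtac. }
apply AddE; split; [|split; [vtac|split]].
- intros z; rewrite upairE; intros [Hz|Hz]; rewrite Hz; apply opair_box; auto.
- enough (H : upair t t ≡ fset (t :: nil)) by (rewrite H; apply finite_fset; auto).
  apply eqs_ext; intros z; rewrite upairE, fsetE, Exists_cons, Exists_nil; tauto.
- intros x j k; rewrite !upairE; unfold t; intros Hj Hk.
  assert (Hj' : opair x j ≡ opair (opair a n) i) by tauto.
  assert (Hk' : opair x k ≡ opair (opair a n) i) by tauto.
  apply opair_inj in Hj', Hk'; rewrite (proj2 Hj'), (proj2 Hk'); reflexivity.
Qed.

Lemma P_list p : p ∈ P -> exists l, Forall V l /\ p ≡ fset l.
Proof. intros H; apply AddE in H; apply finite_list; tauto. Qed.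

(** * The group of permutations of [w1] *)

Lemma SymE s : s ∈ Sym V w1 <-> V s /\ bijection s w1 w1.
Proof.
unfold Sym; rewrite sepE, powE.
- split; [tauto|]; intros [H1 H2]; split; auto; apply H2.
- intros y y' Hy _; rewrite Hy; auto.
Qed.

Lemma V_Sym : V (Sym V w1).
Proof.
pose proof V_w1; destruct (@V_pow V _ (cprod w1 w1)) as [u [Hu H']]; [vtac|].
assert (HQ : dfn (fun e => bijection (e 0) w1 w1)) by dauto.
refine (V_eqs _ (V_sep (Q := fun s => bijection s w1 w1) HQ Hu)); apply eqs_ext; intros p.
rewrite sepE_V, H', SymE by auto; split; [tauto|].
intros [H1 H2]; split; auto; split; auto; apply H2.
Qed.

Lemma Sym_V s : s ∈ Sym V w1 -> V s.
Proof. apply (V_mem V_Sym). Qed.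

Section OnePermutation.
Variable s : ens.
Hypothesis Hs : s ∈ Sym V w1.

Lemma Sym_mem a b : opair a b ∈ s -> a ∈ w1 /\ b ∈ w1.
Proof. apply SymE in Hs as [_ [[H _] _]]; apply (function_dom H). Qed.

Lemma Sym_total a : a ∈ w1 -> exists b, opair a b ∈ s.
Proof. apply SymE in Hs as [_ [[[_ [H _]] _] _]]; apply H. Qed.

Lemma Sym_fun a b b' : opair a b ∈ s -> opair a b' ∈ s -> b ≡ b'.
Proof. apply SymE in Hs as [_ [[[_ [_ H]] _] _]]; apply H. Qed.

Lemma Sym_inj a a' b : opair a b ∈ s -> opair a' b ∈ s -> a ≡ a'.
Proof. apply SymE in Hs as [_ [[_ H] _]]; apply H. Qed.

Lemma Sym_onto b : b ∈ w1 -> exists a, opair a b ∈ s.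
Proof. apply SymE in Hs as [_ [_ H]]; apply H. Qed.

Lemma Sym_sub : s ⊆ cprod w1 w1.
Proof. apply SymE in Hs as [_ [[[H _] _] _]]; apply H. Qed.

End OnePermutation.

Lemma Sym_intro s : V s -> s ⊆ cprod w1 w1 ->
  (forall a, a ∈ w1 -> exists b, opair a b ∈ s) ->
  (forall b, b ∈ w1 -> exists a, opair a b ∈ s) ->
  (forall a b b', opair a b ∈ s -> opair a b' ∈ s -> b ≡ b') ->
  (forall a a' b, opair a b ∈ s -> opair a' b ∈ s -> a ≡ a') -> s ∈ Sym V w1.
Proof.
intros; apply SymE; split; auto; split; auto; split; auto; split; auto.
Qed.

Lemma perm_idE a b : opair a b ∈ perm_id w1 <-> a ∈ w1 /\ b ≡ a.
Proof.
unfold perm_id; rewrite sepE.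
- rewrite opair_cprod; split.
  + intros [[Ha Hb] [c Hc]]; apply opair_inj in Hc as [H1 H2]; split; auto.
    rewrite H1, H2; reflexivity.
  + intros [Ha Hb]; split; [rewrite Hb; auto | exists a; rewrite Hb; reflexivity].
- intros y y' Hy _ [c Hc]; exists c; rewrite <- Hy; exact Hc.
Qed.

Lemma perm_compE s r a c : s ∈ Sym V w1 -> r ∈ Sym V w1 ->
  (opair a c ∈ perm_comp w1 s r <-> exists b, opair a b ∈ r /\ opair b c ∈ s).
Proof.
intros Hs Hr; unfold perm_comp; rewrite sepE.
- rewrite opair_cprod; split.
  + intros [_ [a' [b [c' [H [H1 H2]]]]]]; apply opair_inj in H as [H3 H4].
    exists b; rewrite H3, H4; auto.
  + intros [b [H1 H2]]; pose proof (Sym_mem Hr H1); pose proof (Sym_mem Hs H2).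
    split; [tauto|]; exists a, b, c; split; auto; reflexivity.
- intros y y' Hy _ [a' [b [c' H]]]; exists a', b, c'; rewrite <- Hy; exact H.
Qed.

Lemma perm_invE s a b : s ∈ Sym V w1 -> (opair b a ∈ perm_inv w1 s <-> opair a b ∈ s).
Proof.
intros Hs; unfold perm_inv; rewrite sepE.
- rewrite opair_cprod; split.
  + intros [_ [a' [b' [H H1]]]]; apply opair_inj in H as [H3 H4]; rewrite H3, H4; auto.
  + intros H; pose proof (Sym_mem Hs H); split; [tauto|]; exists a, b; split; auto; reflexivity.
- intros y y' Hy _ [a' [b' H]]; exists a', b'; rewrite <- Hy; exact H.
Qed.

Lemma sep_sub x Q : sep x Q ⊆ x.
Proof. intros z [[i Hi] Hz]; exists i; exact Hz. Qed.

Lemma perm_id_Sym : perm_id w1 ∈ Sym V w1.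
Proof.
pose proof V_w1 as HW.
assert (HV : V (perm_id w1)).
{ apply (V_eqs (x := sep (cprod w1 w1) (fun t => exists a, a ∈ w1 /\ t ≡ opair a a)));
    [|apply V_sep; [dauto | vtac]].
  apply (@rel_ext w1 w1); [apply sep_sub | apply sep_sub|]; intros a b Ha Hb.
  rewrite perm_idE, sepE_V by (try vtac; dauto); rewrite opair_cprod; split.
  - intros [_ [c [Hc H]]]; apply opair_inj in H as [H1 H2]; rewrite H1, H2; split; auto; reflexivity.
  - intros [_ H]; split; auto; exists a; rewrite H; split; auto; reflexivity. }
apply Sym_intro; auto; [apply sep_sub| | | |].
- intros a Ha; exists a; apply perm_idE; split; auto; reflexivity.
- intros a Ha; exists a; apply perm_idE; split; auto; reflexivity.
- intros a b b' H H'; apply perm_idE in H, H'; rewrite (proj2 H), (proj2 H'); reflexivity.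
- intros a b b' H H'; apply perm_idE in H, H'; rewrite <- (proj2 H), <- (proj2 H'); reflexivity.
Qed.

Lemma perm_comp_Sym s r : s ∈ Sym V w1 -> r ∈ Sym V w1 -> perm_comp w1 s r ∈ Sym V w1.
Proof.
intros Hs Hr; pose proof V_w1 as HW; pose proof (Sym_V Hs) as HVs; pose proof (Sym_V Hr) as HVr.
assert (HV : V (perm_comp w1 s r)).
{ apply (V_eqs (x := sep (cprod w1 w1) (fun t => exists a, a ∈ w1 /\ exists b, b ∈ w1 /\
    exists c, c ∈ w1 /\ t ≡ opair a c /\ opair a b ∈ r /\ opair b c ∈ s)));
    [|apply V_sep; [dauto | vtac]].
  apply (@rel_ext w1 w1); [apply sep_sub | apply sep_sub|]; intros a c Ha Hc.
  rewrite perm_compE, sepE_V by (auto; try vtac; dauto); rewrite opair_cprod; split.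
  - intros [_ [a' [_ [b [_ [c' [_ [H [H1 H2]]]]]]]]]; apply opair_inj in H as [H3 H4].
    exists b; rewrite H3, H4; auto.
  - intros [b [H1 H2]]; pose proof (Sym_mem Hr H1) as [Ha' Hb']; split; auto.
    exists a; split; auto; exists b; split; auto; exists c; split; auto; split; auto; reflexivity. }
apply Sym_intro; auto; [apply sep_sub| | | |].
- intros a Ha; destruct (Sym_total Hr Ha) as [b Hb].
  destruct (Sym_total Hs (proj2 (Sym_mem Hr Hb))) as [c Hc].
  exists c; apply perm_compE; auto; exists b; auto.
- intros c Hc; destruct (Sym_onto Hs Hc) as [b Hb].
  destruct (Sym_onto Hr (proj1 (Sym_mem Hs Hb))) as [a Ha].
  exists a; apply perm_compE; auto; exists b; auto.
- intros a c c' H H'; apply perm_compE in H, H'; auto.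
  destruct H as [b [H1 H2]], H' as [b' [H1' H2']].
  rewrite (Sym_fun Hr H1 H1') in H2; apply (Sym_fun Hs H2 H2').
- intros a a' c H H'; apply perm_compE in H, H'; auto.
  destruct H as [b [H1 H2]], H' as [b' [H1' H2']].
  rewrite (Sym_inj Hs H2 H2') in H1; apply (Sym_inj Hr H1 H1').
Qed.

Lemma perm_inv_Sym s : s ∈ Sym V w1 -> perm_inv w1 s ∈ Sym V w1.
Proof.
intros Hs; pose proof V_w1 as HW; pose proof (Sym_V Hs) as HVs.
assert (HV : V (perm_inv w1 s)).
{ apply (V_eqs (x := sep (cprod w1 w1) (fun t => exists a, a ∈ w1 /\ exists b, b ∈ w1 /\
    t ≡ opair b a /\ opair a b ∈ s))); [|apply V_sep; [dauto | vtac]].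
  apply (@rel_ext w1 w1); [apply sep_sub | apply sep_sub|]; intros b a Hb Ha.
  rewrite perm_invE, sepE_V by (auto; try vtac; dauto); rewrite opair_cprod; split.
  - intros [_ [a' [_ [b' [_ [H H1]]]]]]; apply opair_inj in H as [H3 H4]; rewrite H3, H4; auto.
  - intros H; split; auto; exists a; split; auto; exists b; split; auto; split; auto; reflexivity. }
apply Sym_intro; auto; [apply sep_sub| | | |].
- intros a Ha; destruct (Sym_onto Hs Ha) as [b Hb]; exists b; apply perm_invE; auto.
- intros a Ha; destruct (Sym_total Hs Ha) as [b Hb]; exists b; apply perm_invE; auto.
- intros a c c' H H'; rewrite perm_invE in H, H' by auto; apply (Sym_inj Hs H H').
- intros a c c' H H'; rewrite perm_invE in H, H' by auto; apply (Sym_fun Hs H H').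
Qed.

Lemma Sym_eqs s r : s ∈ Sym V w1 -> r ∈ Sym V w1 ->
  (forall a b, opair a b ∈ s <-> opair a b ∈ r) -> s ≡ r.
Proof.
intros Hs Hr H; apply (@rel_ext w1 w1); try (apply Sym_sub; auto); intros; apply H.
Qed.

Definition swap (a b : ens) : ens :=
  sep (cprod w1 w1) (fun t => exists x, x ∈ w1 /\ exists y, y ∈ w1 /\ t ≡ opair x y /\
    ((x ≡ a /\ y ≡ b) \/ (x ≡ b /\ y ≡ a) \/ (~ x ≡ a /\ ~ x ≡ b /\ y ≡ x))).

Lemma swapE a b x y : V a -> V b -> opair x y ∈ swap a b <-> x ∈ w1 /\ y ∈ w1 /\
  ((x ≡ a /\ y ≡ b) \/ (x ≡ b /\ y ≡ a) \/ (~ x ≡ a /\ ~ x ≡ b /\ y ≡ x)).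
Proof.
intros Ha Hb; pose proof V_w1; unfold swap; rewrite sepE_V by (try vtac; dauto).
rewrite opair_cprod; split.
- intros [[Hx Hy] [x' [_ [y' [_ [H1 H2]]]]]]; apply opair_inj in H1 as [H3 H4].
  rewrite H3, H4 in *; auto.
- intros [Hx [Hy Hq]]; split; auto; exists x; split; auto; exists y; split; auto; split; auto.
  reflexivity.
Qed.

Lemma swap_Sym a b : a ∈ w1 -> b ∈ w1 -> swap a b ∈ Sym V w1.
Proof.
intros Ha Hb; pose proof V_w1 as HW; pose proof (V_mem HW Ha) as HVa; pose proof (V_mem HW Hb) as HVb.
assert (Hfun : forall x y y', opair x y ∈ swap a b -> opair x y' ∈ swap a b -> y ≡ y').
{ intros x y y' H H'; apply swapE in H as [_ [_ H]]; auto; apply swapE in H' as [_ [_ H']]; auto.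
  destruct H as [[H1 H2]|[[H1 H2]|[H1 [H2 H3]]]], H' as [[H1' H2']|[[H1' H2']|[H1' [H2' H3']]]];
    try tauto; rewrite ?H2, ?H2', ?H3, ?H3'; try reflexivity; rewrite <- H1, <- H1'; reflexivity. }
assert (Hsym : forall x y, opair x y ∈ swap a b -> opair y x ∈ swap a b).
{ intros x y H; apply swapE in H as [Hx [Hy H]]; auto; apply swapE; auto; split; auto; split; auto.
  destruct H as [H|[H|[H1 [H2 H3]]]]; [tauto|tauto|].
  right; right; rewrite H3; split; auto; split; auto; reflexivity. }
assert (Htot : forall x, x ∈ w1 -> exists y, opair x y ∈ swap a b).
{ intros x Hx; destruct (classic (x ≡ a)) as [H1|H1]; [|destruct (classic (x ≡ b)) as [H2|H2]].
  - exists b; apply swapE; auto; split; auto; split; auto; left; split; auto; reflexivity.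
  - exists a; apply swapE; auto; split; auto; split; auto; right; left; split; auto; reflexivity.
  - exists x; apply swapE; auto; split; auto; split; auto; right; right; split; auto; split; auto; reflexivity. }
apply Sym_intro; auto.
- unfold swap; apply V_sep; [dauto | vtac].
- apply sep_sub.
- intros y Hy; destruct (Htot y Hy) as [x Hx]; exists x; auto.
- intros x x' y H H'; apply (Hfun y); auto.
Qed.

(** * The action on conditions *)

Lemma actE s p b n i : s ∈ Sym V w1 -> p ⊆ cond_box w1 ->
  (opair (opair b n) i ∈ act s p <-> exists a, opair a b ∈ s /\ opair (opair a n) i ∈ p).
Proof.
intros Hs Hp; unfold act_cond; rewrite sepE.
- rewrite opair_box; split.
  + intros [_ [a [b' [n' [i' [H [H1 H2]]]]]]]; apply opair_inj in H as [H H3].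
    apply opair_inj in H as [H4 H5]; exists a; rewrite H3, H4, H5; auto.
  + intros [a [H1 H2]]; pose proof (Sym_mem Hs H1); pose proof (Hp _ H2) as H3.
    apply opair_box in H3; split; [tauto|]; exists a, b, n, i; split; auto; reflexivity.
- intros y y' Hy _ [a [b' [n' [i' H]]]]; exists a, b', n', i'; rewrite <- Hy; exact H.
Qed.

#[global] Instance act_proper : Proper (eqs ==> eqs ==> eqs) act.
Proof.
intros s s' Hs p p' Hp; rewrite Hp; clear p Hp; unfold act_cond.
apply eqs_ext; intros z; rewrite !sepE.
- setoid_rewrite Hs; reflexivity.
- intros y y' Hy _ [a [b' [n' [i' H]]]]; exists a, b', n', i'; rewrite <- Hy; exact H.
- intros y y' Hy _ [a [b' [n' [i' H]]]]; exists a, b', n', i'; rewrite <- Hy; exact H.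
Qed.

Lemma act_box s p : act s p ⊆ cond_box w1.
Proof. apply sep_sub. Qed.

Lemma dft_act s p : dft s -> dft p -> dft (fun e => act (s e) (p e)).
Proof.
intros Hs Hp; pose proof V_w1 as HW; pose proof V_box as HB.
set (Q := fun t s p => exists a, V a /\ exists b, b ∈ w1 /\ exists n, n ∈ omega /\
      exists i, i ∈ two /\ t ≡ opair (opair b n) i /\ opair a b ∈ s /\ opair (opair a n) i ∈ p).
assert (HQ : forall r q : ens, V r -> V q -> V (sep (cond_box w1) (fun t => Q t r q)) /\
  act r q ≡ sep (cond_box w1) (fun t => Q t r q)).
{ intros r q Hr Hq; assert (HQ : dfn (fun e => Q (e 0) r q)) by (unfold Q; dauto).
  split; [apply V_sep; auto|].
  apply eqs_ext; intros t; rewrite sepE_V by auto; unfold act_cond; rewrite sepE.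
  - unfold Q; split.
    + intros [Ht [a [b [n [i [H1 [H2 H3]]]]]]]; split; auto.
      assert (HV := V_mem Hr H2); rewrite H1 in Ht; apply opair_box in Ht as [Hb [Hn Hi]].
      exists a; split; [apply (V_opl HV)|]; exists b; split; auto; exists n; split; auto; exists i; auto.
    + intros [Ht [a [_ [b [_ [n [_ [i [_ H]]]]]]]]]; split; auto; exists a, b, n, i; exact H.
  - intros y y' Hy _ [a [b' [n' [i' H]]]]; exists a, b', n', i'; rewrite <- Hy; exact H. }
apply (dft_char (Q := fun t e => t ∈ cond_box w1 /\ Q t (s e) (p e))).
- intros e He; destruct (HQ (s e) (p e)) as [H1 H2]; try (apply dft_V; auto); rewrite H2; exact H1.
- intros e z He Hz; destruct (HQ (s e) (p e)) as [H1 H2]; try (apply dft_V; auto).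
  rewrite H2, sepE_V; [reflexivity | | auto].
  pose proof (dft_V Hs He); pose proof (dft_V Hp He); unfold Q; dauto.
- unfold Q; dauto.
Qed.

Lemma V_act s p : V s -> V p -> V (act s p).
Proof.
intros Hs Hp; apply (dft_V (t := fun _ => act s p) (e := fun _ => s)); [|intros n; auto].
apply dft_act; dauto.
Qed.

(** Finiteness is transported along a list enumerating [p]; single-valuedness of the image comes
    from injectivity of [s]. *)
Lemma act_Add s p : s ∈ Sym V w1 -> p ∈ P -> act s p ∈ P.
Proof.
intros Hs Hp; pose proof (P_box Hp) as Hb; pose proof (P_list Hp) as [l [Hl Hpl]].
pose proof Hp as Hp'; apply AddE in Hp' as [_ [HV [_ Hfun]]].
apply AddE; split; [apply act_box|]; split; [apply V_act; auto; apply Sym_V; auto|]; split.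
- destruct (@list_image V (fun t z => exists a b n i, t ≡ opair (opair a n) i /\ opair a b ∈ s /\
     z ≡ opair (opair b n) i) l) as [l' [Hl' H]].
  + intros x x' z Hx [a [b [n [i H]]]]; exists a, b, n, i; rewrite <- Hx; exact H.
  + intros x Hx; rewrite <- Hpl in Hx; assert (HVx := V_mem HV Hx).
    pose proof (Hb _ Hx) as Hbx; apply boxE in Hbx as [a [n [i [Ha [Hn [Hi Hxt]]]]]].
    destruct (Sym_total Hs Ha) as [b Hab]; pose proof (V_mem (Sym_V Hs) Hab) as HVab.
    pose proof (V_opr HVab); pose proof (V_mem V_omega Hn); pose proof (V_mem V_two Hi).
    exists (opair (opair b n) i); split; [vtac|]; intros z; split.
    * intros [a' [b' [n' [i' [H1' [H2 H3]]]]]]; rewrite Hxt in H1'.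
      apply opair_inj in H1' as [H4 H5]; apply opair_inj in H4 as [H4 H6].
      rewrite <- H4 in H2; rewrite H3, (Sym_fun Hs H2 Hab), H5, H6; reflexivity.
    * intros Hz; exists a, b, n, i; auto.
  + enough (E : act s p ≡ fset l') by (rewrite E; apply finite_fset; auto).
    apply eqs_ext; intros z; rewrite H; split.
    * intros Hz; pose proof (act_box Hz) as Hbz; apply boxE in Hbz as [b [n [i [_ [_ [_ Hzt]]]]]].
      rewrite Hzt in Hz; apply actE in Hz as [a [H1 H2]]; auto.
      exists (opair (opair a n) i); rewrite <- Hpl; split; auto; exists a, b, n, i.
      split; auto; reflexivity.
    * intros [x [Hx [a [b [n [i [H1 [H2 H3]]]]]]]]; rewrite H3; apply actE; auto; exists a; split; auto.
      rewrite <- H1, Hpl; exact Hx.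
- intros x i j Hi Hj; pose proof (act_box Hi) as Hbx; unfold cond_box in Hbx.
  apply opair_cprod in Hbx as [Hbx _]; rewrite cprodE in Hbx; destruct Hbx as [b [n [_ [_ Hx]]]].
  rewrite Hx in Hi, Hj; apply actE in Hi as [a [H1 H2]]; auto; apply actE in Hj as [a' [H1' H2']]; auto.
  rewrite <- (Sym_inj Hs H1 H1') in H2'; apply (Hfun (opair a n)); auto.
Qed.

Lemma act_mono s p q : s ∈ Sym V w1 -> p ⊆ q -> q ⊆ cond_box w1 -> act s p ⊆ act s q.
Proof.
intros Hs Hpq Hq; pose proof (sub_trans Hpq Hq) as Hp.
apply cond_sub; [apply act_box|]; intros b n i _ H; apply actE in H as [a [H1 H2]]; auto.
apply actE; auto; exists a; auto.
Qed.

Lemma act_comp s r p : s ∈ Sym V w1 -> r ∈ Sym V w1 -> p ⊆ cond_box w1 ->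
  act (perm_comp w1 s r) p ≡ act s (act r p).
Proof.
intros Hs Hr Hp; pose proof (perm_comp_Sym Hs Hr) as Hc; pose proof (@act_box r p) as Hb.
apply sub_antisym; (apply cond_sub; [apply act_box|]); intros c n i _ H;
  apply actE in H as [a [H1 H2]]; auto.
- apply perm_compE in H1 as [b [H3 H4]]; auto.
  apply actE; auto; exists b; split; auto; apply actE; auto; exists a; auto.
- apply actE in H2 as [b [H3 H4]]; auto; apply actE; auto; exists b; split; auto.
  apply perm_compE; auto; exists a; auto.
Qed.

Lemma act_id p : p ⊆ cond_box w1 -> act (perm_id w1) p ≡ p.
Proof.
intros Hp; pose proof perm_id_Sym as Hi.
apply sub_antisym; (apply cond_sub; [auto using act_box|]); intros a n i Ha H.
- apply actE in H as [b [H1 H2]]; auto; apply perm_idE in H1; rewrite (proj2 H1); auto.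
- apply actE; auto; exists a; split; auto; apply perm_idE; split; auto; reflexivity.
Qed.

Lemma act_inv s p : s ∈ Sym V w1 -> p ⊆ cond_box w1 -> act (perm_inv w1 s) (act s p) ≡ p.
Proof.
intros Hs Hp; pose proof (perm_inv_Sym Hs) as Hi; pose proof (@act_box s p) as Hb.
apply sub_antisym; (apply cond_sub; [auto using act_box|]); intros a n i Ha H.
- apply actE in H as [b [H1 H2]]; auto; rewrite perm_invE in H1 by auto.
  apply actE in H2 as [c [H3 H4]]; auto; rewrite (Sym_inj Hs H1 H3); auto.
- apply actE; auto; destruct (Sym_total Hs Ha) as [b Hab]; exists b; split; [apply perm_invE; auto|].
  apply actE; auto; exists a; auto.
Qed.

Lemma act_inv' s p : s ∈ Sym V w1 -> p ⊆ cond_box w1 -> act s (act (perm_inv w1 s) p) ≡ p.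
Proof.
intros Hs Hp; pose proof (perm_inv_Sym Hs) as Hi.
rewrite <- (act_inv Hi Hp) at 2; apply act_proper; [|reflexivity].
apply Sym_eqs; auto; [apply perm_inv_Sym; auto|]; intros a b; rewrite !perm_invE; auto; reflexivity.
Qed.

Lemma act_empty s : act s empty ≡ empty.
Proof.
apply sub_antisym; intros z Hz; [|destruct (not_mem_empty Hz)].
destruct Hz as [[i [a [b [n [j [_ [_ H]]]]]]] _]; destruct (not_mem_empty H).
Qed.

Lemma act_inj s p q : s ∈ Sym V w1 -> p ∈ P -> q ∈ P -> act s p ≡ act s q -> p ≡ q.
Proof.
intros Hs Hp Hq H; rewrite <- (act_inv Hs (P_box Hp)), H; apply act_inv; auto; apply P_box; auto.
Qed.

(** Otherwise [w1] would be covered by a countable set of [V]. This is where the uncountability of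
    [w1] enters. *)
Lemma fresh E l : V E -> countable_in V E -> Forall V l ->
  exists b, b ∈ w1 /\ ~ b ∈ E /\ ~ b ∈ fset l.
Proof.
intros HE HC Hl; apply NNPP; intros H.
destruct (ground_w1 (V := V) (w1 := w1)) as [HV [_ [Hn _]]]; apply Hn.
apply (countable_sub (y := cup E (fset l))); auto.
- intros z Hz; rewrite cupE; apply NNPP; intros H'; apply H; exists z; tauto.
- apply countable_cup; auto; [apply V_fset; auto | apply countable_fset; auto].
Qed.

End Conditions.

Ltac dhook ::=
  match goal with
  | |- dft (fun e => cprod (@?s e) (@?t e)) => apply (dft_cprod (s := s) (t := t))
  | |- dft (fun e => act_cond _ (@?s e) (@?t e)) => apply (dft_act (s := s) (p := t))
  | |- dfn (fun e => function (@?f e) (@?s e) (@?t e)) => apply (dfn_function (f := f) (x := s) (y := t))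
  | |- dfn (fun e => injection (@?f e) (@?s e) (@?t e)) => apply (dfn_injection (f := f) (x := s) (y := t))
  | |- dfn (fun e => bijection (@?f e) (@?s e) (@?t e)) => apply (dfn_bijection (f := f) (x := s) (y := t))
  | |- dfn (fun e => finite_in _ (@?t e)) => apply (dfn_finite (t := t))
  | |- dfn (fun e => countable_in _ (@?t e)) => apply (dfn_countable (t := t))
  end.

Ltac vhook ::=
  match goal with
  | |- _ empty => apply V_empty
  | |- _ omega => apply V_omega
  | |- _ (vnat _) => apply V_vnat
  | |- _ one => apply V_one
  | |- _ two => apply V_two
  | |- _ (cprod _ _) => apply V_cprod
  | |- _ (Add _ _) => apply V_Add
  | |- _ (Sym _ _) => apply V_Sym
  | |- _ (act_cond _ _ _) => apply V_act
  end.

(** * Symmetric names *)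

(** With y ∈ {y} ∈ (y,p) ∈ x, a name inside [x] lies three levels down, so the induction also
    carries the statement for elements and for elements of elements. *)
Lemma name_ind (Q : ens -> Prop) :
  (forall x, (forall y p, opair y p ∈ x -> Q y) -> Q x) -> forall x, Q x.
Proof.
intros HQ x.
enough (H : Q x /\ forall u, u ∈ x -> Q u /\ forall v, v ∈ u -> Q v) by exact (proj1 H).
induction x as [x IH] using mem_ind; split.
- apply HQ; intros y p Hp; destruct (IH _ Hp) as [_ H].
  apply (H (upair y y)); [unfold opair; rewrite upairE | rewrite upairE]; left; reflexivity.
- intros u Hu; destruct (IH u Hu) as [H1 H2]; split; auto; intros v Hv; apply H2; auto.
Qed.

Lemma checkE x z : z ∈ check x <-> exists y, y ∈ x /\ z ≡ opair (check y) empty.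
Proof.
assert (Hp : forall x y, x ≡ y -> check x ≡ check y).
{ clear x; intros x; induction x as [I f IH]; intros [J g] [H1 H2]; cbn [check]; split.
  - intros i; destruct (H1 i) as [j Hj]; exists j; rewrite (IH i _ Hj); reflexivity.
  - intros j; destruct (H2 j) as [i Hi]; exists i; rewrite (IH i _ Hi); reflexivity. }
split.
- destruct x as [I f]; intros [i Hi]; exists (f i); split; [|exact Hi].
  exact (elt_mem (x := sup f) i).
- intros [y [Hy Hz]]; destruct x as [I f]; destruct Hy as [i Hi]; exists i; cbn in *.
  rewrite Hz, (Hp _ _ Hi); reflexivity.
Qed.

#[global] Instance check_proper : Proper (eqs ==> eqs) check.
Proof.
intros x y H; apply eqs_ext; intros z; rewrite !checkE; setoid_rewrite H; reflexivity.
Qed.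

Definition diff (x y : ens) : ens := sep x (fun z => ~ z ∈ y).

Lemma diffE x y z : z ∈ diff x y <-> z ∈ x /\ ~ z ∈ y.
Proof.
unfold diff; rewrite sepE; [reflexivity|]; intros a b H _; rewrite H; auto.
Qed.

Section Names.
Context {V : ens -> Prop} {w1 : ens} {M : ground V w1}.
Notation dfn := (dfn (V := V)).
Notation dft := (dft (V := V)).
Notation P := (Add V w1).
Notation act := (act_cond w1).
Notation actn := (act_name V w1).

Lemma V_diff x y : V x -> V y -> V (diff x y).
Proof. intros; apply V_sep; [dauto | auto]. Qed.

Lemma FixE E s : s ∈ Fix_ V w1 E <-> s ∈ Sym V w1 /\ forall a, a ∈ E -> opair a a ∈ s.
Proof.
unfold Fix_; rewrite sepE; [reflexivity|].
intros y y' Hy _ H a Ha; rewrite <- Hy; auto.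
Qed.

Definition img (s B : ens) : ens := sep w1 (fun b => exists a, a ∈ B /\ opair a b ∈ s).

Lemma imgE s B b : s ∈ Sym V w1 -> (b ∈ img s B <-> exists a, a ∈ B /\ opair a b ∈ s).
Proof.
intros Hs; unfold img; rewrite sepE.
- split; [tauto|]; intros [a [Ha Hb]]; pose proof (Sym_mem Hs Hb); split; [tauto|]; exists a; auto.
- intros y y' Hy _ [a H]; exists a; rewrite <- Hy; exact H.
Qed.

Lemma img_sub s B : img s B ⊆ w1.
Proof. apply sep_sub. Qed.

Lemma dft_img s B : dft s -> dft B -> dft (fun e => img (s e) (B e)).
Proof. intros Hs HB; pose proof (V_w1 (V := V)); unfold img; dauto. Qed.

Lemma V_img s B : V s -> V B -> V (img s B).
Proof.
intros Hs HB; apply (dft_V (t := fun _ => img s B) (e := fun _ => s)); [|intros n; auto].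
apply dft_img; dauto.
Qed.

Lemma countable_img s B : s ∈ Sym V w1 -> V B -> countable_in V B -> countable_in V (img s B).
Proof.
intros Hs HB [f [Hf [[Hsub [Ht Hfun]] Hinj]]]; pose proof (Sym_V Hs) as HVs.
pose proof (V_w1 (V := V)) as HW.
set (Q := fun t => exists b, b ∈ w1 /\ exists k, k ∈ omega /\ t ≡ opair b k /\
  exists a, a ∈ B /\ opair a b ∈ s /\ opair a k ∈ f).
assert (HQ : dfn (fun e => Q (e 0))) by (unfold Q; dauto).
set (g := sep (cprod (img s B) omega) Q).
assert (Hg : forall b k, opair b k ∈ g <-> exists a, opair a b ∈ s /\ opair a k ∈ f).
{ intros b k; unfold g; pose proof (V_img HVs HB); rewrite sepE_V by (auto; vtac); unfold Q; split.
  - intros [_ [b' [_ [k' [_ [H1 [a [_ H2]]]]]]]]; apply opair_inj in H1 as [H3 H4].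
    exists a; rewrite H3, H4; auto.
  - intros [a [H1 H2]]; pose proof (Sym_mem Hs H1); pose proof (Hsub _ H2) as Hak.
    apply opair_cprod in Hak; split.
    + apply opair_cprod; split; [apply imgE; auto; exists a|]; tauto.
    + exists b; split; [tauto|]; exists k; split; [tauto|]; split; [reflexivity|]; exists a; tauto. }
exists g; split; [|split; [split; [|split]|]].
- pose proof (V_img HVs HB); apply V_sep; auto; vtac.
- apply sep_sub.
- intros b Hb; apply imgE in Hb as [a [Ha Hab]]; auto.
  destruct (Ht a Ha) as [k Hk]; exists k; apply Hg; exists a; auto.
- intros b k k' H H'; apply Hg in H as [a [H1 H2]], H' as [a' [H1' H2']].
  rewrite (Sym_inj Hs H1 H1') in H2; apply (Hfun _ _ _ H2 H2').
- intros b b' k H H'; apply Hg in H as [a [H1 H2]], H' as [a' [H1' H2']].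
  rewrite (Hinj _ _ _ H2 H2') in H1; apply (Sym_fun Hs H1 H1').
Qed.

(** Induction on the generation of the filter: intersections take the union of the supports, and
    conjugation by [s] replaces a support by its image under [s]. *)
Lemma filter_support H : symfilter V w1 H ->
  exists E, V E /\ E ⊆ w1 /\ countable_in V E /\ Fix_ V w1 E ⊆ H.
Proof.
induction 1 as [E HE Hsub HC|H K HH IH HK HHK|H K HH IH HK IH'|s H Hs HH IH].
- exists E; split; auto; split; auto; split; auto; apply sub_refl.
- destruct IH as [E [H1 [H2 [H3 H4]]]]; exists E; split; auto; split; auto; split; auto.
  exact (sub_trans H4 HHK).
- destruct IH as [E [H1 [H2 [H3 H4]]]], IH' as [E' [H1' [H2' [H3' H4']]]].
  exists (cup E E'); split; [vtac|]; split; [|split; [apply countable_cup; auto|]].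
  + intros z; rewrite cupE; intros [Hz|Hz]; auto.
  + intros s Hs; apply FixE in Hs as [Hs Hfix]; rewrite capE; split; [apply H4 | apply H4'];
      apply FixE; split; auto; intros a Ha; apply Hfix; rewrite cupE; auto.
- destruct IH as [E [H1 [H2 [H3 H4]]]].
  exists (img s E); pose proof (Sym_V Hs) as HVs.
  split; [apply V_img; auto|]; split; [apply img_sub|]; split; [apply countable_img; auto|].
  intros t Ht; apply FixE in Ht as [Ht Hfix].
  pose proof (perm_inv_Sym Hs) as Hi.
  (* As [t] fixes the image of [E] under [s], the conjugate h = s⁻¹ t s fixes [E]; so [h] lies in
     [H] and t = s h s⁻¹ in the conjugate of [H]. *)
  set (h := perm_comp w1 (perm_inv w1 s) (perm_comp w1 t s)).
  assert (Hts : perm_comp w1 t s ∈ Sym V w1) by (apply perm_comp_Sym; auto).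
  assert (Hh : h ∈ Sym V w1) by (apply perm_comp_Sym; auto).
  assert (HhE : forall a b, opair a b ∈ h <->
            exists c d, opair a c ∈ s /\ opair c d ∈ t /\ opair b d ∈ s).
  { intros a b; unfold h; rewrite perm_compE by auto; setoid_rewrite perm_compE; auto; split.
    - intros [d [[c [H5 H6]] H7]]; rewrite perm_invE in H7 by auto; exists c, d; auto.
    - intros [c [d [H5 [H6 H7]]]]; exists d; rewrite perm_invE by auto; split; auto; exists c; auto. }
  assert (HhH : h ∈ H).
  { apply H4, FixE; split; auto; intros a Ha; destruct (Sym_total Hs (H2 a Ha)) as [b Hb].
    apply HhE; exists b, b; split; auto; split; auto; apply Hfix, imgE; auto; exists a; auto. }
  destruct HhH as [i Hhi]; exists i; cbn [conj_subgroup elt].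
  assert (Hg : elt i ∈ Sym V w1) by (rewrite <- Hhi; auto).
  assert (Hgs : perm_comp w1 (elt i) (perm_inv w1 s) ∈ Sym V w1) by (apply perm_comp_Sym; auto).
  apply Sym_eqs; auto; [apply perm_comp_Sym; auto|]; intros a d.
  rewrite perm_compE by auto; setoid_rewrite perm_compE; auto; split.
  + intros Had; pose proof (Sym_mem Ht Had) as [Ha Hd].
    destruct (Sym_onto Hs Ha) as [c Hc], (Sym_onto Hs Hd) as [e He].
    exists e; split; auto; exists c; rewrite perm_invE by auto; split; auto.
    rewrite <- Hhi; apply HhE; exists a, d; auto.
  + intros [e [[c [H5 H6]] H7]]; rewrite perm_invE in H5 by auto; rewrite <- Hhi in H6.
    apply HhE in H6 as [a' [d' [H8 [H9 H10]]]].
    rewrite (Sym_fun Hs H5 H8), (Sym_fun Hs H7 H10); exact H9.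
Qed.

#[global] Instance actn_proper : Proper (eqs ==> eqs ==> eqs) actn.
Proof.
intros s s' Hs x x' Hx.
assert (H : actn s x ≡ actn s x').
{ apply name_rec_ext; auto; intros v v' Hv p p' Hp; rewrite Hv, Hp; reflexivity. }
rewrite H; clear x Hx H; induction x' as [x IH] using name_ind.
apply eqs_ext; intros z; rewrite !act_nameE; split; intros [y [p [Hp [Hyp Hz]]]];
  exists y, p; split; auto; split; auto; rewrite Hz, (IH y p Hyp), Hs; reflexivity.
Qed.

Lemma actn_comp s r x : s ∈ Sym V w1 -> r ∈ Sym V w1 ->
  actn (perm_comp w1 s r) x ≡ actn s (actn r x).
Proof.
intros Hs Hr; induction x as [x IH] using name_ind.
apply eqs_ext; intros z; rewrite !act_nameE; split.
- intros [y [p [Hp [Hyp Hz]]]]; exists (actn r y), (act r p).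
  split; [apply act_Add; auto|]; split.
  + apply act_nameE; exists y, p; split; auto; split; auto; reflexivity.
  + rewrite Hz, (IH y p Hyp), act_comp; auto; [reflexivity | apply P_box; auto].
- intros [y' [q [Hq [Hyq Hz]]]]; apply act_nameE in Hyq as [y [p [Hp [Hyp H]]]].
  apply opair_inj in H as [H1 H2]; exists y, p; split; auto; split; auto.
  rewrite Hz, H1, H2, (IH y p Hyp), act_comp; auto; [reflexivity | apply P_box; auto].
Qed.

(** [act_name] drops every element that is not a pair with a condition, so the identity acts
    trivially only on genuine names; symmetry is irrelevant for this. *)
Inductive hname (x : ens) : Prop :=
| hname_intro :
    (forall z, z ∈ x -> exists y p, z ≡ opair y p /\ p ∈ P /\ hname y) -> hname x.

Lemma actn_id x : hname x -> actn (perm_id w1) x ≡ x.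
Proof.
induction x as [x IH] using name_ind; intros [Hx].
apply eqs_ext; intros z; rewrite act_nameE; split.
- intros [y [p [Hp [Hyp Hz]]]]; rewrite Hz, act_id by (apply P_box; auto).
  rewrite (IH y p Hyp); auto.
  destruct (Hx _ Hyp) as [y' [p' [H [_ [Hy]]]]]; apply opair_inj in H as [H _].
  constructor; intros w Hw; rewrite H in Hw; auto.
- intros Hz; destruct (Hx z Hz) as [y [p [H [Hp Hy]]]]; rewrite H in Hz.
  exists y, p; split; auto; split; auto.
  rewrite H, act_id, (IH y p Hz) by (auto; apply P_box; auto); reflexivity.
Qed.

Lemma HS_hname x : HS V w1 x -> hname x.
Proof.
induction x as [x IH] using name_ind; intros [_ Hx _]; constructor; intros z Hz.
destruct (Hx z Hz) as [y [p [H [Hp Hy]]]]; exists y, p; split; auto; split; auto.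
rewrite H in Hz; apply (IH y p Hz); auto.
Qed.

Lemma StabE x s : s ∈ Stab V w1 x <-> s ∈ Sym V w1 /\ actn s x ≡ x.
Proof.
unfold Stab; rewrite sepE; [reflexivity|]; intros y y' Hy _; rewrite Hy; auto.
Qed.

Lemma perm_inv_comp s : s ∈ Sym V w1 -> perm_comp w1 (perm_inv w1 s) s ≡ perm_id w1.
Proof.
intros Hs; pose proof (perm_inv_Sym Hs) as Hi.
apply Sym_eqs; [apply perm_comp_Sym; auto | apply perm_id_Sym|]; intros a b.
rewrite perm_compE, perm_idE by auto; split.
- intros [c [H1 H2]]; rewrite perm_invE in H2 by auto; split; [apply (Sym_mem Hs H1)|].
  apply (Sym_inj Hs H2 H1).
- intros [Ha Hb]; destruct (Sym_total Hs Ha) as [c Hc]; exists c; split; auto.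
  rewrite perm_invE, Hb by auto; exact Hc.
Qed.

Lemma subgroup_Stab x : hname x -> V (Stab V w1 x) -> subgroup V w1 (Stab V w1 x).
Proof.
intros Hx HV; split; auto; split; [apply sep_sub|]; split; [|split].
- apply StabE; split; [apply perm_id_Sym | apply actn_id; auto].
- intros s r Hs Hr; apply StabE in Hs as [Hs Hsx]; apply StabE in Hr as [Hr Hrx].
  apply StabE; split; [apply perm_comp_Sym; auto|].
  rewrite actn_comp, Hrx by auto; exact Hsx.
- intros s Hs; apply StabE in Hs as [Hs Hsx]; pose proof (perm_inv_Sym Hs) as Hi.
  apply StabE; split; auto.
  rewrite <- Hsx at 1; rewrite <- actn_comp, perm_inv_comp by auto; apply actn_id; auto.
Qed.

(** [symfilter_up] asks for a subgroup that is an element of [V]. For a stabilizer this has to be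
    established, hence the hypothesis on [Stab V w1 x]. *)
Lemma HS_mk x E :
  V x -> (forall z, z ∈ x -> exists y p, z ≡ opair y p /\ p ∈ P /\ HS V w1 y) ->
  V (Stab V w1 x) -> V E -> E ⊆ w1 -> countable_in V E ->
  (forall s, s ∈ Sym V w1 -> (forall a, a ∈ E -> opair a a ∈ s) -> actn s x ≡ x) ->
  HS V w1 x.
Proof.
intros Hx Hel HSt HE HEw HC Hfix; constructor; auto.
apply (symfilter_up (H := Fix_ V w1 E)); [constructor; auto| |].
- apply subgroup_Stab; auto; constructor; intros z Hz.
  destruct (Hel z Hz) as [y [p [H1 [H2 H3]]]]; exists y, p; auto using HS_hname.
- intros s Hs; apply FixE in Hs as [Hs Hsf]; apply StabE; split; auto.
Qed.

Lemma actn_check s x : actn s (check x) ≡ check x.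
Proof.
induction x as [x IH] using mem_ind; apply eqs_ext; intros z; rewrite act_nameE, checkE; split.
- intros [y [p [Hp [Hyp Hz]]]]; apply checkE in Hyp as [x' [Hx' H]]; apply opair_inj in H as [H1 H2].
  exists x'; split; auto; rewrite Hz, H1, H2, IH, act_empty by auto; reflexivity.
- intros [y [Hy Hz]]; exists (check y), empty; split; [apply P_empty|]; split.
  + apply checkE; exists y; split; auto; reflexivity.
  + rewrite Hz, IH, act_empty by auto; reflexivity.
Qed.

(** On numerals, [check] obeys check(n+1) = check(n) ∪ {(check(n), ∅)}, so recursion on [omega] puts
    its restriction to [omega] into [V]. *)
Lemma check_graph :
  exists K, V K /\ forall x z, opair x z ∈ K <-> exists n, x ≡ vnat n /\ z ≡ check (vnat n).
Proof.
set (F := fun x => cup x (upair (opair x empty) (opair x empty))).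
exists (sup (fun n => opair (vnat n) (Nat.iter n F empty))).
split; [apply V_nat_rec; [unfold F; dauto | vtac]|].
assert (HF : forall x z, z ∈ F x <-> z ∈ x \/ z ≡ opair x empty)
  by (intros x z; unfold F; rewrite cupE, upairE; tauto).
assert (H : forall n, Nat.iter n F empty ≡ check (vnat n)).
{ induction n as [|n IH].
  - apply eqs_ext; intros z; split; intros Hz; [destruct (not_mem_empty Hz)|].
    apply checkE in Hz as [y [Hy _]]; destruct (not_mem_empty Hy).
  - change (Nat.iter (S n) F empty) with (F (Nat.iter n F empty)); apply eqs_ext; intros z.
    rewrite HF, checkE; cbn [vnat]; setoid_rewrite succE; rewrite IH, checkE; split.
    + intros [[y [Hy Hz]]|Hz]; [exists y; auto|exists (vnat n); split; [right; reflexivity | auto]].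
    + intros [y [[Hy|Hy] Hz]]; [left; exists y; auto | right].
      rewrite Hz, Hy; reflexivity. }
intros x k; split.
- intros [n Hn]; cbn [elt] in Hn; apply opair_inj in Hn; rewrite H in Hn; exists n; exact Hn.
- intros [n Hn]; exists n; cbn [elt]; rewrite H, (proj1 Hn), (proj2 Hn); reflexivity.
Qed.

Lemma V_check n : V (check (vnat n)).
Proof.
destruct check_graph as [K [HK HE]]; apply (V_opr (x := vnat n)), (V_mem HK).
apply HE; exists n; split; reflexivity.
Qed.

(** * Names for the Cohen reals and for sets of them *)

Notation cn := (c_name V w1).

Lemma cnE a z : z ∈ cn a <-> exists n p, p ∈ P /\
  opair (opair a (vnat n)) one ∈ p /\ z ≡ opair (check (vnat n)) p.
Proof.
split.
- intros [[[n i] Hi] Hz]; exists n, (elt i); split; [apply elt_mem|]; split; [exact Hi | exact Hz].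
- intros [n [p [[i Hp] [Hn Hz]]]]; rewrite Hp in Hn.
  exists (exist (fun np : idx omega * idx P => opair (opair a (elt (fst np))) one ∈ elt (snd np)) (n, i) Hn).
  cbn; rewrite Hz, Hp; reflexivity.
Qed.

#[global] Instance cn_proper : Proper (eqs ==> eqs) cn.
Proof.
intros a b H; apply eqs_ext; intros z; rewrite !cnE; setoid_rewrite H; reflexivity.
Qed.

Lemma dft_cn t : dft t -> dft (fun e => cn (t e)).
Proof.
intros Ht; destruct check_graph as [K [HK HE]].
set (Q := fun z a => exists n, n ∈ omega /\ exists p, p ∈ P /\ opair (opair a n) one ∈ p /\
  exists c, V c /\ opair n c ∈ K /\ z ≡ opair c p).
assert (HQ : dfn (fun e => Q (e 0) (t (fun n => e (S n))))) by (unfold Q; dauto).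
assert (HcnQ : forall a z, z ∈ cn a <-> Q z a).
{ intros a z; rewrite cnE; unfold Q; split.
  - intros [n [p [Hp [H1 H2]]]]; exists (vnat n); split; [apply vnat_omega|]; exists p; split; auto.
    split; auto; exists (check (vnat n)); split; [apply V_check|]; split; auto.
    apply HE; exists n; split; reflexivity.
  - intros [x [_ [p [Hp [H1 [c [_ [H2 H3]]]]]]]]; apply HE in H2 as [n [H4 H5]].
    exists n, p; split; auto; rewrite <- H4; split; auto; rewrite H3, H5, <- H4; reflexivity. }
apply (dft_char (Q := fun z e => Q z (t e))); auto.
intros e He.
(* A bound for separation: (n,c) ∈ K gives {n,c} ∈ ⋃K and c ∈ ⋃⋃K. *)
apply (V_eqs (x := sep (cprod (bigU (bigU K)) P) (fun z => Q z (t e)))).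
- apply eqs_ext; intros z; rewrite HcnQ, sepE.
  + split; [tauto|]; intros H; split; auto; destruct H as [n [_ [p [Hp [_ [c [_ [H1 H2]]]]]]]].
    rewrite H2; apply opair_cprod; split; auto; apply bigUE; exists (upair n c); split.
    * apply bigUE; exists (opair n c); split; auto; unfold opair; rewrite upairE; right; reflexivity.
    * rewrite upairE; right; reflexivity.
  + intros y y' Hy _; unfold Q; setoid_rewrite Hy; auto.
- pose proof (dft_V Ht He); apply V_sep; [unfold Q; dauto | vtac].
Qed.

Lemma V_cn a : V a -> V (cn a).
Proof.
intros Ha; apply (dft_V (t := fun _ => cn a) (e := fun _ => a)); [|intros n; auto].
apply dft_cn; dauto.
Qed.

Lemma actn_cn s a b : s ∈ Sym V w1 -> opair a b ∈ s -> actn s (cn a) ≡ cn b.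
Proof.
intros Hs Hab; pose proof (Sym_mem Hs Hab) as [Ha Hb].
apply eqs_ext; intros z; rewrite act_nameE, cnE; split.
- intros [y [p [Hp [Hyp Hz]]]]; apply cnE in Hyp as [n [p' [Hp' [Hn H]]]].
  apply opair_inj in H as [H1 H2]; rewrite <- H2 in Hn.
  exists n, (act s p); split; [apply act_Add; auto|]; split.
  + apply actE; auto; [apply P_box; auto | exists a; auto].
  + rewrite Hz, H1, actn_check; reflexivity.
- intros [n [q [Hq [Hn Hz]]]]; pose proof (perm_inv_Sym Hs) as Hi; pose proof (P_box Hq) as Hqb.
  exists (check (vnat n)), (act (perm_inv w1 s) q); split; [apply act_Add; auto|]; split.
  + apply cnE; exists n, (act (perm_inv w1 s) q); split; [apply act_Add; auto|].
    split; [|reflexivity]; apply actE; auto; exists b; split; auto; apply perm_invE; auto.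
  + rewrite Hz, actn_check, act_inv' by auto; reflexivity.
Qed.

(** The recursion behind [act_name] has no definability lemma; instead each stabilizer in use is
    described by an explicit definable condition on the permutation. *)
Lemma V_Stab x (Q : ens -> Prop) : dfn (fun e => Q (e 0)) ->
  (forall s, s ∈ Sym V w1 -> (actn s x ≡ x <-> Q s)) -> V (Stab V w1 x).
Proof.
intros HQ H; pose proof V_Sym as HS; apply (V_eqs (x := sep (Sym V w1) Q)); [|apply V_sep; auto].
apply eqs_ext; intros s; rewrite sepE_V, StabE by auto; specialize (H s); tauto.
Qed.

Lemma HS_check n : HS V w1 (check (vnat n)).
Proof.
assert (HSt : forall x, V (Stab V w1 (check x))).
{ intros x; apply (V_Stab (Q := fun s => s ≡ s)); [dauto|].
  intros s _; split; [reflexivity|]; intros _; apply actn_check. }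
induction n as [n IH] using (well_founded_induction Nat.lt_wf_0).
apply (@HS_mk _ empty); auto; [apply V_check | | vtac | | apply countable_empty |].
- intros z Hz; apply checkE in Hz as [y [Hy Hz]]; apply memvnat in Hy as [m [Hm Hy]].
  rewrite Hy in Hz; exists (check (vnat m)), empty; split; auto; split; [apply P_empty | auto].
- intros z Hz; destruct (not_mem_empty Hz).
- intros s _ _; apply actn_check.
Qed.

Lemma HS_cn a : a ∈ w1 -> HS V w1 (cn a).
Proof.
intros Ha; pose proof (V_w1 (V := V)) as HW; pose proof (V_mem HW Ha) as HVa.
apply (@HS_mk _ (upair a a)); [apply V_cn; auto | | | vtac | | apply countable_singleton; auto |].
- intros z Hz; apply cnE in Hz as [n [p [Hp [_ Hz]]]]; exists (check (vnat n)), p.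
  split; auto; split; auto; apply HS_check.
(* The name [cn a] is moved to [cn b] with b = s(a). Stating [cn b ≡ cn a] instead of [b ≡ a] avoids
   proving that [cn] is injective. *)
- apply (V_Stab (Q := fun s => exists b, b ∈ w1 /\ opair a b ∈ s /\ cn b ≡ cn a)).
  + dauto; apply dft_cn; dauto.
  + intros s Hs; split.
    * intros H; destruct (Sym_total Hs Ha) as [b Hb]; exists b; split; [apply (Sym_mem Hs Hb)|].
      split; auto; rewrite <- (actn_cn Hs Hb); exact H.
    * intros [b [_ [Hb H]]]; rewrite (actn_cn Hs Hb); exact H.
- intros z; rewrite upairE; intros [H|H]; rewrite H; auto.
- intros s Hs Hfix; apply actn_cn; auto; apply Hfix; rewrite upairE; left; reflexivity.
Qed.

(** [An w1] is [A_name V w1] up to unfolding. General [B] is wanted because both refutations look at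
    the Cohen reals outside a support. *)
Definition An (B : ens) : ens := rep B (fun a => opair (cn a) empty).

Lemma AnE B z : z ∈ An B <-> exists a, a ∈ B /\ z ≡ opair (cn a) empty.
Proof. apply repE; intros a b H _; rewrite H; reflexivity. Qed.

#[global] Instance An_proper : Proper (eqs ==> eqs) An.
Proof.
intros a b H; apply eqs_ext; intros z; rewrite !AnE; setoid_rewrite H; reflexivity.
Qed.

Lemma dft_An t : dft t -> dft (fun e => An (t e)).
Proof. intros Ht; unfold An; dauto; apply dft_cn; dauto. Qed.

Lemma V_An B : V B -> V (An B).
Proof.
intros Ha; apply (dft_V (t := fun _ => An B) (e := fun _ => B)); [|intros n; auto].
apply dft_An; dauto.
Qed.

Lemma actn_An s B : s ∈ Sym V w1 -> B ⊆ w1 -> actn s (An B) ≡ An (img s B).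
Proof.
intros Hs HB; apply eqs_ext; intros z; rewrite act_nameE, AnE; split.
- intros [y [p [Hp [Hyp Hz]]]]; apply AnE in Hyp as [a [Ha H]]; apply opair_inj in H as [H1 H2].
  destruct (Sym_total Hs (HB a Ha)) as [b Hb]; exists b; split; [apply imgE; auto; exists a; auto|].
  rewrite Hz, H1, H2, act_empty, (actn_cn Hs Hb); reflexivity.
- intros [b [Hb Hz]]; apply imgE in Hb as [a [Ha Hab]]; auto.
  exists (cn a), empty; split; [apply P_empty|]; split.
  + apply AnE; exists a; split; auto; reflexivity.
  + rewrite Hz, act_empty, (actn_cn Hs Hab); reflexivity.
Qed.

(** A point outside [B] is fixed, so by injectivity it is not the image of a point of [B], and as
    [s] is single-valued no point outside [B] is sent into [B]. *)
Lemma img_fix s B : s ∈ Sym V w1 -> B ⊆ w1 ->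
  (forall a, a ∈ diff w1 B -> opair a a ∈ s) -> img s B ≡ B.
Proof.
intros Hs HB Hfix; apply eqs_ext; intros b; rewrite imgE by auto; split.
- intros [a [Ha Hab]]; apply NNPP; intros Hb; pose proof (Sym_mem Hs Hab) as [_ Hbw].
  assert (Hbb : opair b b ∈ s) by (apply Hfix, diffE; auto).
  apply Hb; rewrite <- (Sym_inj Hs Hab Hbb); auto.
- intros Hb; destruct (Sym_onto Hs (HB b Hb)) as [a Hab]; exists a; split; auto.
  apply NNPP; intros Ha; pose proof (Sym_mem Hs Hab) as [Haw _].
  assert (Haa : opair a a ∈ s) by (apply Hfix, diffE; auto).
  apply Ha; rewrite <- (Sym_fun Hs Hab Haa); auto.
Qed.

(** The complement of [B] is a support: a permutation fixing it pointwise merely permutes the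
    entries of [An B]. *)
Lemma HS_An B : V B -> B ⊆ w1 -> countable_in V (diff w1 B) -> HS V w1 (An B).
Proof.
intros HB HBw HC; pose proof (V_w1 (V := V)) as HW.
apply (@HS_mk _ (diff w1 B)); [apply V_An; auto | | | apply V_diff; auto | apply sep_sub | auto |].
- intros z Hz; apply AnE in Hz as [a [Ha Hz]]; exists (cn a), empty.
  split; auto; split; [apply P_empty | apply HS_cn; auto].
- apply (V_Stab (Q := fun s => An (img s B) ≡ An B)).
  + apply dfn_eq; [apply dft_An, dft_img | apply dft_cst, V_An; auto]; dauto.
  + intros s Hs; rewrite actn_An by auto; reflexivity.
- intros s Hs Hfix; rewrite actn_An, img_fix by auto; reflexivity.
Qed.

Definition cocountable (B : ens) : Prop := V B /\ B ⊆ w1 /\ countable_in V (diff w1 B).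

Lemma cocountable_img s B : s ∈ Sym V w1 -> cocountable B -> cocountable (img s B).
Proof.
intros Hs [HB [HBw HC]]; pose proof (V_w1 (V := V)) as HW; pose proof (Sym_V Hs).
split; [apply V_img; auto|]; split; [apply img_sub|].
enough (H' : diff w1 (img s B) ≡ img s (diff w1 B))
  by (rewrite H'; apply countable_img; auto; apply V_diff; auto).
apply eqs_ext; intros b; rewrite diffE, !imgE by auto; split.
- intros [Hb Hn]; destruct (Sym_onto Hs Hb) as [a Ha]; exists a; split; auto.
  apply diffE; split; [apply (Sym_mem Hs Ha)|]; intros Hm; apply Hn; exists a; auto.
- intros [a [Ha Hab]]; apply diffE in Ha as [Ha Hn]; split; [apply (Sym_mem Hs Hab)|].
  intros [a' [Ha' Hab']]; apply Hn; rewrite (Sym_inj Hs Hab Hab'); auto.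
Qed.

Lemma cocountable_set : exists C, V C /\ forall B, B ∈ C <-> cocountable B.
Proof.
pose proof (V_w1 (V := V)) as HW; destruct (V_pow HW) as [u [Hu H]].
assert (HQ : dfn (fun e => countable_in V (diff w1 (e 0)))) by (unfold diff; dauto).
exists (sep u (fun B => countable_in V (diff w1 B))); split; [apply V_sep; auto|].
intros B; rewrite sepE_V, H by auto; unfold cocountable; tauto.
Qed.

(** All cocountable [B] are taken at once. Every permutation permutes them, so the empty set
    supports the family; and the complement of any support of a choice function occurs among
    them. *)
Lemma family_name : exists X, HS V w1 X /\
  forall z, z ∈ X <-> exists B, cocountable B /\ z ≡ opair (An B) empty.
Proof.
destruct cocountable_set as [C [HC HCE]].
set (X := rep C (fun B => opair (An B) empty)).
assert (HXE : forall z, z ∈ X <-> exists B, cocountable B /\ z ≡ opair (An B) empty).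
{ intros z; unfold X; rewrite repE; [setoid_rewrite HCE; reflexivity|].
  intros y y' Hy _; rewrite Hy; reflexivity. }
assert (Hact : forall s, s ∈ Sym V w1 -> actn s X ≡ X).
{ intros s Hs; apply eqs_ext; intros z; rewrite act_nameE, HXE; split.
  - intros [y [p [Hp [Hyp Hz]]]]; apply HXE in Hyp as [B [HB H]]; apply opair_inj in H as [H1 H2].
    exists (img s B); split; [apply cocountable_img; auto|].
    rewrite Hz, H1, H2, act_empty, actn_An by (auto; apply HB); reflexivity.
  - intros [B [HB Hz]]; pose proof (perm_inv_Sym Hs) as Hi.
    pose proof (cocountable_img Hi HB) as HB'.
    exists (An (img (perm_inv w1 s) B)), empty; split; [apply P_empty|]; split.
    + apply HXE; exists (img (perm_inv w1 s) B); split; auto; reflexivity.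
    + rewrite Hz, act_empty, actn_An by (auto; apply HB').
      enough (E : img s (img (perm_inv w1 s) B) ≡ B) by (rewrite E; reflexivity).
      apply eqs_ext; intros b; rewrite imgE by auto; setoid_rewrite imgE; auto; split.
      * intros [a [[b' [Hb' H1]] H2]]; rewrite perm_invE in H1 by auto.
        rewrite (Sym_fun Hs H2 H1); auto.
      * intros Hb; destruct (Sym_onto Hs (proj1 (proj2 HB) b Hb)) as [a Ha].
        exists a; split; auto; exists b; split; auto; apply perm_invE; auto. }
exists X; split; auto.
apply (@HS_mk _ empty); [ | | | vtac | | apply countable_empty | auto].
- apply V_rep; [apply dft_opair; [apply dft_An; dauto | dauto] | auto].
- intros z Hz; apply HXE in Hz as [B [HB Hz]]; exists (An B), empty; split; auto.
  split; [apply P_empty | apply HS_An; apply HB].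
- apply (V_Stab (Q := fun s => s ≡ s)); [dauto|]; intros s Hs; split; [reflexivity | auto].
- intros z Hz; destruct (not_mem_empty Hz).
Qed.

End Names.

(** * Generic filters and forcing of atomic formulas *)

#[global] Instance val_proper : Proper (eqs ==> eqs ==> eqs) val.
Proof.
intros G G' HG x x' Hx.
assert (H : val G x ≡ val G x') by (apply name_rec_ext; auto; intros v v' Hv p p' Hp; exact Hv).
rewrite H; clear x Hx H; induction x' as [x IH] using name_ind.
apply eqs_ext; intros z; rewrite !valE; split; intros [y [p [Hp [Hyp Hz]]]];
  exists y, p; pose proof (IH y p Hyp) as E.
- split; [rewrite <- HG; exact Hp | split; [exact Hyp | rewrite <- E; exact Hz]].
- split; [rewrite HG; exact Hp | split; [exact Hyp | rewrite E; exact Hz]].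
Qed.

Section Generic.
Context {V : ens -> Prop} {w1 : ens} {M : ground V w1}.
Notation dfn := (dfn (V := V)).
Notation dft := (dft (V := V)).
Notation P := (Add V w1).
Notation act := (act_cond w1).
Notation actn := (act_name V w1).
Notation cn := (c_name V w1).
Notation An := (An (V := V) (w1 := w1)).
Notation swap := (swap (w1 := w1)).

(** Density below [p0] becomes density by adding the conditions incompatible with [p0]; a directed
    filter containing [p0] contains none of these. *)
Lemma generic_below H (D : ens -> Prop) p0 : generic V w1 H ->
  dfn (fun e => D (e 0)) -> p0 ∈ H ->
  (forall p, p ∈ P -> p0 ⊆ p -> exists q, q ∈ P /\ p ⊆ q /\ D q) ->
  exists q, q ∈ H /\ D q.
Proof.
intros [HP [_ [_ [Hdir Hden]]]] HD Hp0 Hdense.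
pose proof (V_Add (V := V) (w1 := w1)) as HV; pose proof (P_V (HP _ Hp0)) as HVp.
set (Q := fun q => D q \/ ~ exists r, r ∈ P /\ p0 ⊆ r /\ q ⊆ r).
assert (HQ : dfn (fun e => Q (e 0))) by (unfold Q; dauto).
destruct (Hden (sep P Q)) as [q [Hq HqH]].
- apply V_sep; auto.
- apply sep_sub.
- intros p Hp; destruct (classic (exists r, r ∈ P /\ p0 ⊆ r /\ p ⊆ r)) as [[r [Hr [H1 H2]]]|Hn].
  + destruct (Hdense r Hr H1) as [q [Hq [Hrq HDq]]]; exists q; split; [|exact (sub_trans H2 Hrq)].
    rewrite sepE_V by auto; split; auto; left; auto.
  + exists p; split; [rewrite sepE_V by auto; split; auto; right; auto | apply sub_refl].
- rewrite sepE_V in Hq by auto; destruct Hq as [_ [Hq|Hq]]; [exists q; auto|].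
  destruct (Hdir p0 q Hp0 HqH) as [r [Hr [H1 H2]]]; destruct Hq; exists r; auto.
Qed.

Lemma generic_P H p : generic V w1 H -> p ∈ H -> p ∈ P.
Proof. intros HG; apply HG. Qed.

Lemma generic_empty H : generic V w1 H -> empty ∈ H.
Proof. intros HG; apply HG. Qed.

Lemma generic_up H p q : generic V w1 H -> p ∈ H -> q ∈ P -> q ⊆ p -> q ∈ H.
Proof. intros HG; apply HG. Qed.

Lemma generic_dir H p q : generic V w1 H -> p ∈ H -> q ∈ H -> exists r, r ∈ H /\ p ⊆ r /\ q ⊆ r.
Proof. intros HG; apply HG. Qed.

Lemma rep_actE s H z : z ∈ rep H (act s) <-> exists p, p ∈ H /\ z ≡ act s p.
Proof. apply repE; intros y y' Hy _; rewrite Hy; reflexivity. Qed.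

Lemma generic_act s H : s ∈ Sym V w1 -> generic V w1 H -> generic V w1 (rep H (act s)).
Proof.
intros Hs HG; pose proof (perm_inv_Sym Hs) as Hi; pose proof (Sym_V Hs) as HVs.
assert (Hb : forall p, p ∈ H -> p ⊆ cond_box w1) by (intros p Hp; apply P_box, (generic_P HG Hp)).
repeat split.
- intros z Hz; apply rep_actE in Hz as [p [Hp Hz]]; rewrite Hz; apply act_Add; auto.
  apply (generic_P HG Hp).
- apply rep_actE; exists empty; split; [apply (generic_empty HG)|]; rewrite act_empty; reflexivity.
- intros p q Hp Hq Hqp; apply rep_actE in Hp as [p0 [Hp0 Hp]]; rewrite Hp in Hqp.
  apply rep_actE; exists (act (perm_inv w1 s) q); split.
  + apply (generic_up HG Hp0); [apply act_Add; auto|].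
    rewrite <- (act_inv Hs (Hb _ Hp0)); apply act_mono; auto; apply act_box.
  + rewrite act_inv'; auto; [reflexivity | apply P_box; auto].
- intros p q Hp Hq; apply rep_actE in Hp as [p0 [Hp0 Hp]], Hq as [q0 [Hq0 Hq]].
  destruct (generic_dir HG Hp0 Hq0) as [r [Hr [H1 H2]]]; exists (act s r).
  split; [apply rep_actE; exists r; split; auto; reflexivity|].
  rewrite Hp, Hq; split; apply act_mono; auto.
- intros D HD HDP Hdense.
  (* The dense set is pulled back along [s]; the pullback is definable over [V] because [s] belongs
     to [V]. *)
  destruct (@generic_below H (fun p => act s p ∈ D) empty HG) as [q [Hq HqD]].
  + dauto.
  + apply (generic_empty HG).
  + intros p Hp _; destruct (Hdense (act s p) (act_Add Hs Hp)) as [q [Hq Hpq]].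
    pose proof (HDP _ Hq) as HqP; exists (act (perm_inv w1 s) q).
    split; [apply act_Add; auto|]; split.
    * rewrite <- (act_inv Hs (P_box Hp)); apply act_mono; auto; apply P_box; auto.
    * rewrite act_inv'; auto; apply P_box; auto.
  + exists (act s q); split; auto; apply rep_actE; exists q; split; auto; reflexivity.
Qed.

(** Moving both filter and name changes nothing: by injectivity of the action, for a condition [p]
    the image of [p] is in the moved filter exactly when [p] is in [H]. *)
Lemma val_act s H x : s ∈ Sym V w1 -> H ⊆ P -> val (rep H (act s)) (actn s x) ≡ val H x.
Proof.
intros Hs HP; induction x as [x IH] using name_ind; apply eqs_ext; intros z; rewrite !valE; split.
- intros [y' [q [Hq [Hyq Hz]]]]; apply act_nameE in Hyq as [y [p [Hp [Hyp H']]]].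
  apply opair_inj in H' as [H1 H2]; exists y, p; split; [|split; auto].
  + apply rep_actE in Hq as [p0 [Hp0 Hq]]; rewrite Hq in H2.
    rewrite <- (act_inj Hs (HP _ Hp0) Hp H2); exact Hp0.
  + rewrite Hz, H1; apply (IH y p Hyp).
- intros [y [p [Hp [Hyp Hz]]]]; exists (actn s y), (act s p); split; [|split].
  + apply rep_actE; exists p; split; auto; reflexivity.
  + apply act_nameE; exists y, p; split; [apply HP; auto|]; split; auto; reflexivity.
  + rewrite Hz; symmetry; apply (IH y p Hyp).
Qed.

(** One inclusion of forced equality: whatever (x',q) puts into [x] is, densely below [p] and [q],
    matched by a member of [y]. Leaving [R] open lets the same clause serve for forced equality
    itself and for a set of triples witnessing it. *)
Definition half (R : ens -> ens -> ens -> Prop) (x y p : ens) : Prop :=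
  forall x', V x' -> forall q, q ∈ P -> opair x' q ∈ x ->
  forall r, r ∈ P -> p ⊆ r -> q ⊆ r ->
  exists r', r' ∈ P /\ r ⊆ r' /\ exists y', V y' /\ exists q', q' ∈ P /\
    opair y' q' ∈ y /\ q' ⊆ r' /\ R x' y' r'.

Definition halves (R : ens -> ens -> ens -> Prop) (x y p : ens) : Prop :=
  half R x y p /\ half (fun a b => R b a) y x p.

Definition tri (x y p : ens) : ens := opair (opair x y) p.

(* As names are well-founded, [p] forces [x = y] as soon as a set of triples
   containing [(x, y, p)] is closed under the defining clauses of forced
   equality.  This existential form is first-order over [V] without any
   recursion. *)
Definition forces_eq (x y p : ens) : Prop :=
  p ∈ P /\ exists S, V S /\ tri x y p ∈ S /\
  forall x, V x -> forall y, V y -> forall p, p ∈ P -> tri x y p ∈ S ->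
    halves (fun a b c => tri a b c ∈ S) x y p.

Lemma half_impl (R R' : ens -> ens -> ens -> Prop) x y p :
  (forall a b c, c ∈ P -> R a b c -> R' a b c) -> half R x y p -> half R' x y p.
Proof.
intros HR H x' Hx' q Hq Hxq r Hr Hpr Hqr.
destruct (H x' Hx' q Hq Hxq r Hr Hpr Hqr) as [r' [H1 [H2 [y' [H3 [q' [H4 [H5 [H6 H7]]]]]]]]].
exists r'; split; auto; split; auto; exists y'; split; auto; exists q'; auto.
Qed.

Lemma half_mono R x y p q : p ⊆ q -> half R x y p -> half R x y q.
Proof.
intros Hpq H x' Hx' q' Hq' Hxq r Hr Hqr; apply H; auto; exact (sub_trans Hpq Hqr).
Qed.

Lemma dfn_forces_eq x y p : dft x -> dft y -> dft p ->
  dfn (fun e => forces_eq (x e) (y e) (p e)).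
Proof.
intros Hx Hy Hp; unfold forces_eq, halves, half, tri; cbv beta; dauto.
Qed.

Lemma forces_eq_V x y p : forces_eq x y p -> V x /\ V y.
Proof.
intros [_ [S [HS [Hm _]]]]; pose proof (V_opl (V_mem HS Hm)) as H.
split; [apply (V_opl H) | apply (V_opr H)].
Qed.

Lemma forces_eq_unfold x y p : forces_eq x y p -> halves forces_eq x y p.
Proof.
intros H; pose proof (forces_eq_V H) as [Hx Hy]; destruct H as [Hp [S [HS [Hm Hbis]]]].
destruct (Hbis x Hx y Hy p Hp Hm) as [H1 H2].
split; [revert H1 | revert H2]; apply half_impl; intros a b c Hc Habc;
  (split; [exact Hc|]); exists S; auto.
Qed.

(** The matched pairs of members come with different witnessing sets. Instead of choosing among
    these, one takes all forced triples over a transitive set [T] containing [x] and [y], together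
    with the new triple; separation applies since [forces_eq] is definable. *)
Lemma forces_eq_fold x y p : V x -> V y -> p ∈ P -> halves forces_eq x y p -> forces_eq x y p.
Proof.
intros Hx Hy Hp [H1 H2]; pose proof (P_V Hp) as HVp; pose proof (V_Add (V := V) (w1 := w1)) as HVP.
destruct (@V_transitive_superset V _ (upair x y)) as [T [HT [HxyT Htr]]]; [vtac|].
assert (HxT : x ∈ T) by (apply (Htr _ HxyT); rewrite upairE; left; reflexivity).
assert (HyT : y ∈ T) by (apply (Htr _ HxyT); rewrite upairE; right; reflexivity).
assert (HTn : forall u, u ∈ T -> forall v q, opair v q ∈ u -> v ∈ T).
{ intros u Hu v q Hv; apply (Htr u Hu) in Hv; apply (Htr (upair v v)).
  - apply (Htr _ Hv); unfold opair; rewrite upairE; left; reflexivity.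
  - rewrite upairE; left; reflexivity. }
set (Q := fun t => exists u, u ∈ T /\ exists v, v ∈ T /\ exists r, r ∈ P /\
            t ≡ tri u v r /\ (forces_eq u v r \/ (u ≡ x /\ v ≡ y /\ r ≡ p))).
assert (HQ : dfn (fun e => Q (e 0))).
{ unfold Q, tri; dauto; apply dfn_forces_eq; dauto. }
set (S := sep (cprod (cprod T T) P) Q).
assert (HVS : V S) by (apply V_sep; auto; vtac).
assert (Htri : forall u v r u' v' r', tri u v r ≡ tri u' v' r' -> u ≡ u' /\ v ≡ v' /\ r ≡ r').
{ intros u v r u' v' r' H; apply opair_inj in H as [H H3]; apply opair_inj in H; tauto. }
assert (HSE : forall u v r, u ∈ T -> v ∈ T -> r ∈ P -> forces_eq u v r -> tri u v r ∈ S).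
{ intros u v r Hu Hv Hr H; unfold S; rewrite sepE_V by (auto; vtac); split.
  - unfold tri; rewrite !opair_cprod; auto.
  - exists u; split; auto; exists v; split; auto; exists r; split; auto; split; auto; reflexivity. }
split; auto; exists S; split; auto; split.
- unfold S; rewrite sepE_V by (auto; vtac); split; [unfold tri; rewrite !opair_cprod; auto|].
  exists x; split; auto; exists y; split; auto; exists p; split; auto; split; [reflexivity|].
  right; split; [|split]; reflexivity.
- assert (Hlift : forall u v r, u ∈ T -> v ∈ T -> halves forces_eq u v r ->
                    halves (fun a b c => tri a b c ∈ S) u v r).
  { intros u v r Hu Hv [Hh1 Hh2]; split.
    - intros u' Hu' q Hq Huq t Ht Hrt Hqt.
      destruct (Hh1 u' Hu' q Hq Huq t Ht Hrt Hqt) as [t' [H3 [H4 [v' [H5 [q' [H6 [H7 [H8 H9]]]]]]]]].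
      exists t'; split; auto; split; auto; exists v'; split; auto; exists q'; split; auto; split; auto.
      split; auto; apply HSE; auto; [apply (HTn u Hu _ q) | apply (HTn v Hv _ q')]; auto.
    - intros u' Hu' q Hq Huq t Ht Hrt Hqt.
      destruct (Hh2 u' Hu' q Hq Huq t Ht Hrt Hqt) as [t' [H3 [H4 [v' [H5 [q' [H6 [H7 [H8 H9]]]]]]]]].
      exists t'; split; auto; split; auto; exists v'; split; auto; exists q'; split; auto; split; auto.
      split; auto; apply HSE; auto; [apply (HTn u Hu _ q') | apply (HTn v Hv _ q)]; auto. }
  intros u Hu v Hv r Hr Hm; unfold S in Hm; rewrite sepE_V in Hm by (auto; vtac).
  destruct Hm as [Hm [u' [Hu' [v' [Hv' [r' [Hr' [He Hcase]]]]]]]].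
  unfold tri in Hm; rewrite !opair_cprod in Hm.
  apply Hlift; try tauto; apply Htri in He as [E1 [E2 E3]].
  assert (Hh : halves forces_eq u' v' r').
  { destruct Hcase as [Hc|[E4 [E5 E6]]]; [apply forces_eq_unfold; auto|].
    split.
    - intros a Ha q Hq Haq t Ht Hrt Hqt; rewrite E4 in Haq; rewrite E6 in Hrt.
      setoid_rewrite E5; apply (H1 a Ha q Hq Haq t Ht Hrt Hqt).
    - intros a Ha q Hq Haq t Ht Hrt Hqt; rewrite E5 in Haq; rewrite E6 in Hrt.
      setoid_rewrite E4; apply (H2 a Ha q Hq Haq t Ht Hrt Hqt). }
  destruct Hh as [Hh1 Hh2]; split.
  + intros a Ha q Hq Haq t Ht Hrt Hqt; rewrite E1 in Haq; rewrite E3 in Hrt.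
    setoid_rewrite E2; apply (Hh1 a Ha q Hq Haq t Ht Hrt Hqt).
  + intros a Ha q Hq Haq t Ht Hrt Hqt; rewrite E2 in Haq; rewrite E3 in Hrt.
    setoid_rewrite E1; apply (Hh2 a Ha q Hq Haq t Ht Hrt Hqt).
Qed.

Lemma forces_eq_mono x y p q : forces_eq x y p -> q ∈ P -> p ⊆ q -> forces_eq x y q.
Proof.
intros H Hq Hpq; pose proof (forces_eq_V H) as [Hx Hy].
apply forces_eq_unfold in H as [H1 H2]; apply forces_eq_fold; auto.
split; eapply half_mono; eauto.
Qed.

(** Genericity below a common extension of [p] and [q] finds the matching member. Induction on [x]
    alone covers both inclusions, as each matched pair has its first component inside [x]. *)
Lemma forces_eq_sound H x y p : generic V w1 H -> forces_eq x y p -> p ∈ H -> val H x ≡ val H y.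
Proof.
intros HG; revert y p; induction x as [x IH] using name_ind; intros y p Hf Hp.
pose proof (forces_eq_V Hf) as [HVx HVy]; apply forces_eq_unfold in Hf as [H1 H2].
pose proof (V_Add (V := V) (w1 := w1)) as HVP.
apply eqs_ext; intros z; rewrite !valE; split.
- intros [x' [q [Hq [Hxq Hz]]]]; pose proof (V_opl (V_mem HVx Hxq)) as HVx'.
  destruct (generic_dir HG Hp Hq) as [r [Hr [Hpr Hqr]]].
  destruct (@generic_below H (fun r' => exists y', V y' /\ exists q', q' ∈ P /\
    opair y' q' ∈ y /\ q' ⊆ r' /\ forces_eq x' y' r') r HG) as [r' [Hr' [y' [HVy' [q' [Hq' [Hyq [Hqr' Hf]]]]]]]].
  + dauto; apply dfn_forces_eq; dauto.
  + exact Hr.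
  + intros t Ht Hrt; apply (H1 x' HVx' q (generic_P HG Hq) Hxq t Ht);
      [exact (sub_trans Hpr Hrt) | exact (sub_trans Hqr Hrt)].
  + exists y', q'; split; [apply (generic_up HG Hr'); auto|]; split; auto.
    rewrite Hz; apply (IH x' q Hxq y' r'); auto.
- intros [y' [q [Hq [Hyq Hz]]]]; pose proof (V_opl (V_mem HVy Hyq)) as HVy'.
  destruct (generic_dir HG Hp Hq) as [r [Hr [Hpr Hqr]]].
  destruct (@generic_below H (fun r' => exists x', V x' /\ exists q', q' ∈ P /\
    opair x' q' ∈ x /\ q' ⊆ r' /\ forces_eq x' y' r') r HG) as [r' [Hr' [x' [HVx' [q' [Hq' [Hxq [Hqr' Hf]]]]]]]].
  + dauto; apply dfn_forces_eq; dauto.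
  + exact Hr.
  + intros t Ht Hrt; apply (H2 y' HVy' q (generic_P HG Hq) Hyq t Ht);
      [exact (sub_trans Hpr Hrt) | exact (sub_trans Hqr Hrt)].
  + exists x', q'; split; [apply (generic_up HG Hr'); auto|]; split; auto.
    rewrite Hz; symmetry; apply (IH x' q' Hxq y' r'); auto.
Qed.

Lemma forces_eq_complete H x y : generic V w1 H -> V x -> V y ->
  val H x ≡ val H y -> exists p, p ∈ H /\ forces_eq x y p.
Proof.
intros HG; revert y; induction x as [x IH] using name_ind; intros y HVx HVy Hxy.
pose proof (V_Add (V := V) (w1 := w1)) as HVP.
(* [N1 p]: some name that [p] puts into [x] is never forced equal, below [p], to a name put into
   [y]; [N2] is the mirror image. Densely often a condition forces equality or satisfies one of the
   two, and in [H] both are excluded by the induction hypothesis. *)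
set (N1 := fun p => exists x', V x' /\ exists q, q ∈ P /\ opair x' q ∈ x /\ q ⊆ p /\
  forall y', V y' -> forall q', q' ∈ P -> opair y' q' ∈ y ->
  forall r, r ∈ P -> p ⊆ r -> q' ⊆ r -> ~ forces_eq x' y' r).
set (N2 := fun p => exists y', V y' /\ exists q, q ∈ P /\ opair y' q ∈ y /\ q ⊆ p /\
  forall x', V x' -> forall q', q' ∈ P -> opair x' q' ∈ x ->
  forall r, r ∈ P -> p ⊆ r -> q' ⊆ r -> ~ forces_eq x' y' r).
destruct (@generic_below H (fun p => forces_eq x y p \/ N1 p \/ N2 p) empty HG) as [p [Hp HD]].
- unfold N1, N2; dauto; apply dfn_forces_eq; dauto.
- apply (generic_empty HG).
- intros p Hp _.
  destruct (classic (exists r, r ∈ P /\ p ⊆ r /\ (N1 r \/ N2 r))) as [[r [Hr [Hpr HN]]]|Hn].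
  { exists r; auto. }
  exists p; split; auto; split; [apply sub_refl|]; left.
  apply forces_eq_fold; auto; split.
  + intros x' Hx' q Hq Hxq r Hr Hpr Hqr; apply NNPP; intros Hc; apply Hn; exists r.
    split; auto; split; auto; left; exists x'; split; auto; exists q; split; auto; split; auto; split; auto.
    intros y' Hy' q' Hq' Hyq t Ht Hrt Hqt Hf; apply Hc; exists t; split; auto; split; auto.
    exists y'; split; auto; exists q'; auto.
  + intros y' Hy' q Hq Hyq r Hr Hpr Hqr; apply NNPP; intros Hc; apply Hn; exists r.
    split; auto; split; auto; right; exists y'; split; auto; exists q; split; auto; split; auto; split; auto.
    intros x' Hx' q' Hq' Hxq t Ht Hrt Hqt Hf; apply Hc; exists t; split; auto; split; auto.
    exists x'; split; auto; exists q'; auto.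
- destruct HD as [Hf|[HN|HN]]; [exists p; auto| |]; exfalso.
  + destruct HN as [x' [HVx' [q [Hq [Hxq [Hqp HN]]]]]].
    assert (Hm : val H x' ∈ val H x).
    { apply valE; exists x', q; split; [apply (generic_up HG Hp); auto|]; split; auto; reflexivity. }
    rewrite Hxy in Hm; apply valE in Hm as [y' [q' [Hq' [Hyq Heq]]]].
    pose proof (V_opl (V_mem HVy Hyq)) as HVy'.
    destruct (IH x' q Hxq y' HVx' HVy' Heq) as [r [Hr Hf]].
    destruct (generic_dir HG Hp Hr) as [t [Ht [H1 H2]]].
    destruct (generic_dir HG Ht Hq') as [u [Hu [H3 H4]]]; pose proof (generic_P HG Hu) as HuP.
    apply (HN y' HVy' q' (generic_P HG Hq') Hyq u HuP); auto; [exact (sub_trans H1 H3)|].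
    apply (forces_eq_mono Hf HuP), (sub_trans H2 H3).
  + destruct HN as [y' [HVy' [q [Hq [Hyq [Hqp HN]]]]]].
    assert (Hm : val H y' ∈ val H y).
    { apply valE; exists y', q; split; [apply (generic_up HG Hp); auto|]; split; auto; reflexivity. }
    rewrite <- Hxy in Hm; apply valE in Hm as [x' [q' [Hq' [Hxq Heq]]]].
    pose proof (V_opl (V_mem HVx Hxq)) as HVx'; symmetry in Heq.
    destruct (IH x' q' Hxq y' HVx' HVy' Heq) as [r [Hr Hf]].
    destruct (generic_dir HG Hp Hr) as [t [Ht [H1 H2]]].
    destruct (generic_dir HG Ht Hq') as [u [Hu [H3 H4]]]; pose proof (generic_P HG Hu) as HuP.
    apply (HN x' HVx' q' (generic_P HG Hq') Hxq u HuP); auto; [exact (sub_trans H1 H3)|].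
    apply (forces_eq_mono Hf HuP), (sub_trans H2 H3).
Qed.

(** Stricter than forced membership in the usual sense: [p] itself singles out the entry of [f],
    rather than densely many extensions doing so. A membership true in the extension still has such
    a witness in the filter. *)
Definition forces_mem (x f p : ens) : Prop :=
  exists y, V y /\ exists q, q ∈ P /\ opair y q ∈ f /\ q ⊆ p /\ forces_eq x y p.

Lemma dfn_forces_mem x y p : dft x -> dft y -> dft p ->
  dfn (fun e => forces_mem (x e) (y e) (p e)).
Proof.
intros Hx Hy Hp; unfold forces_mem; dauto; apply dfn_forces_eq; dauto.
Qed.

Lemma forces_mem_sound H x f p : generic V w1 H -> forces_mem x f p -> p ∈ H -> val H x ∈ val H f.
Proof.
intros HG [y [HVy [q [Hq [Hyq [Hqp Hf]]]]]] Hp; apply valE; exists y, q.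
split; [apply (generic_up HG Hp); auto|]; split; auto; apply (forces_eq_sound HG Hf Hp).
Qed.

Lemma forces_mem_complete H x f : generic V w1 H -> V x -> V f ->
  val H x ∈ val H f -> exists p, p ∈ H /\ forces_mem x f p.
Proof.
intros HG HVx HVf Hm; apply valE in Hm as [y [q [Hq [Hyq Heq]]]].
pose proof (V_opl (V_mem HVf Hyq)) as HVy.
destruct (forces_eq_complete HG HVx HVy Heq) as [p [Hp Hf]].
destruct (generic_dir HG Hp Hq) as [r [Hr [H1 H2]]]; exists r; split; auto.
exists y; split; auto; exists q; split; [apply (generic_P HG Hq)|]; split; auto; split; auto.
apply (forces_eq_mono Hf (generic_P HG Hr) H1).
Qed.

Lemma val_check H x : generic V w1 H -> val H (check x) ≡ x.
Proof.
intros HG; induction x as [x IH] using mem_ind; apply eqs_ext; intros z; rewrite valE; split.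
- intros [y [p [Hp [Hyp Hz]]]]; apply checkE in Hyp as [x' [Hx' H1]]; apply opair_inj in H1 as [H1 _].
  rewrite Hz, H1, IH; auto.
- intros Hz; exists (check z), empty; split; [apply (generic_empty HG)|]; split.
  + apply checkE; exists z; split; auto; reflexivity.
  + rewrite IH; auto; reflexivity.
Qed.

Lemma val_cn H a n : generic V w1 H ->
  (vnat n ∈ val H (cn a) <-> exists p, p ∈ H /\ opair (opair a (vnat n)) one ∈ p).
Proof.
intros HG; rewrite valE; split.
- intros [y [p [Hp [Hyp Hz]]]]; apply cnE in Hyp as [m [p' [_ [Hm H1]]]]; apply opair_inj in H1 as [H1 H2].
  rewrite H1, val_check in Hz by auto; apply vnat_inj in Hz; subst m.
  exists p; rewrite H2 at 2; rewrite H2 in Hp; split; auto; rewrite H2; auto.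
- intros [p [Hp Hn]]; exists (check (vnat n)), p; split; auto; split.
  + apply cnE; exists n, p; split; [apply (generic_P HG Hp)|]; split; auto; reflexivity.
  + rewrite val_check; auto; reflexivity.
Qed.

Lemma val_An H B z : generic V w1 H -> (z ∈ val H (An B) <-> exists a, a ∈ B /\ z ≡ val H (cn a)).
Proof.
intros HG; rewrite valE; split.
- intros [y [p [Hp [Hyp Hz]]]]; apply AnE in Hyp as [a [Ha H1]]; apply opair_inj in H1 as [H1 _].
  exists a; split; auto; rewrite Hz, H1; reflexivity.
- intros [a [Ha Hz]]; exists (cn a), empty; split; [apply (generic_empty HG)|]; split; auto.
  apply AnE; exists a; split; auto; reflexivity.
Qed.

Definition upn (x y : ens) : ens := upair (opair x empty) (opair y empty).
Definition opn (x y : ens) : ens := upn (upn x x) (upn x y).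

Lemma val_upn H x y : generic V w1 H -> val H (upn x y) ≡ upair (val H x) (val H y).
Proof.
intros HG; apply eqs_ext; intros z; rewrite valE, upairE; unfold upn; setoid_rewrite upairE; split.
- intros [u [p [Hp [[H1|H1] Hz]]]]; apply opair_inj in H1 as [H1 _]; rewrite H1 in Hz; auto.
- intros [Hz|Hz]; [exists x | exists y]; exists empty; (split; [apply (generic_empty HG)|]); split; auto;
    [left | right]; reflexivity.
Qed.

Lemma val_opn H x y : generic V w1 H -> val H (opn x y) ≡ opair (val H x) (val H y).
Proof. intros HG; unfold opn; rewrite !val_upn by auto; reflexivity. Qed.

Lemma dft_opn s t : dft s -> dft t -> dft (fun e => opn (s e) (t e)).
Proof. intros Hs Ht; unfold opn, upn; dauto. Qed.

Lemma fresh_nat l : exists N, forall n a i, opair (opair a (vnat n)) i ∈ fset l -> n < N.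
Proof.
induction l as [|x l [N HN]].
- exists 0; intros n a i H; destruct (not_mem_empty H).
- destruct (classic (exists m a i, x ≡ opair (opair a (vnat m)) i)) as [[m [a [i Hx]]]|Hx].
  + exists (N + S m); intros n b j H; cbn in H; rewrite cupE, upairE in H.
    assert (H' : opair (opair b (vnat n)) j ≡ x \/ opair (opair b (vnat n)) j ∈ fset l) by tauto.
    destruct H' as [H'|H']; [|apply HN in H'; lia].
    rewrite Hx in H'; apply opair_inj in H' as [H' _]; apply opair_inj in H' as [_ H'].
    apply vnat_inj in H'; lia.
  + exists N; intros n b j H; cbn in H; rewrite cupE, upairE in H.
    assert (H' : opair (opair b (vnat n)) j ≡ x \/ opair (opair b (vnat n)) j ∈ fset l) by tauto.
    destruct H' as [H'|H']; [|apply HN in H'; lia].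
    destruct Hx; exists n, b, j; symmetry; exact H'.
Qed.

Lemma zero_two : empty ∈ two.
Proof. apply (memvnat 2); exists 0; split; [lia | reflexivity]. Qed.

Lemma one_two : one ∈ two.
Proof. apply (memvnat 2); exists 1; split; [lia | reflexivity]. Qed.

(** Density: at a coordinate N beyond all those used by a condition, the value 1 can be prescribed
    for [a] and 0 for [b]. *)
Lemma cn_distinct H a b : generic V w1 H -> a ∈ w1 -> b ∈ w1 -> ~ a ≡ b ->
  ~ val H (cn a) ≡ val H (cn b).
Proof.
intros HG Ha Hb Hab Heq; pose proof (V_w1 (V := V)) as HW.
pose proof (V_mem HW Ha) as HVa; pose proof (V_mem HW Hb) as HVb.
destruct (@generic_below H (fun q => exists n, n ∈ omega /\ opair (opair a n) one ∈ q /\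
            opair (opair b n) empty ∈ q) empty HG) as [q [Hq [m [[n Hmn] [H1 H2]]]]].
- dauto.
- apply (generic_empty HG).
- intros p Hp _; destruct (P_list Hp) as [l [Hl Hpl]]; destruct (fresh_nat l) as [N HN].
  assert (Hno : forall c i, ~ opair (opair c (vnat N)) i ∈ p).
  { intros c i Hc; rewrite Hpl in Hc; apply HN in Hc; lia. }
  set (ta := opair (opair a (vnat N)) one); set (tb := opair (opair b (vnat N)) empty).
  assert (Hta : upair ta ta ∈ P) by (apply P_single; auto using vnat_omega, one_two).
  assert (Htb : upair tb tb ∈ P) by (apply P_single; auto using vnat_omega, zero_two).
  assert (Hpair : forall x t, x ∈ upair t t -> x ≡ t) by (intros x t; rewrite upairE; tauto).
  assert (Htab : cup (upair ta ta) (upair tb tb) ∈ P).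
  { apply P_cup; auto; intros c k i j Hi Hj; apply Hpair in Hi, Hj.
    apply opair_inj in Hi as [Hi _], Hj as [Hj _]; apply opair_inj in Hi as [Hi _], Hj as [Hj _].
    destruct Hab; rewrite <- Hi, <- Hj; reflexivity. }
  exists (cup p (cup (upair ta ta) (upair tb tb))); split; [|split].
  + apply P_cup; auto; intros c k i j Hi Hj; exfalso; rewrite cupE in Hj.
    destruct Hj as [Hj|Hj]; apply Hpair in Hj; apply opair_inj in Hj as [Hj _];
      apply opair_inj in Hj as [_ Hj]; rewrite Hj in Hi; apply (Hno _ _ Hi).
  + intros z Hz; rewrite cupE; auto.
  + exists (vnat N); split; [apply vnat_omega|]; rewrite !cupE, !upairE; split.
    * right; left; left; reflexivity.
    * right; right; left; reflexivity.
- cbn [elt omega] in Hmn; rewrite Hmn in H1, H2.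
  assert (Hm : vnat n ∈ val H (cn b)) by (rewrite <- Heq; apply val_cn; auto; exists q; auto).
  apply val_cn in Hm as [p [Hp Hpn]]; auto.
  destruct (generic_dir HG Hp Hq) as [r [Hr [H3 H4]]].
  pose proof (generic_P HG Hr) as HrP; apply AddE in HrP as [_ [_ [_ Hfun]]].
  assert (E : vnat 1 ≡ vnat 0) by (apply (Hfun (opair b (vnat n))); [apply H3 | apply H4]; auto).
  apply vnat_inj in E; discriminate.
Qed.

Lemma cond_support p : p ∈ P ->
  exists l, Forall V l /\ forall a n i, opair (opair a n) i ∈ p -> a ∈ fset l.
Proof.
intros Hp; destruct (P_list Hp) as [l [Hl Hpl]].
destruct (@list_image V (fun t z => exists n i, t ≡ opair (opair z n) i) l) as [l' [Hl' H]].
- intros x x' z Hx [n [i H]]; exists n, i; rewrite <- Hx; exact H.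
- intros x Hx; rewrite <- Hpl in Hx; pose proof (P_box Hp Hx) as Hb.
  apply boxE in Hb as [a [n [i [Ha [_ [_ Hxa]]]]]].
  exists a; split; [apply (V_mem V_w1 Ha)|]; intros z; split.
  + intros [n' [i' Hz]]; rewrite Hxa in Hz; apply opair_inj in Hz as [Hz _].
    apply opair_inj in Hz as [Hz _]; symmetry; exact Hz.
  + intros Hz; exists n, i; rewrite Hz; exact Hxa.
- exists l'; split; auto; intros a n i Ha; apply H; exists (opair (opair a n) i); split.
  + rewrite <- Hpl; exact Ha.
  + exists n, i; reflexivity.
Qed.

Lemma dft_swap s t : dft s -> dft t -> dft (fun e => swap (s e) (t e)).
Proof. intros Hs Ht; pose proof (V_w1 (V := V)); unfold swap; dauto. Qed.

(** Turns membership of the swapped [p] in a filter into membership of [p] in the swapped filter. *)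
Lemma act_swap_involutive a b p : a ∈ w1 -> b ∈ w1 -> p ⊆ cond_box w1 ->
  act (swap a b) (act (swap a b) p) ≡ p.
Proof.
intros Ha Hb Hp; pose proof (V_mem V_w1 Ha) as HVa; pose proof (V_mem V_w1 Hb) as HVb.
pose proof (swap_Sym Ha Hb) as Hs; rewrite <- (act_inv Hs Hp) at 2; apply act_proper; [|reflexivity].
assert (Hsym : forall x y, opair x y ∈ swap a b -> opair y x ∈ swap a b).
{ intros x y H; apply swapE in H as [Hx [Hy H]]; auto; apply swapE; auto; split; auto; split; auto.
  destruct H as [H|[H|[H1 [H2 H3]]]]; [tauto|tauto|].
  right; right; rewrite H3; split; auto; split; auto; reflexivity. }
apply Sym_eqs; auto; [apply perm_inv_Sym; auto|]; intros x y; rewrite perm_invE by auto; split; apply Hsym.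
Qed.

(* Choosing [b] by genericity puts [p] itself in the permuted filter, so no pair of
   compatible conditions has to be considered. *)
Lemma generic_swap H E a p : generic V w1 H -> V E -> countable_in V E -> a ∈ w1 -> p ∈ H ->
  exists b, b ∈ w1 /\ ~ b ∈ E /\ ~ b ≡ a /\ p ∈ rep H (act (swap a b)).
Proof.
intros HG HVE HC Ha Hp; pose proof (V_w1 (V := V)) as HW; pose proof (V_mem HW Ha) as HVa.
pose proof (generic_P HG Hp) as HpP; pose proof (P_V HpP) as HVp; pose proof (P_box HpP) as Hpb.
destruct (@generic_below H (fun q => exists b, b ∈ w1 /\ ~ b ∈ E /\ ~ b ≡ a /\
            act (swap a b) p ⊆ q) p HG) as [q [Hq [b [Hb [HbE [Hba Hbq]]]]]].
- dauto; apply dft_swap; dauto.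
- exact Hp.
- intros r Hr Hpr; destruct (cond_support Hr) as [l [Hl Hsup]].
  destruct (@fresh V w1 M E (a :: l) HVE HC) as [b [Hb [HbE Hbl]]]; [constructor; auto|].
  rewrite fsetE, Exists_cons, <- fsetE in Hbl.
  pose proof (V_mem HW Hb) as HVb; pose proof (swap_Sym Ha Hb) as Hs.
  exists (cup (act (swap a b) p) r); split; [|split].
  + apply P_cup; auto; [apply act_Add; auto|]; intros c n i j Hi Hj.
    apply actE in Hi as [d [Hdc Hi]]; auto; apply swapE in Hdc as [_ [_ Hdc]]; auto.
    (* Compatibility of the swapped [p] with [r]: a coordinate moved from [a] to [b] does not meet
       [r], as [b] is outside its support; none moves from [b], as p ⊆ r; the unmoved ones agree
       with [r]. *)
    apply Hpr in Hi; destruct Hdc as [[H1 H2]|[[H1 H2]|[H1 [H2 H3]]]].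
    * rewrite H2 in Hj; apply Hsup in Hj; tauto.
    * rewrite H1 in Hi; apply Hsup in Hi; tauto.
    * rewrite H3 in Hj; apply AddE in Hr as [_ [_ [_ Hfun]]]; apply (Hfun (opair d n)); auto.
  + intros z Hz; rewrite cupE; auto.
  + exists b; split; auto; split; auto; split; [tauto|]; intros z Hz; rewrite cupE; auto.
- exists b; split; auto; split; auto; split; auto; apply rep_actE.
  exists (act (swap a b) p); split.
  + apply (generic_up HG Hq); auto; apply act_Add; auto; apply swap_Sym; auto.
  + rewrite act_swap_involutive; auto; reflexivity.
Qed.

End Generic.

(** * The symmetric extension *)

Lemma upair_in_eqs (D : ens -> Prop) z x y : transitive_class D ->
  D z -> D x -> D y -> upair_in D z x y -> z ≡ upair x y.
Proof.
intros HD Hz Hx Hy H; apply eqs_ext; intros w; rewrite upairE; split; intros Hw.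
- apply H; auto; apply (HD z w); auto.
- assert (Hxy : w ∈ upair x y) by (rewrite upairE; auto).
  destruct Hw as [Hw|Hw]; rewrite Hw; apply H; auto; [left|right]; reflexivity.
Qed.

Lemma rel_inE (D : ens -> Prop) R x y : transitive_class D -> D R -> D x -> D y ->
  (rel_in D R x y <-> opair x y ∈ R).
Proof.
intros HD HR Hx Hy; split.
- intros [z [Hz [HzR [a [b [Ha [Hb [H1 [H2 H3]]]]]]]]].
  apply upair_in_eqs in H1, H2, H3; auto; rewrite H3, H1, H2 in HzR; exact HzR.
- intros H; pose proof (HD _ _ HR H) as Hp; exists (opair x y); split; auto; split; auto.
  exists (upair x x), (upair x y); split; [|split].
  + apply (HD _ _ Hp); unfold opair; rewrite upairE; left; reflexivity.
  + apply (HD _ _ Hp); unfold opair; rewrite upairE; right; reflexivity.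
  + split; [|split]; intros w _; apply upairE.
Qed.

Section Extension.
Context {V : ens -> Prop} {w1 : ens} {M : ground V w1}.
Variable G : ens.
Hypothesis HG : generic V w1 G.
Notation dfn := (dfn (V := V)).
Notation dft := (dft (V := V)).
Notation P := (Add V w1).
Notation act := (act_cond w1).
Notation cn := (c_name V w1).
Notation An := (An (V := V) (w1 := w1)).
Notation swap := (swap (w1 := w1)).
Notation N := (sym_ext V w1 G).

Lemma N_trans : transitive_class N.
Proof.
intros x y [n [Hn Hx]] Hy; rewrite Hx in Hy; apply valE in Hy as [m [p [_ [Hm Hy]]]].
destruct Hn as [_ Hn _]; destruct (Hn _ Hm) as [m' [p' [H [_ Hm']]]].
apply opair_inj in H as [H _]; exists m'; split; auto; rewrite Hy, H; reflexivity.
Qed.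

Lemma N_val x : HS V w1 x -> N (val G x).
Proof. intros H; exists x; split; auto; reflexivity. Qed.

Lemma HS_support x : HS V w1 x -> V x /\ exists E, V E /\ E ⊆ w1 /\ countable_in V E /\
  Fix_ V w1 E ⊆ Stab V w1 x.
Proof. intros [Hx _ Hf]; split; auto; apply filter_support, Hf. Qed.

Lemma cocountable_diff E : V E -> countable_in V E -> cocountable (V := V) (w1 := w1) (diff w1 E).
Proof.
intros HE HC; pose proof (V_w1 (V := V)) as HW.
split; [apply V_diff; auto|]; split; [apply sep_sub|].
apply (countable_sub (y := E)); auto; [apply V_diff; auto; apply V_diff; auto|].
intros z Hz; rewrite !diffE in Hz; apply NNPP; tauto.
Qed.

Lemma diff_inhabited E : V E -> countable_in V E -> exists b, b ∈ diff w1 E.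
Proof.
intros HE HC; destruct (@fresh V w1 M E nil HE HC) as [b [Hb [Hn _]]]; [constructor|].
exists b; apply diffE; auto.
Qed.

Section Swap.
Variables E a b : ens.
Hypothesis HaE : a ∈ diff w1 E.
Hypothesis HbE : b ∈ diff w1 E.

Let Ha : a ∈ w1.
Proof. apply diffE in HaE; tauto. Qed.

Let Hb : b ∈ w1.
Proof. apply diffE in HbE; tauto. Qed.

Let HG' : G ⊆ P.
Proof. intros p; apply (generic_P HG). Qed.

Lemma swap_fix c : c ∈ w1 -> ~ c ∈ diff w1 E -> opair c c ∈ swap a b.
Proof.
intros Hc Hn; pose proof (V_mem V_w1 Ha); pose proof (V_mem V_w1 Hb).
apply swapE; auto; split; auto; split; auto; right; right.
split; [|split; [|reflexivity]]; intros H'; apply Hn; rewrite H'; auto.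
Qed.

(** The transposition of two points outside [E] lies in the stabilizer of [x]; [val_act] then
    compares the two filters at the same name. *)
Lemma val_swap_supported x : E ⊆ w1 -> Fix_ V w1 E ⊆ Stab V w1 x ->
  val (rep G (act (swap a b))) x ≡ val G x.
Proof.
intros HE HF; pose proof (swap_Sym Ha Hb) as Hs.
assert (H : act_name V w1 (swap a b) x ≡ x).
{ apply (StabE (w1 := w1)), HF, FixE; split; auto; intros c Hc; apply swap_fix; auto.
  rewrite diffE; tauto. }
rewrite <- (val_act x Hs HG'), H; reflexivity.
Qed.

Lemma val_swap_An : val (rep G (act (swap a b))) (An (diff w1 E)) ≡ val G (An (diff w1 E)).
Proof.
pose proof (swap_Sym Ha Hb) as Hs; assert (HB : diff w1 E ⊆ w1) by apply sep_sub.
rewrite <- (val_act (An (diff w1 E)) Hs HG'), (actn_An Hs HB), (img_fix Hs HB); [reflexivity|].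
intros c Hc; apply diffE in Hc; apply swap_fix; tauto.
Qed.

Lemma val_swap_l : val (rep G (act (swap a b))) (cn a) ≡ val G (cn b).
Proof.
pose proof (swap_Sym Ha Hb) as Hs; pose proof (V_mem V_w1 Ha); pose proof (V_mem V_w1 Hb).
rewrite <- (val_act (cn b) Hs HG'), (actn_cn (a := b) (b := a) Hs); [reflexivity|].
apply swapE; auto; split; auto; split; auto; right; left; split; reflexivity.
Qed.

Lemma val_swap_r : val (rep G (act (swap a b))) (cn b) ≡ val G (cn a).
Proof.
pose proof (swap_Sym Ha Hb) as Hs; pose proof (V_mem V_w1 Ha); pose proof (V_mem V_w1 Hb).
rewrite <- (val_act (cn a) Hs HG'), (actn_cn (a := a) (b := b) Hs); [reflexivity|].
apply swapE; auto; split; auto; split; auto; left; split; reflexivity.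
Qed.

End Swap.

Lemma V_opn x y : V x -> V y -> V (opn x y).
Proof. intros; unfold opn, upn; vtac. Qed.

Lemma N_cn a : a ∈ w1 -> N (val G (cn a)).
Proof. intros Ha; apply N_val, HS_cn, Ha. Qed.

Lemma not_AC : ~ AC_in N.
Proof.
intros HAC; pose proof (V_w1 (V := V)) as HW.
destruct (family_name (V := V) (w1 := w1)) as [X [HX HXE]].
assert (HXm : forall y, y ∈ val G X <-> exists B, cocountable (V := V) (w1 := w1) B /\ y ≡ val G (An B)).
{ intros y; rewrite valE; setoid_rewrite HXE; split.
  - intros [n [p [_ [[B [HB H]] Hy]]]]; apply opair_inj in H as [H _].
    exists B; split; auto; rewrite Hy, H; reflexivity.
  - intros [B [HB Hy]]; exists (An B), empty; split; [apply (generic_empty HG)|]; split; auto.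
    exists B; split; auto; reflexivity. }
destruct (HAC (val G X) (N_val HX)) as [f [[f' [Hf' Hff']] [_ [Hfun Hch]]]].
(* Each member is nonempty: a fresh point avoids the countable complement of [B]. *)
{ intros y _ Hy; apply HXm in Hy as [B [[HVB [HBw HC]] Hy]].
  destruct (@fresh V w1 M (diff w1 B) nil) as [b [Hb [Hn _]]]; auto; [apply V_diff; auto|].
  rewrite diffE in Hn; exists (val G (cn b)); split; [apply N_cn; auto|].
  rewrite Hy; apply val_An; auto; exists b; split; [apply NNPP; tauto | reflexivity]. }
assert (HNf : N f) by (exists f'; auto).
destruct (HS_support Hf') as [HVf' [E [HVE [HEw [HCE HFix]]]]].
pose proof (cocountable_diff HVE HCE) as HB; set (B := diff w1 E) in *.
assert (HS : val G (An B) ∈ val G X) by (apply HXm; exists B; split; auto; reflexivity).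
assert (HNS : N (val G (An B))) by (apply (N_trans (N_val HX) HS)).
destruct (Hch _ HNS HS) as [z [HNz [Hz Hrel]]].
apply val_An in Hz as [a [Ha Hz]]; auto.
pose proof Hrel as Hpair; rewrite rel_inE in Hpair by (auto using N_trans).
pose proof Ha as Ha'; unfold B in Ha'; apply diffE in Ha' as [Haw HaE].
pose proof (V_mem HW Haw) as HVa.
assert (HVn : V (opn (An B) (cn a))) by (apply V_opn; [apply V_An, HB | apply V_cn; auto]).
destruct (forces_mem_complete HG HVn HVf') as [p [Hp Hforce]].
{ rewrite (val_opn _ _ HG), <- Hz, <- Hff'; exact Hpair. }
destruct (generic_swap HG HVE HCE Haw Hp) as [b [Hb [HbE [Hba Hp']]]].
assert (HbB : b ∈ B) by (apply diffE; auto).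
pose proof (generic_act (swap_Sym Haw Hb) HG) as HG'.
(* The same forced membership is evaluated in the swapped filter: the values of [f'] and [An B]
   persist while [cn a] now denotes the real of [b], so [f] takes two values at one argument. *)
pose proof (forces_mem_sound HG' Hforce Hp') as Hm; rewrite (val_opn _ _ HG') in Hm.
unfold B in Hm; rewrite (val_swap_An Ha HbB), (val_swap_l Ha HbB),
  (val_swap_supported Ha HbB HEw HFix), <- Hff' in Hm.
apply (cn_distinct HG Haw Hb); [intros H; apply Hba; symmetry; exact H|].
rewrite <- Hz; apply (Hfun _ _ _ HNS HNz (N_cn Hb)); auto.
apply rel_inE; auto using N_trans, N_cn.
Qed.

Lemma not_wellorderable : ~ wellorderable_in N (val G (An w1)).
Proof.
intros [R [[R' [HR' HRR']] [_ [Hirr [Htrans [_ Hmin]]]]]]; pose proof (V_w1 (V := V)) as HW.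
assert (HNR : N R) by (exists R'; auto).
destruct (HS_support HR') as [HVR' [E [HVE [HEw [HCE HFix]]]]].
pose proof (cocountable_diff HVE HCE) as HB; set (B := diff w1 E) in *.
assert (HNS : N (val G (An B))) by (apply N_val, HS_An; apply HB).
assert (HA : forall c, c ∈ w1 -> val G (cn c) ∈ val G (An w1)).
{ intros c Hc; apply val_An; auto; exists c; split; auto; reflexivity. }
destruct (Hmin (val G (An B)) HNS) as [m [HNm [Hm Hleast]]].
{ intros y _ Hy; apply val_An in Hy as [c [Hc Hy]]; auto; rewrite Hy; apply HA, HB, Hc. }
{ destruct (diff_inhabited HVE HCE) as [c Hc]; exists (val G (cn c)); split; [apply N_cn, HB, Hc|].
  apply val_An; auto; exists c; split; auto; reflexivity. }
apply val_An in Hm as [a [Ha Hm]]; auto.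
pose proof Ha as Ha'; unfold B in Ha'; apply diffE in Ha' as [Haw HaE].
pose proof (V_mem HW Haw) as HVa.
assert (Hless : forall b, b ∈ B -> ~ b ≡ a -> opair (val G (cn a)) (val G (cn b)) ∈ R).
{ intros b Hb Hba; assert (Hbw : b ∈ w1) by (apply HB, Hb).
  destruct (Hleast (val G (cn b)) (N_cn Hbw)) as [H|H].
  - apply val_An; auto; exists b; split; auto; reflexivity.
  - destruct (cn_distinct HG Hbw Haw Hba); rewrite <- Hm, H; reflexivity.
  - rewrite rel_inE in H by (auto using N_trans, N_cn); rewrite Hm in H; exact H. }
pose proof (V_Add (V := V) (w1 := w1)) as HVP; pose proof (V_diff HW HVE) as HVB; fold B in HVB.
set (F := fun b p => forces_mem (V := V) (w1 := w1) (opn (cn a) (cn b)) R' p).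
(* One condition must handle all [b] at once, since the [b] of the swap is chosen after it. [T1 p]:
   below [p], some [b] is never forced to be above [a]. [T2 p]: for each [b] this is forced densely
   below [p], the dense form making up for the strictness of [forces_mem]. One of them holds on a
   dense set. *)
set (T1 := fun p => exists b, b ∈ B /\ ~ b ≡ a /\ forall r, r ∈ P -> p ⊆ r -> ~ F b r).
set (T2 := fun p => forall b, b ∈ B -> ~ b ≡ a -> forall r, r ∈ P -> p ⊆ r ->
             exists r', r' ∈ P /\ r ⊆ r' /\ F b r').
assert (HF : forall s t, dft s -> dft t -> dfn (fun e => F (s e) (t e))).
{ intros s t Hs Ht; unfold F; apply dfn_forces_mem; auto; [|dauto].
  apply dft_opn; apply dft_cn; dauto. }
destruct (@generic_below V w1 M G (fun p => T1 p \/ T2 p) empty HG) as [p [Hp HT]].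
- unfold T1, T2; dauto; apply HF; dauto.
- apply (generic_empty HG).
- intros p Hp _; destruct (classic (exists r, r ∈ P /\ p ⊆ r /\ T1 r)) as [[r [Hr [Hpr HT]]]|Hn].
  { exists r; auto. }
  exists p; split; auto; split; [apply sub_refl|]; right; intros b Hb Hba r Hr Hpr.
  apply NNPP; intros Hc; apply Hn; exists r; split; auto; split; auto; exists b; split; auto; split; auto.
  intros t Ht Hrt Hf; apply Hc; exists t; auto.
- destruct HT as [[b [Hb [Hba HT]]]|HT].
  (* [T1] cannot hold in G: minimality of [a] gives a condition of G forcing the pair into the
     relation, and a common extension contradicts [T1]. *)
  + assert (Hbw : b ∈ w1) by (apply HB, Hb); pose proof (V_mem HW Hbw) as HVb.
    destruct (@forces_mem_complete V w1 M G (opn (cn a) (cn b)) R' HG) as [q [Hq Hf]]; auto.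
    * apply V_opn; apply V_cn; auto.
    * rewrite (val_opn _ _ HG), <- HRR'; auto.
    * destruct (generic_dir HG Hp Hq) as [r [Hr [Hpr Hqr]]]; pose proof (generic_P HG Hr) as HrP.
      apply (HT r HrP Hpr); destruct Hf as [y [Hy [q' [Hq' [Hyq [Hqq Hf]]]]]].
      exists y; split; auto; exists q'; split; auto; split; auto; split; [exact (sub_trans Hqq Hqr)|].
      apply (forces_eq_mono Hf HrP Hqr).
  + destruct (generic_swap HG HVE HCE Haw Hp) as [b [Hb [HbE [Hba Hp']]]].
    assert (HbB : b ∈ B) by (apply diffE; auto); pose proof (V_mem HW Hb) as HVb.
    pose proof (generic_act (swap_Sym Haw Hb) HG) as HG'.
    (* [p] also lies in the swapped filter, so genericity of that filter below [p] yields a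
       condition forcing the pair for this [b]. Read there, it says that the real of [b] precedes
       that of [a]; with minimality, transitivity contradicts irreflexivity. *)
    destruct (@generic_below V w1 M _ (fun r => F b r) p HG') as [q [Hq Hf]]; auto.
    { apply HF; dauto. }
    pose proof (forces_mem_sound HG' Hf Hq) as Hmem; rewrite (val_opn _ _ HG') in Hmem.
    rewrite (val_swap_l Ha HbB), (val_swap_r Ha HbB),
      (val_swap_supported Ha HbB HEw HFix), <- HRR' in Hmem.
    apply (Hirr (val G (cn a)) (N_cn Haw) (HA a Haw)).
    apply (Htrans _ (val G (cn b)) _); auto using N_cn;
      apply rel_inE; auto using N_trans, N_cn.
Qed.

End Extension.

Theorem proposition3p21 (V : ens -> Prop) (w1 G0 : ens)
  (V_transitive : transitive_class V)
  (V_ZFC : ZFC_in V)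
  (w1_omega1 : is_omega1 V w1)
  (G0_generic : generic V w1 G0) :
  let N := sym_ext V w1 G0 in
  let A := val G0 (A_name V w1) in
  N A /\ ~ wellorderable_in N A /\ ~ WO_in N /\ ~ AC_in N.
Proof.
assert (M : ground V w1) by (split; [split|]; assumption).
change (A_name V w1) with (An (V := V) (w1 := w1) w1); intros N A.
assert (HA : N A).
{ apply N_val, HS_An; [apply V_w1 | apply sub_refl|].
  (* The complement of [w1] in itself is empty, so the name of A has empty support. *)
  apply (countable_sub (y := empty)); [apply V_diff; apply V_w1 | | apply countable_empty].
  intros z Hz; rewrite diffE in Hz; tauto. }
pose proof (not_wellorderable G0_generic) as Hw.
split; auto; split; auto; split; [|apply not_AC; auto].
intros HWO; exact (Hw (HWO A HA)).
Qed.
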